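(* For an integer $n\ge 0$ let $A(n)$ denote the number of partitions of $n$ into distinct parts each congruent to $1$ or $2$ modulo $3$. Then $$\frac{x}{(\log x)^{11/12}} \ll \#\{0\le n\le x : A(2n+1)\ \text{is odd}\}\ll \frac{x}{(\log x)^{1/2}},$$ i.e. there exist constants $c, C>0$ and $x_0>1$ such that for all real $x\ge x_0$, $$c\,\frac{x}{(\log x)^{11/12}} \le \#\{n\in\mathbb{Z} : 0\le n\le x,\ A(2n+1)\ \text{is odd}\}\le C\,\frac{x}{(\log x)^{1/2}}.$$
   Context: A partition of $n$ into distinct parts congruent to $1$ or $2$ modulo $3$ is a finite set of pairwise distinct positive integers, none divisible by $3$, whose sum is $n$. The notation $F(x)\ll G(x)$ means that there is an absolute constant $C>0$ with $F(x)\le C\,G(x)$ for all sufficiently large real $x$. *)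

(* Defs.v *)
From mathcomp Require Import all_boot all_order all_algebra finmap.
From mathcomp Require Import all_classical all_reals all_analysis.
Set Implicit Arguments.
Unset Strict Implicit.
Unset Printing Implicit Defensive.
Import Order.TTheory GRing.Theory Num.Theory.
Local Open Scope classical_set_scope.
Local Open Scope ring_scope.

(* The parts of a partition of n are at most n, so a set of parts is a set of
   elements of 'I_n.+1; the part 0 is excluded by the congruence condition. *)
Definition is_distinct12_partition (n : nat) (S : {set 'I_n.+1}) : bool :=
  [forall i in S, (i %% 3 == 1)%N || (i %% 3 == 2)%N] &&
  (\sum_(i in S) (i : nat) == n)%N.

Definition A (n : nat) : nat :=
  #|[set S : {set 'I_n.+1} | is_distinct12_partition S]%SET|.

Definition odd_set (R : realType) (x : R) : set nat :=
  [set n : nat | n%:R <= x /\ odd (A (2 * n + 1))].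

(* fset_set is set0 on infinite sets; this shows that case does not arise. *)
Lemma finite_odd_set (R : realType) (x : R) : finite_set (odd_set x).
Proof.
apply: (@sub_finite_set _ _ `I_(Num.truncn x).+1) => [n [nx _] /=|].
  by rewrite ltnS truncn_ge_nat // (le_trans _ nx).
exact: finite_II.
Qed.

Definition odd_count (R : realType) (x : R) : nat :=
  #|` fset_set (odd_set x) |%fset.

(* Main.v *)
Require Import Defs.
From mathcomp Require Import all_boot all_order all_algebra all_fingroup all_field finmap.
From mathcomp Require Import all_classical all_reals all_analysis.
From mathcomp Require Import zify ring lra.
Set Implicit Arguments.
Unset Strict Implicit.
Unset Printing Implicit Defensive.
Import Order.TTheory GRing.Theory Num.Theory.
Local Open Scope ring_scope.

(** Write f_k for the product of the 1 - q^(k m) over m >= 1.  Modulo 2 the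
    generating function of A is f_1 / f_3.  Over F_2 the triple product gives
    two theta series: f_1 is the sum of the q^((a^2 - 1) / 24) over a prime to 6,
    and T = f_3^3 / f_1 is the sum of the q^((a^2 - 1) / 3) over a prime to 3.
    Since f_1 / f_3 = T f_1^2 / f_3^4 and the other factors are series in q^2, the
    odd part of f_1 / f_3 comes from that of T, which is q T(q^2)^2 = q T(q^4);
    hence the sum of the A (2 n + 1) q^n is f_3 T modulo 2 ([A_sum_sqr]).  In other words A (2 n + 1)
    has the parity of the number of solutions of 2 x^2 + 3 y^2 = 24 n + 11 in
    positive integers prime to 3.

    Count the solutions of x^2 + 6 y^2 = N and 2 x^2 + 3 y^2 = N, the two forms of
    discriminant -24, with the weight 0, 2 or -1 according to divisibility of x
    and y by 3.  This weight is a cubic ring class character added to its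
    conjugate, so the resulting function [qcoef] is a Hecke eigenform of weight
    one: qcoef (p n) = qcoef p * qcoef n - chi p * qcoef (n / p), with chi the
    quadratic character of -6 ([qcoef_Hecke]).  Modulo 2 the weights 0 and 2
    disappear and A (2 n + 1) has the parity of qcoef (24 n + 11) ([odd_A]).
    Moreover, for primes p > 3, qcoef p is 2 or -1 when chi p = 1, and 0 when
    chi p = -1.

    Lower bound.  A product of distinct primes with qcoef p = -1 has odd qcoef,
    and these primes have density 1/3: indeed 1 + chi p - qcoef p is 3 at them
    and 0 at all other primes above 3, so the logarithmic density follows from
    Mertens estimates for 1, chi and qcoef ([cubic_nonsplit_window]).  For chi
    and qcoef these rest on square-root cancellation in the partial sums and on
    the nonvanishing at 1 of the Dirichlet series, which is elementary for chi
    and for qcoef comes from the nonnegativity of the coefficients 1 * qcoef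
    ([qcoef_hsum_lower]).  The sum of 1 / m over the integers m so obtained up to
    z exceeds a multiple of (ln z)^(1/12) ([gsum_lower]): going from z to z^3
    multiplies it by at least 11/10, and 3^(1/12) <= 11/10.  One more prime factor
    turns this into a count of integers up to X of order at least
    X / (ln X)^(11/12)
    ([good_count_lower]).  A factor 1, 5, 7 or 11 moves each of them to the
    residue class 11 modulo 24.

    Upper bound.  If A (2 n + 1) is odd then 24 n + 11 is represented by one of
    the forms, so it is a square times an integer m with chi p = 1 for all primes
    p dividing m.  The square of the sum of 1 / m over these m up to Y is at most
    the sum of (1 * chi)(n) / n over n <= Y^2, which is O(ln Y); weighting the
    integers by their logarithm then bounds their number up to X by
    O(X / sqrt (ln X)) ([sqrsplit_count_upper]). *)

(** * The quadratic character of -6 *)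

(** The Kronecker symbol of discriminant -24. *)
Definition chi (n : nat) : int :=
  if (n %% 24)%N \in [:: 1; 5; 7; 11]%N then 1
  else if (n %% 24)%N \in [:: 13; 17; 19; 23]%N then -1 else 0.

Lemma chi_modn n : chi (n %% 24) = chi n.
Proof. by rewrite /chi modn_mod. Qed.

Lemma chiM m n : chi (m * n) = chi m * chi n.
Proof.
rewrite -[chi m]chi_modn -[chi n]chi_modn -[LHS]chi_modn -modnMm chi_modn.
have /allP/(_ (m %% 24)%N) h : all (fun a => all (fun b =>
  chi (a * b) == chi a * chi b) (iota 0 24)) (iota 0 24) by vm_compute.
by apply/eqP/(allP (h _)); rewrite mem_iota ltn_pmod.
Qed.

Lemma chi_prime p : prime p -> (3 < p)%N -> (chi p == 1) || (chi p == -1).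
Proof.
move=> pr p3; have n2 : ~~ (2 %| p)%N.
  by apply/negP => /(prime_nt_dvdP pr (isT : 2 != 1))%N h; rewrite -h in p3.
have n3 : ~~ (3 %| p)%N.
  by apply/negP => /(prime_nt_dvdP pr (isT : 3 != 1))%N h; rewrite -h in p3.
rewrite /chi; move: n2 n3; have -> : (2 %| p)%N = (2 %| p %% 24)%N by lia.
have -> : (3 %| p)%N = (3 %| p %% 24)%N by lia.
have := ltn_pmod p (isT : (0 < 24)%N); move: (p %% 24)%N => a.
by do 24 (case: a => [|a] //).
Qed.

(** The hypothesis on z is the vanishing of the 24th cyclotomic polynomial,
    and t is the sum of the z^a over the a with chi a = 1. The p-th power map
    multiplies the exponents by p; when chi p = -1 it sends them to the other
    class of residues, which is the first one shifted by 12, and z^12 = -1. *)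
Lemma Frobenius_sqrt_m6 (K : fieldType) p (chp : p \in [pchar K]) (z : K) :
  (3 < p)%N -> z ^+ 8 = z ^+ 4 - 1 ->
  let t := z + z ^+ 5 + z ^+ 7 + z ^+ 11 in
  t ^+ 2 = - 6%:R /\ t ^+ p = t *~ chi p.
Proof.
move=> p3 z8 t; have pr := pcharf_prime chp.
have z12 : z ^+ 12 = -1.
  by rewrite (_ : 12 = 8 + 4)%N // exprD z8 mulrBl mul1r -exprD z8; ring.
have z24 : z ^+ 24 = 1.
  by rewrite (_ : 24 = 12 + 12)%N // exprD z12 mulrNN mulr1.
split.
  suff : t ^+ 2 + 6%:R = 0 by move/eqP; rewrite addr_eq0 => /eqP.
  (* the left-hand side is the 24th cyclotomic polynomial times this cofactor *)
  transitivity ((z ^+ 8 - z ^+ 4 + 1) *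
    (6%:R + z ^+ 2 + z ^+ 4 *+ 6 + z ^+ 6 *+ 3 + z ^+ 8 *+ 2 + z ^+ 10 *+ 3 + z ^+ 14)).
    by rewrite /t; ring.
  by rewrite z8 (_ : _ - _ + 1 = 0) ?mul0r //; ring.
have expm n : z ^+ n = z ^+ (n %% 24).
  by rewrite {1}(divn_eq n 24) exprD mulnC exprM z24 expr1n mul1r.
have -> : t ^+ p = z ^+ (p %% 24) + z ^+ (5 * (p %% 24) %% 24)
    + z ^+ (7 * (p %% 24) %% 24) + z ^+ (11 * (p %% 24) %% 24).
  by rewrite !modnMmr -!expm !exprM -!(pFrobenius_autE chp) /t !rmorphD.
have h k : z ^+ (12 + k) = - z ^+ k by rewrite exprD z12 mulN1r.
have := chi_prime pr p3; rewrite /chi.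
move: (p %% 24)%N => a; rewrite /t.
case: ifP => [+ _|_]; last case: ifP => [+ _|_ /orP[] //].
  by rewrite !inE => /or4P[] /eqP ->; 
  do 3! match goal with |- context [modn ?x 24] =>
    let v := eval vm_compute in (modn x 24) in change (modn x 24) with v end; ring.
rewrite !inE => /or4P[] /eqP ->; do 3! match goal with |- context [modn ?x 24] =>
    let v := eval vm_compute in (modn x 24) in change (modn x 24) with v end;
  rewrite (h 1%N) (h 5%N) (h 7%N) (h 11%N); ring.
Qed.

(** Quadratic reciprocity for -6: the square root of -6 written with 24th
    roots of unity in an algebraic closure lies in F_p exactly when Frobenius
    fixes it. *)
Lemma exists_sqrt_m6 p : prime p -> (3 < p)%N ->
  (exists k : 'F_p, k ^+ 2 = - 6%:R) <-> chi p = 1.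
Proof.
move=> pr p3.
have [K [f _]] := countable_algebraic_closure 'F_p.
have chF : p \in [pchar 'F_p] by apply: pchar_Fp.
have chp : p \in [pchar K] by rewrite (fmorph_pchar f).
have [z z8] : exists z : K, z ^+ 8 = z ^+ 4 - 1.
  have [z] := @solve_monicpoly K 8 (fun i => if i == 0%N then -1 else if i == 4 then 1 else 0) isT.
  move=> hz; exists z; rewrite hz !big_ord_recr big_ord0 /=; ring.
have [t2 tp] := Frobenius_sqrt_m6 chp p3 z8.
move: (z + _ + _ + _) t2 tp => t t2 tp.
have n6 : - 6%:R != 0 :> K.
  rewrite oppr_eq0 -(dvdn_pcharf chp); apply/negP => /[dup] /dvdn_leq h.
  have {h} : (p \in iota 4 3) by rewrite mem_iota; lia.
  by rewrite !inE; move: pr => /[swap] /or3P[] /eqP -> //.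
have t0 : t != 0 by apply: contraNneq n6 => t0; rewrite -t2 t0 expr0n.
have fix_t k : f k = t -> chi p = 1.
  move=> fk; case/orP: (chi_prime pr p3) => /eqP // h; exfalso.
  have kp : k ^+ p = k by have := expf_card k; rewrite card_Fp.
  have : t ^+ p = t by rewrite -fk -rmorphXn kp.
  rewrite tp h mulrN1z => /eqP; rewrite eq_sym -addr_eq0 -mulr2n -mulr_natl mulf_eq0 (negPf t0) orbF.
  by rewrite -(dvdn_pcharf chp) => /dvdn_leq; lia.
split=> [[k k2]|h].
  have : (f k) ^+ 2 == t ^+ 2 by rewrite -rmorphXn k2 t2 rmorphN rmorph_nat.
  rewrite eqf_sqr => /orP[/eqP|/eqP fk]; first exact: fix_t.
  by apply: (@fix_t (- k)); rewrite rmorphN fk opprK.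
have : root (map_poly f ('X^#|'F_p| - 'X)) t.
  rewrite rmorphB /= map_polyXn map_polyX /root !hornerE card_Fp // tp h.
  by rewrite subrr.
rewrite finField_genPoly rmorph_prod /= => /rootP; rewrite horner_prod => /eqP.
rewrite prodf_seq_eq0 => /hasP[k _]; rewrite /= rmorphB /= map_polyX map_polyC !hornerE.
rewrite subr_eq0 => /eqP tk; exists k; apply: (fmorph_inj f).
by rewrite rmorphXn /= -tk t2 rmorphN rmorph_nat.
Qed.

(** * Representations by the two forms of discriminant -24 *)

(** The two reduced forms of discriminant -24. The class group has order two,
    so classes are booleans under xor, with [false] the principal class. *)
Definition qform (d : bool) (z : int * int) : int :=
  if d then 2 * z.1 ^+ 2 + 3 * z.2 ^+ 2 else z.1 ^+ 2 + 6 * z.2 ^+ 2.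

(** Gaussian composition, that is, multiplication of ideals of Z[sqrt(-6)] in
    bases adapted to the two classes. *)
Definition qmul (d e : bool) (z w : int * int) : int * int :=
  ((if d && e then 2 else 1) * z.1 * w.1 - (if d || e then 3 else 6) * z.2 * w.2,
   (if d && ~~ e then 2 else 1) * z.1 * w.2 + (if ~~ d && e then 2 else 1) * z.2 * w.1).

Definition qconj (z : int * int) : int * int := (z.1, - z.2).

Definition qscale (c : int) (z : int * int) : int * int := (c * z.1, c * z.2).

Lemma qformM d e z w : qform (d (+) e) (qmul d e z w) = qform d z * qform e w.
Proof. by case: z w => [x y] [a b]; case: d; case: e; rewrite /qform /qmul /=; ring. Qed.

Lemma qform_conj d z : qform d (qconj z) = qform d z.
Proof. by rewrite /qform /qconj /= sqrrN. Qed.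

Lemma qform_scale d c z : qform d (qscale c z) = c ^+ 2 * qform d z.
Proof. by rewrite /qform /qscale /=; case: d; ring. Qed.

Lemma qconjK : involutive qconj.
Proof. by case=> x y; rewrite /qconj /= opprK. Qed.

Lemma qmul_conj d e z w :
  qmul d (d (+) e) (qconj z) (qmul d e z w) = qscale (qform d z) w.
Proof.
by case: z w => [x y] [a b]; case: d; case: e;
  rewrite /qform /qmul /qconj /qscale /=; congr pair; ring.
Qed.

Lemma qmul_conjV d e z w :
  qmul d (d (+) e) z (qmul d e (qconj z) w) = qscale (qform d z) w.
Proof. by rewrite -{1}[z]qconjK qmul_conj qform_conj. Qed.

Lemma qmul_scale d e c z w : qmul d e z (qscale c w) = qscale c (qmul d e z w).
Proof. by rewrite /qmul /qscale /=; congr pair; ring. Qed.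

Lemma qscale_inj c : c != 0 -> injective (qscale c).
Proof. by move=> c0 [x y] [a b] [] /(mulfI c0) -> /(mulfI c0) ->. Qed.

Lemma dvdz_primeM (p : nat) (a b : int) : prime p ->
  (p%:Z %| a * b)%Z = (p%:Z %| a)%Z || (p%:Z %| b)%Z.
Proof. by move=> pr; rewrite !dvdzE abszM Euclid_dvdM. Qed.

Lemma dvdz_prime_sqr (p : nat) (a : int) : prime p ->
  (p%:Z %| a ^+ 2)%Z = (p%:Z %| a)%Z.
Proof. by move=> pr; rewrite expr2 dvdz_primeM ?orbb. Qed.

Lemma dvdz_prime_small (p k : nat) : prime p -> (0 < k < p)%N -> (p%:Z %| k%:Z)%Z = false.
Proof. by move=> pr /andP[k0 kp]; rewrite dvdzE /=; apply/negP => /dvdn_leq; lia. Qed.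

Lemma prime_ndvd6 p : prime p -> (3 < p)%N -> (p%:Z %| 6%:Z)%Z = false.
Proof.
move=> pr p3; rewrite (_ : 6%:Z = 2%:Z * 3%:Z) // dvdz_primeM //.
by rewrite !dvdz_prime_small //; lia.
Qed.

Lemma exists_sqrtn n : exists s, (s * s <= n < s.+1 * s.+1)%N.
Proof.
elim: n => [|n [s /andP[h1 h2]]]; first by exists 0%N.
case: (ltnP n.+1 (s.+1 * s.+1)) => h; first by exists s; lia.
by exists s.+1; nia.
Qed.

(** Thue's lemma, by the pigeonhole principle on the differences x - t y with
    x and y at most the integer square root of p. *)
Lemma thue (p : nat) (t : 'F_p) : prime p ->
  exists x y : int, [/\ (x, y) != (0, 0), x ^+ 2 < p%:Z, y ^+ 2 < p%:Z
    & x%:~R = t * y%:~R].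
Proof.
move=> pr; have [s /andP[sp ps]] := exists_sqrtn p.
have {}sp : (s * s < p)%N.
  rewrite ltn_neqAle sp andbT; apply/eqP => e; move: pr; rewrite -e.
  case: s {sp ps e} => [|[|s]] //; apply/negP/primePn; right; exists s.+2; last exact: dvdn_mulr.
  by nia.
pose f (u : 'I_s.+1 * 'I_s.+1) : 'F_p := (u.1 : nat)%:R - t * (u.2 : nat)%:R.
have : ~~ injectiveb f.
  apply/negP => /injectiveP /leq_card.
  by rewrite card_prod !card_ord (Fp_cast pr); lia.
case/injectivePn=> [[a b] [[a' b'] ne fe]].
exists ((a : nat)%:Z - (a' : nat)%:Z), ((b : nat)%:Z - (b' : nat)%:Z).
have [ha hb ha' hb'] := And4 (ltn_ord a) (ltn_ord b) (ltn_ord a') (ltn_ord b').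
split; try nia.
  apply: contraNneq ne => -[e1 e2]; apply/eqP; congr pair; apply: val_inj => /=; lia.
move: fe; rewrite /f /= => /eqP; rewrite subr_eq => /eqP e.
by rewrite !rmorphB /= -!pmulrn e; ring.
Qed.

Lemma intr_Fp_eq0 p (n : int) : prime p -> (n%:~R == 0 :> 'F_p) = (p%:Z %| n)%Z.
Proof. move=> pr. by rewrite -(dvdz_pcharf (pchar_Fp pr)). Qed.

Lemma edivz (m : nat) (x : int) : (0 < m)%N ->
  exists q r : int, x = m%:Z * q + r /\ 0 <= r < m%:Z.
Proof.
move=> m0; exists (x %/ m%:Z)%Z, (x %% m%:Z)%Z; split; first by rewrite mulrC -divz_eq.
by rewrite modz_ge0 ?ltz_pmod //; lia.
Qed.

(** Thue's lemma gives x^2 + 6 y^2 = k p with 0 < k < 7. For each k an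
    explicit substitution removes the factor k and shows which of the two
    forms represents p. *)
Lemma split_prime_repr p : prime p -> (3 < p)%N -> chi p = 1 ->
  exists d z, qform d z = p%:Z.
Proof.
move=> pr p3 /(exists_sqrt_m6 pr p3) [t t2].
have [x [y [ne x2 y2 xty]]] := thue t pr.
have : (p%:Z %| x ^+ 2 + 6 * y ^+ 2)%Z.
  rewrite -intr_Fp_eq0 // rmorphD rmorphM !rmorphXn /= xty exprMn t2.
  by apply/eqP; ring.
case/dvdzP=> k ek.
have k0 : 0 < k.
  have : 0 < x ^+ 2 + 6 * y ^+ 2; last by nia.
  move: ne; rewrite xpair_eqE negb_and; case/orP => h; have := h; rewrite -sqrf_eq0; nia.
have k7 : k < 7 by nia.
have [x' [r [ex hr]]] := edivz x (isT : (0 < 2)%N).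
have [y' [ry [ey hry]]] := edivz y (isT : (0 < 2)%N).
have [x3 [r3 [ex3 hr3]]] := edivz x (isT : (0 < 3)%N).
have [x5 [r5 [ex5 hr5]]] := edivz x (isT : (0 < 5)%N).
have [y5 [s5 [ey5 hs5]]] := edivz y (isT : (0 < 5)%N).
have : k = 1 \/ k = 2 \/ k = 3 \/ k = 4 \/ k = 5 \/ k = 6 by lia.
case=> [k1|[k1|[k1|[k1|[k1|k1]]]]]; subst k.
- by exists false, (x, y); rewrite /qform /=; lia.
- exists true, (x', y); rewrite /qform /=.
  have [?|?] : r = 0 \/ r = 1 by lia.
    by subst r; subst x; lia.
  by subst r; subst x; lia.
- exists true, (y, x3); rewrite /qform /=.
  have [?|[?|?]] : r3 = 0 \/ r3 = 1 \/ r3 = 2 by lia.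
  + by subst r3; subst x; lia.
  + by subst r3; subst x; lia.
  + by subst r3; subst x; lia.
- exists false, (x', y'); rewrite /qform /=.
  have r0 : r = 0.
    by have [//|?] : r = 0 \/ r = 1 by [lia]; subst r; subst x; lia.
  have [?|?] : ry = 0 \/ ry = 1 by lia.
    by subst r ry; subst x y; lia.
  by subst r ry; subst x y; lia.
- have [h|h] : (exists m, x = 5 * m + 2 * y) \/ (exists m, x = 5 * m - 2 * y).
  + (* 5 divides x^2 + 6 y^2, hence x^2 - 4 y^2 *)
    have e : (5%:Z %| (x - 2 * y) * (x + 2 * y))%Z.
      apply/dvdzP; exists (p%:Z - 2 * y ^+ 2); lia.
    move: e; rewrite (@dvdz_primeM 5) // => /orP[] /dvdzP[m em].
      by left; exists m; lia.
    by right; exists m; lia.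
  + by have [m em] := h; exists true, (m + y, - m); rewrite /qform /=; subst x; lia.
  + by have [m em] := h; exists true, (m - y, m); rewrite /qform /=; subst x; lia.
- have [m xm] : exists m, x = 6 * m.
    have e : (2%:Z * 3%:Z %| x)%Z.
      rewrite Gauss_dvdz // -[(2%:Z %| x)%Z](@dvdz_prime_sqr 2) // -[(3%:Z %| x)%Z](@dvdz_prime_sqr 3) //.
      apply/andP; split; apply/dvdzP.
        by exists (3 * p%:Z - 3 * y ^+ 2); lia.
      by exists (2 * p%:Z - 2 * y ^+ 2); lia.
    by case/dvdzP: e => m ->; exists m; lia.
  by exists false, (y, m); rewrite /qform /=; subst x; lia.
Qed.

(** If p did not divide the second coordinate, a ratio of the coordinates
    would give a square root of -6 modulo p. *)
Lemma inert_prime_repr p d z : prime p -> (3 < p)%N -> chi p = -1 ->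
  (p%:Z %| qform d z)%Z -> (p%:Z %| z.1)%Z && (p%:Z %| z.2)%Z.
Proof.
move=> pr p3 ch h.
have n6 := prime_ndvd6 pr p3.
have [c [c6 cE]] : exists c, (p%:Z %| c)%Z = false /\
    (p%:Z %| (c * z.1) ^+ 2 + 6 * z.2 ^+ 2)%Z.
  case: d h => h.
    exists 2; split; first by rewrite (dvdz_prime_small pr) //; lia.
    case/dvdzP: h => q; rewrite /qform => e; apply/dvdzP; exists (2 * q); lia.
  exists 1; split; first by rewrite (dvdz_prime_small pr) //; lia.
  by rewrite mul1r.
have y0 : (p%:Z %| z.2)%Z.
  apply/negPn/negP => ny.
  have : (exists k : 'F_p, k ^+ 2 = - 6%:R).
    move: cE; rewrite -intr_Fp_eq0 // rmorphD rmorphM !rmorphXn /= => /eqP e.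
    have y0 : z.2%:~R != 0 :> 'F_p by rewrite intr_Fp_eq0.
    exists ((c * z.1)%:~R / z.2%:~R); rewrite expr_div_n.
    by move/eqP: e; rewrite addr_eq0 => /eqP ->; rewrite -mulNr mulfK // expf_neq0.
  by move/(exists_sqrt_m6 pr p3); rewrite ch.
move: cE; rewrite rpredDr; last by rewrite dvdz_mull // dvdz_prime_sqr.
by rewrite dvdz_prime_sqr // dvdz_primeM // c6 y0 andbT.
Qed.

Definition pdvd (p : nat) (z : int * int) := (p%:Z %| z.1)%Z && (p%:Z %| z.2)%Z.

Lemma pdvdP p z : reflect (exists w, z = qscale p%:Z w) (pdvd p z).
Proof.
apply: (iffP andP) => [[/dvdzP[a ea] /dvdzP[b eb]]|[[a b] ->]].
  by exists (a, b); case: z ea eb => x y /= -> ->; rewrite /qscale /= !(mulrC p%:Z).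
by rewrite /qscale /= !dvdz_mulr.
Qed.

(** The product of the second coordinates of the two composed points is
    divisible by p, up to a factor 2. When p divides one of these coordinates
    it also divides the first coordinate of the same point, because the form
    takes there a value divisible by p^2. *)
Lemma pdvd_qmul_or p d e (z w : int * int) (n : int) : prime p -> (3 < p)%N ->
  qform d z = p%:Z -> qform e w = p%:Z * n ->
  pdvd p (qmul d e (qconj z) w) || pdvd p (qmul d e z w).
Proof.
move=> pr p3 hz hw; have n6 := prime_ndvd6 pr p3.
have [n2 n3] : (p%:Z %| 2)%Z = false /\ (p%:Z %| 3)%Z = false.
  by split; apply: dvdz_prime_small => //; lia.
have key v : qform (d (+) e) v = p%:Z ^+ 2 * n -> (p%:Z %| v.2)%Z -> pdvd p v.
  rewrite /pdvd /qform => hv h; rewrite h andbT.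
  case/dvdzP: h => m h; rewrite h in hv.
  rewrite -dvdz_prime_sqr //; move: hv; case: (d (+) e) => hv.
    have : (p%:Z %| 2 * v.1 ^+ 2)%Z.
      apply/dvdzP; exists (p%:Z * n - 3 * m ^+ 2 * p%:Z).
      transitivity (p%:Z ^+ 2 * n - 3 * (m * p%:Z) ^+ 2); first by rewrite -hv; ring.
      by ring.
    by rewrite dvdz_primeM // n2.
  apply/dvdzP; exists (p%:Z * n - 6 * m ^+ 2 * p%:Z).
  transitivity (p%:Z ^+ 2 * n - 6 * (m * p%:Z) ^+ 2); first by rewrite -hv; ring.
  by ring.
have : (p%:Z %| (qmul d e (qconj z) w).2 * (qmul d e z w).2)%Z.
  move: hz hw; case: z => u v; case: w => x y; rewrite /qform /qmul /qconj /=.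
  case: d {key}; case: e => /= hz hw.
  - suff : (p%:Z %| 2 * ((1 * u * y + 1 * - v * x) * (1 * u * y + 1 * v * x)))%Z.
      by rewrite dvdz_primeM // n2.
    apply/dvdzP; exists (y ^+ 2 - n * v ^+ 2).
    transitivity ((2 * u ^+ 2 + 3 * v ^+ 2) * y ^+ 2 - v ^+ 2 * (2 * x ^+ 2 + 3 * y ^+ 2)).
      by ring.
    by rewrite hz hw; ring.
  - apply/dvdzP; exists (2 * y ^+ 2 - n * v ^+ 2).
    transitivity (2 * (2 * u ^+ 2 + 3 * v ^+ 2) * y ^+ 2 - v ^+ 2 * (x ^+ 2 + 6 * y ^+ 2)).
      by ring.
    by rewrite hz hw; ring.
  - apply/dvdzP; exists (y ^+ 2 - 2 * n * v ^+ 2).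
    transitivity ((u ^+ 2 + 6 * v ^+ 2) * y ^+ 2 - 2 * v ^+ 2 * (2 * x ^+ 2 + 3 * y ^+ 2)).
      by ring.
    by rewrite hz hw; ring.
  - apply/dvdzP; exists (y ^+ 2 - n * v ^+ 2).
    transitivity ((u ^+ 2 + 6 * v ^+ 2) * y ^+ 2 - v ^+ 2 * (x ^+ 2 + 6 * y ^+ 2)).
      by ring.
    by rewrite hz hw; ring.
have hq z' : qform d z' = p%:Z -> qform (d (+) e) (qmul d e z' w) = p%:Z ^+ 2 * n.
  by move=> hz'; rewrite qformM hz' hw mulrA -expr2.
rewrite dvdz_primeM // => /orP[] /key -> //; rewrite ?orbT //; apply: hq => //.
by rewrite qform_conj.
Qed.

(** The two composed points add up to (2 c z.1 w.1, 2 c' z.1 w.2) with c and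
    c' equal to 1 or 2, and p does not divide z.1 because z represents p. *)
Lemma pdvd_qmul_and p d e (z w : int * int) : prime p -> (3 < p)%N ->
  qform d z = p%:Z ->
  pdvd p (qmul d e (qconj z) w) && pdvd p (qmul d e z w) = pdvd p w.
Proof.
move=> pr p3 hz; apply/idP/idP => [|/pdvdP[v ->]]; last first.
  by rewrite !qmul_scale; apply/andP; split; apply/pdvdP; eexists.
have n6 := prime_ndvd6 pr p3.
have [n2 n3] : (p%:Z %| 2)%Z = false /\ (p%:Z %| 3)%Z = false.
  by split; apply: dvdz_prime_small => //; lia.
have nu : (p%:Z %| z.1)%Z = false.
  apply/negP => /dvdzP[m hu]; move: hz; rewrite /qform hu.
  have [->|m0] := eqVneq m 0.
    have n6' : (6%:Z %| p%:Z)%Z = false.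
      rewrite dvdzE /=; apply/negP => /(dvdn_trans (isT : 2 %| 6))%N.
      by move/(prime_nt_dvdP pr (isT : 2 != 1))%N => h; rewrite -h in p3.
    have n3' : (3%:Z %| p%:Z)%Z = false.
      rewrite dvdzE /=; apply/negP => /(prime_nt_dvdP pr (isT : 3 != 1))%N h.
      by rewrite -h in p3.
    case: d => h; [move: n3'|move: n6']; rewrite -h mul0r expr0n /= ?mulr0 add0r;
      by rewrite dvdz_mulr.
  have : p%:Z < (m * p%:Z) ^+ 2.
    have m2 : m ^+ 2 != 0 by rewrite expf_neq0.
    have m1 : 1 <= m ^+ 2 by have := sqr_ge0 m; lia.
    by rewrite exprMn; nia.
  by have := sqr_ge0 z.2; case: d; lia.
case/andP=> /andP[a1 a2] /andP[b1 b2].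
move: (rpredD a1 b1) (rpredD a2 b2); rewrite /qmul /qconj /= /pdvd.
set c1 := (X in X * z.1 * w.1); set c2 := (X in X * z.1 * w.2).
rewrite [X in (_ %| X)%Z -> _](_ : _ = 2 * (c1 * (z.1 * w.1))); last by ring.
rewrite [X in _ -> (_ %| X)%Z -> _](_ : _ = 2 * (c2 * (z.1 * w.2))); last by ring.
rewrite !(@dvdz_primeM p) // n2 nu /=.
have -> : (p%:Z %| c1)%Z = false by rewrite /c1; case: ifP => _ //; apply: dvdz_prime_small => //; lia.
have -> : (p%:Z %| c2)%Z = false by rewrite /c2; case: ifP => _ //; apply: dvdz_prime_small => //; lia.
by move=> /= -> ->.
Qed.

(** A cubic character of the ring class group of conductor 3 added to its
    conjugate: 2 is 1 + 1, and -1 is the sum of the two primitive cube roots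
    of unity. Points whose value is divisible by 3 get weight 0. *)
Definition weight (z : int * int) : int :=
  if (3%:Z %| z.1)%Z then 0 else if (3%:Z %| z.2)%Z then 2 else -1.

Definition weight3 (a b : 'F_3) : int := if a == 0 then 0 else if b == 0 then 2 else -1.

Lemma weightE z : weight z = weight3 z.1%:~R z.2%:~R.
Proof. by rewrite /weight /weight3 !(@intr_Fp_eq0 3). Qed.

Lemma F3_case (P : 'F_3 -> Prop) : P 0 -> P 1 -> P (-1) -> forall a, P a.
Proof.
move=> P0 P1 P2 [[|[|[|//]]] h].
- by rewrite (_ : Ordinal h = 0) //; apply: val_inj.
- by rewrite (_ : Ordinal h = 1) //; apply: val_inj.
- by rewrite (_ : Ordinal h = -1) //; apply: val_inj.
Qed.

(** The product formula (u + 1/u)(v + 1/v) = (u v + 1/(u v)) + (v/u + u/v) for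
    a character added to its conjugate. Only the coordinates modulo 3 matter,
    so it is a finite check. *)
Lemma weight_qmul d e z w :
  weight (qmul d e z w) + weight (qmul d e (qconj z) w) = weight z * weight w.
Proof.
rewrite !weightE /qmul /qconj /=.
rewrite !(rmorphD, rmorphB, rmorphN, rmorphM) /= ?rmorphN.
move: (z.1%:~R : 'F_3) (z.2%:~R : 'F_3) (w.1%:~R : 'F_3) (w.2%:~R : 'F_3).
by case: d; case: e; do 4! (apply: F3_case).
Qed.

Lemma weight_scale (p : nat) z : prime p -> (3 < p)%N -> weight (qscale p%:Z z) = weight z.
Proof.
move=> pr p3; rewrite /weight /qscale /=.
have h : (3%:Z %| p%:Z)%Z = false.
  by rewrite dvdzE /=; apply/negP => /(prime_nt_dvdP pr (isT : 3 != 1))%N h; rewrite -h in p3.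
by rewrite !(@dvdz_primeM 3) // h.
Qed.

Definition ints (n : nat) : seq int := [seq i%:Z - n%:Z | i <- iota 0 (2 * n).+1].

Lemma mem_ints n z : (z \in ints n) = (- n%:Z <= z <= n%:Z).
Proof.
apply/mapP/idP => [[i]|h]; first by rewrite mem_iota; lia.
by exists (absz (z + n%:Z)); [rewrite mem_iota|]; lia.
Qed.

Lemma uniq_ints n : uniq (ints n).
Proof. by rewrite map_inj_uniq ?iota_uniq // => i j /addIr []. Qed.

Definition reprs (d : bool) (n : nat) : seq (int * int) :=
  [seq z <- [seq (x, y) | x <- ints n, y <- ints n] | qform d z == n%:Z].

Lemma uniq_reprs d n : uniq (reprs d n).
Proof. by apply/filter_uniq/allpairs_uniq; rewrite ?uniq_ints // => -[x y] [x' y']. Qed.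

Lemma mem_reprs d n (z : int * int) : (z \in reprs d n) = (qform d z == n%:Z).
Proof.
have bound (x : int) : x ^+ 2 <= n%:Z -> - n%:Z <= x <= n%:Z.
  have [?|[?|?]] : x <= -1 \/ x = 0 \/ 1 <= x by lia.
  - by rewrite expr2; nia.
  - by subst x; lia.
  - by rewrite expr2; nia.
rewrite mem_filter; case: eqP => // h; rewrite andTb; apply/allpairsP; exists z => /=.
have sq (x : int) : 0 <= x ^+ 2 := sqr_ge0 x.
rewrite !mem_ints; split; last by case: z {h}.
  by apply: bound; have := sq z.1; have := sq z.2; move: h; rewrite /qform; case: d; lia.
by apply: bound; have := sq z.1; have := sq z.2; move: h; rewrite /qform; case: d; lia.
Qed.

Definition wsum (d : bool) (n : nat) : int := \sum_(z <- reprs d n) weight z.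

(** Composition with z is a bijection from the representations of n to those
    representations of p n which composition with the conjugate of z makes
    divisible by p. *)
Lemma reprs_qmul p d e z n : prime p -> (3 < p)%N -> qform d z = p%:Z ->
  \sum_(w <- reprs (d (+) e) (p * n) | pdvd p (qmul d (d (+) e) (qconj z) w)) weight w
  = \sum_(w <- reprs e n) weight (qmul d e z w).
Proof.
move=> pr p3 hz; have p0 : p%:Z != 0 by lia.
rewrite -[RHS](big_map (qmul d e z) xpredT weight) -[LHS]big_filter.
apply: perm_big.
apply: uniq_perm; [exact/filter_uniq/uniq_reprs|rewrite map_inj_in_uniq ?uniq_reprs //|].
  move=> u v _ _ /(congr1 (qmul d (d (+) e) (qconj z))); rewrite !qmul_conj hz.
  exact: qscale_inj.
move=> u; rewrite mem_filter mem_reprs; apply/andP/mapP => [[/pdvdP[v ev] /eqP eu]|[v + ->]].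
  have uv : u = qmul d e z v.
    apply: (qscale_inj p0); rewrite -qmul_scale -ev -hz.
    have := qmul_conjV d (d (+) e) z u; rewrite addbA addbb addFb => ->.
    by rewrite hz.
  exists v => //; rewrite mem_reprs; apply/eqP.
  by move: eu; rewrite uv qformM hz PoszM => /(mulfI p0).
rewrite mem_reprs => /eqP ev; rewrite qmul_conj qformM hz ev PoszM; split => //.
by apply/pdvdP; exists v.
Qed.

(** The term at n / p of a Hecke relation, which is 0 when p does not divide
    n. *)
Definition odiv (V : nat -> int) (p n : nat) : int := if (p %| n)%N then V (n %/ p)%N else 0.

Lemma reprs_scale p d n : prime p -> (3 < p)%N ->
  \sum_(w <- reprs d (p * n) | pdvd p w) weight w = odiv (wsum d) p n.
Proof.
move=> pr p3; have p0 : p%:Z != 0 by lia.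
rewrite /odiv; case: ifP => [/dvdnP[m ->]|ndv].
  rewrite mulnK ?prime_gt0 // /wsum.
  under [RHS]eq_bigr do rewrite -(weight_scale _ pr p3).
  rewrite -[RHS](big_map (qscale p%:Z) xpredT weight) -[LHS]big_filter.
apply: perm_big.
  apply: uniq_perm; [exact/filter_uniq/uniq_reprs|rewrite map_inj_uniq ?uniq_reprs //|].
    exact: qscale_inj.
  have h v : (qform d (qscale p%:Z v) == (p * (m * p))%N%:Z) = (qform d v == m%:Z).
    by rewrite qform_scale mulnA mulnC mulnA !PoszM expr2 (inj_eq (mulfI _)) // mulf_neq0.
  move=> u; rewrite mem_filter mem_reprs; apply/andP/mapP => [[/pdvdP[v ->]]|[v + ->]].
    by rewrite h => ev; exists v => //; rewrite mem_reprs.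
  by rewrite mem_reprs h => ->; split => //; apply/pdvdP; exists v.
rewrite big_seq_cond big_pred0 // => u; rewrite mem_reprs; apply/negP => /andP[/eqP h /pdvdP[v uv]].
move: h; rewrite uv qform_scale PoszM expr2 -mulrA => /(mulfI p0) h.
by move/negP: ndv; apply; have : (p%:Z %| n%:Z)%Z by rewrite -h dvdz_mulr.
Qed.

(** A representation w of p n becomes divisible by p after composition with z
    or with its conjugate, and with both exactly when p divides w. Inclusion
    and exclusion then give the Hecke relation. *)
Lemma wsum_split p d e z n : prime p -> (3 < p)%N -> qform d z = p%:Z ->
  wsum (d (+) e) (p * n) = weight z * wsum e n - odiv (wsum (d (+) e)) p n.
Proof.
move=> pr p3 hz; have hz' : qform d (qconj z) = p%:Z by rewrite qform_conj.
apply/eqP; rewrite eq_sym subr_eq -(reprs_scale _ _ pr p3); apply/eqP.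
have := reprs_qmul e n pr p3 hz; have := reprs_qmul e n pr p3 hz'; rewrite qconjK => h1 h2.
rewrite /wsum big_distrr /=; under eq_bigr do rewrite -(weight_qmul d e).
rewrite big_split /= -h1 -h2 !(big_mkcond (fun _ => pdvd _ _)) -!big_split /=.
rewrite [LHS]big_seq [RHS]big_seq; apply: eq_bigr => w; rewrite mem_reprs => /eqP hw.
have := pdvd_qmul_and (d (+) e) w pr p3 hz.
have := @pdvd_qmul_or p d (d (+) e) z w n%:Z pr p3 hz; rewrite hw PoszM => /(_ erefl).
by case: (pdvd _ _); case: (pdvd _ _) => //= _ <-; rewrite ?(addr0, add0r).
Qed.

(** * The Hecke relations and the partial sums of the coefficients *)

Definition wtot (n : nat) : int := wsum false n + wsum true n.

Lemma odivD f g p n : odiv f p n + odiv g p n = odiv (fun m => f m + g m) p n.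
Proof. by rewrite /odiv; case: ifP; rewrite ?addr0. Qed.

Lemma prime_ndvd3 p : prime p -> (3 < p)%N -> (3%:Z %| p%:Z)%Z = false.
Proof.
move=> pr p3; rewrite dvdzE /=; apply/negP => /(prime_nt_dvdP pr (isT : 3 != 1))%N h.
by rewrite -h in p3.
Qed.

Lemma wtot_split p : prime p -> (3 < p)%N -> chi p = 1 ->
  exists2 c : int, c = 2 \/ c = -1 & forall n, wtot (p * n) = c * wtot n - odiv wtot p n.
Proof.
move=> pr p3 ch; have [d [z hz]] := split_prime_repr pr p3 ch.
exists (weight z).
  rewrite /weight; case: ifP => [/dvdzP[m hm]|_]; last by case: ifP; [left|right].
  have : (3%:Z %| p%:Z)%Z.
    rewrite -hz /qform hm; case: d {hz}; apply/dvdzP.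
      by exists (6 * m ^+ 2 + z.2 ^+ 2); ring.
    by exists (3 * m ^+ 2 + 2 * z.2 ^+ 2); ring.
  by rewrite prime_ndvd3.
move=> n; rewrite -[odiv wtot _ _]odivD /wtot.
have h0 := wsum_split false n pr p3 hz; have h1 := wsum_split true n pr p3 hz.
by case: d h0 h1 {hz} => /= -> ->; ring.
Qed.

(** All representations of p n are multiples of p. *)
Lemma wtot_inert p n : prime p -> (3 < p)%N -> chi p = -1 -> wtot (p * n) = odiv wtot p n.
Proof.
move=> pr p3 ch; rewrite -[odiv wtot _ _]odivD /wtot -!(reprs_scale _ _ pr p3).
suff e d : wsum d (p * n) = \sum_(w <- reprs d (p * n) | pdvd p w) weight w by rewrite !e.
rewrite /wsum [RHS]big_mkcond big_seq [RHS]big_seq.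
apply: eq_bigr => z; rewrite mem_reprs => /eqP h.
by rewrite /pdvd (@inert_prime_repr p d z) // h PoszM dvdz_mulr.
Qed.

Lemma wtot3 n : wtot (3 * n) = 0.
Proof.
rewrite /wtot /wsum; rewrite !big_seq !big1 // => z; rewrite mem_reprs => /eqP h;
  rewrite /weight (_ : (3%:Z %| z.1)%Z = true) // -(@dvdz_prime_sqr 3) //.
  have -> : z.1 ^+ 2 = (2 * z.1 ^+ 2 + 3 * z.2 ^+ 2) * 2 - 3 * (z.1 ^+ 2 + 2 * z.2 ^+ 2) by ring.
  move: h; rewrite /qform => ->; apply/dvdzP; exists (2 * n%:Z - z.1 ^+ 2 - 2 * z.2 ^+ 2).
  by rewrite PoszM; ring.
have -> : z.1 ^+ 2 = (z.1 ^+ 2 + 6 * z.2 ^+ 2) - 6 * z.2 ^+ 2 by ring.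
move: h; rewrite /qform => ->; apply/dvdzP; exists (n%:Z - 2 * z.2 ^+ 2).
by rewrite PoszM; ring.
Qed.

(** Doubling one coordinate exchanges the two forms and doubles their value;
    every representation of an even number arises in this way. *)
Lemma wtot2 n : wtot (2 * n) = wtot n.
Proof.
have key d (f : int * int -> int * int) : injective f ->
    (forall z, weight (f z) = weight z) ->
    (forall z, qform (~~ d) (f z) = 2 * qform d z) ->
    (forall z m, qform (~~ d) z = 2 * m -> exists w, z = f w) ->
    wsum (~~ d) (2 * n) = wsum d n.
  move=> fi fw fq fs; rewrite /wsum -[RHS](eq_bigr _ (fun z _ => fw z)).
  rewrite -[RHS](big_map f xpredT weight); apply: perm_big.
  apply: uniq_perm; rewrite ?map_inj_uniq ?uniq_reprs // => z.
  rewrite mem_reprs; apply/eqP/mapP => [h|[w + ->]]; last by rewrite mem_reprs fq => /eqP ->.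
  have [w ew] := fs z n%:Z h; exists w => //; rewrite mem_reprs; apply/eqP.
  by move: h; rewrite ew fq; lia.
rewrite /wtot addrC; congr (_ + _).
  apply: (key false (fun z => (z.1, 2 * z.2))) => [[a b] [c d] []|[a b]|[a b]|[a b] m].
  - by move=> -> h; congr pair; lia.
  - by rewrite /weight /= (@dvdz_primeM 3).
  - by rewrite /qform /=; ring.
  - rewrite /qform /= => h.
    have : (2%:Z %| b)%Z.
      rewrite -(@dvdz_prime_sqr 2) //; apply/dvdzP; exists (2 * b ^+ 2 + a ^+ 2 - m); lia.
    by case/dvdzP=> q ->; exists (a, q); rewrite /= mulrC.
apply: (key true (fun z => (2 * z.1, z.2))) => [[a b] [c d] []|[a b]|[a b]|[a b] m].
- by move=> h ->; congr pair; lia.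
- by rewrite /weight /= (@dvdz_primeM 3).
- by rewrite /qform /=; ring.
- rewrite /qform /= => h.
  have : (2%:Z %| a)%Z.
    by rewrite -(@dvdz_prime_sqr 2) //; apply/dvdzP; exists (m - 3 * b ^+ 2); lia.
  by case/dvdzP=> q ->; exists (q, b); rewrite /= mulrC.
Qed.

(** The weight of a whole orbit under sign changes, divided by 4. Orbits with
    y = 0 have two elements only, whence the value 1 instead of 2. *)
Definition qweight (x y : nat) : int :=
  if (3 %| x)%N then 0 else if y == 0%N then 1 else if (3 %| y)%N then 2 else -1.

Definition qcoef (n : nat) : int :=
  \sum_(1 <= x < n.+1) \sum_(0 <= y < n.+1)
    qweight x y * ((x ^ 2 + 6 * y ^ 2 == n) + (2 * x ^ 2 + 3 * y ^ 2 == n))%N%:Z.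

Lemma sum_ints_even n (f : int -> int) : (forall x, f (- x) = f x) ->
  \sum_(x <- ints n) f x = f 0 + 2 * \sum_(1 <= i < n.+1) f i%:Z.
Proof.
move=> ev; rewrite big_map -[(2 * n).+1]subn0 -/(index_iota 0 _) (big_cat_nat _ (n := n)) //=; last by lia.
have -> : \sum_(0 <= i < n) f (i%:Z - n%:Z) = \sum_(1 <= i < n.+1) f i%:Z.
  rewrite big_nat_rev big_add1 /= !big_nat; apply: eq_bigr => i hi.
  by rewrite -ev; congr f; lia.
have -> : \sum_(n <= i < (2 * n).+1) f (i%:Z - n%:Z) = \sum_(0 <= i < n.+1) f i%:Z.
  rewrite -{1}[n]add0n big_addn (_ : ((2 * n).+1 - n = n.+1)%N); last by lia.
  by apply: eq_bigr => i _; congr f; lia.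
by rewrite [X in _ + X]big_nat_recl //= big_add1 /=; ring.
Qed.

Lemma wtotE n : wtot n = 4 * qcoef n.
Proof.
have wE d : wsum d n = \sum_(x <- ints n) \sum_(y <- ints n)
    weight (x, y) * (qform d (x, y) == n%:Z)%:Z.
  rewrite /wsum big_filter big_mkcond big_allpairs_dep /=.
  by apply: eq_bigr => x _; apply: eq_bigr => y _; case: eqP; rewrite ?mulr1 ?mulr0.
pose g (x : int) : int := \sum_(y <- ints n)
  weight (x, y) * ((qform false (x, y) == n%:Z) + (qform true (x, y) == n%:Z))%N%:Z.
have -> : wtot n = \sum_(x <- ints n) g x.
  rewrite /wtot !wE -big_split /=; apply: eq_bigr => x _; rewrite -big_split /=.
  by apply: eq_bigr => y _; rewrite PoszD mulrDr.
have wN1 x y : weight (- x, y) = weight (x, y) by rewrite /weight /= !rpredN.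
have wN2 x y : weight (x, - y) = weight (x, y) by rewrite /weight /= !rpredN.
rewrite sum_ints_even => [|x]; last first.
  by apply: eq_bigr => y _; rewrite wN1 /qform /= sqrrN.
have -> : g 0 = 0 by rewrite /g big1 // => y _; rewrite /weight /= mul0r.
rewrite add0r (_ : (4 : int) = 2 * 2) // -mulrA; congr (_ * _); rewrite big_distrr /=.
apply: eq_bigr => x _; rewrite /g sum_ints_even => [|y]; last first.
  by rewrite wN2 /qform /= sqrrN.
rewrite [in RHS]big_nat_recl //= mulrDr big_add1 /=.
have q0 (a b : nat) : (a%:Z ^+ 2 + 6 * b%:Z ^+ 2 == n%:Z) = (a ^ 2 + 6 * b ^ 2 == n)%N.
  by apply/eqP/eqP; lia.
have q1 (a b : nat) : (2 * a%:Z ^+ 2 + 3 * b%:Z ^+ 2 == n%:Z) = (2 * a ^ 2 + 3 * b ^ 2 == n)%N.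
  by apply/eqP/eqP; lia.
congr (_ + _).
  rewrite (q0 x 0%N) (q1 x 0%N) mulrA; congr (_ * _).
  by rewrite /weight /qweight !dvdzE /=; case: ifP.
Qed.

Lemma qcoef1 : qcoef 1 = 1.
Proof. by rewrite /qcoef !big_nat1 big_nat_recl // big_nat1 /qweight. Qed.

Lemma qcoef_split p n c e : wtot (p * n) = c * wtot n - e * odiv wtot p n ->
  qcoef (p * n) = c * qcoef n - e * odiv qcoef p n.
Proof.
rewrite (_ : odiv wtot p n = 4 * odiv qcoef p n); last first.
  by rewrite /odiv; case: ifP => _; rewrite ?mulr0 ?wtotE.
by rewrite !wtotE => h; lia.
Qed.

(** The five pairs are the possible values at split, inert and the two
    ramified primes, 2 and 3. *)
Lemma qcoef_prime_Hecke p : prime p ->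
  exists2 c : int, (c, chi p) \in [:: (2, 1); (-1, 1); (0, -1); (1, 0); (0, 0)] &
    forall n, qcoef (p * n) = c * qcoef n - chi p * odiv qcoef p n.
Proof.
move=> pr; case: (ltnP 3 p) => p3.
  have /orP[/eqP ch|/eqP ch] := chi_prime pr p3.
    have [c hc h] := wtot_split pr p3 ch; exists c; first by case: hc => ->; rewrite ch.
    by move=> n; apply: qcoef_split; rewrite h ch mul1r.
  exists 0; first by rewrite ch.
  by move=> n; apply: qcoef_split; rewrite wtot_inert // ch mul0r mulN1r opprK add0r.
have {p3} : p = 2 \/ p = 3 by have := prime_gt1 pr; lia.
case=> ->; [exists 1|exists 0] => // n; apply: qcoef_split.
  by rewrite wtot2 mul1r mul0r subr0.
by rewrite wtot3 !mul0r subr0.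
Qed.

Lemma qcoef_Hecke p n : prime p ->
  qcoef (p * n) = qcoef p * qcoef n - chi p * odiv qcoef p n.
Proof.
move=> pr; have [c _ h] := qcoef_prime_Hecke pr.
suff -> : qcoef p = c by [].
rewrite -[p in LHS]muln1 h qcoef1 /odiv dvdn1 mulr1.
by case: eqP pr => [-> //|_ _]; rewrite mulr0 subr0.
Qed.

Lemma qcoef_prime p : prime p ->
  (qcoef p, chi p) \in [:: (2, 1); (-1, 1); (0, -1); (1, 0); (0, 0)].
Proof.
move=> pr; have [c hc h] := qcoef_prime_Hecke pr.
suff -> : qcoef p = c by [].
rewrite -[p in LHS]muln1 h qcoef1 /odiv dvdn1 mulr1.
by case: eqP pr => [-> //|_ _]; rewrite mulr0 subr0.
Qed.

(** The weights 1, -1, -1, 2, -1, -1, 2 and so on sum to zero over every three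
    consecutive terms after the first. *)
Lemma norm_sum_qweight_le x m : `|\sum_(0 <= y < m) qweight x y| <= 1.
Proof.
rewrite /qweight; case: (3 %| x)%N; first by rewrite big1 ?normr0.
have [q [r [-> r3]]] : exists q r, m = (3 * q + r)%N /\ (r < 3)%N.
  by exists (m %/ 3)%N, (m %% 3)%N; rewrite mulnC -divn_eq ltn_mod.
have m3 k : [/\ (3 %| (3 * k).+1) = false, (3 %| (3 * k).+2) = false & (3 %| (3 * k).+3) = true]%N.
  by split; lia.
suff h k : \sum_(0 <= y < (3 * k).+1)
    (if y == 0%N then 1 else if (3 %| y)%N then 2 else -1 : int) = 1.
  case: r r3 => [|[|[|//]]] _.
  - case: q => [|k]; first by rewrite big_geq ?normr0.
    have -> : (3 * k.+1 + 0 = (3 * k).+3)%N by lia.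
    have [h1 h2 h3] := m3 k.
    by rewrite big_nat_recr //= big_nat_recr //= h h1 h2.
  - by rewrite addn1 h.
  have [h1 h2 h3] := m3 q.
  by rewrite addn2 big_nat_recr //= h h1.
elim: k => [|k IH]; first by rewrite muln0 big_nat1.
have -> : (3 * k.+1 = (3 * k).+3)%N by lia.
have [h1 h2 h3] := m3 k.
by rewrite 3!(big_nat_recr _ _ _ (leq0n _)) /= IH h1 h2 h3.
Qed.

(** For each form the first coordinate takes at most s values, and for each of
    them the second coordinate runs over an initial interval, on which the
    weights sum to at most 1 in absolute value. *)
Lemma norm_sum_qcoef_le (N s : nat) : (N < s.+1 ^ 2)%N ->
  `|\sum_(1 <= n < N.+1) qcoef n| <= (2 * s)%N%:Z.
Proof.
move=> Ns.
have half (f : nat -> nat -> nat) (g : nat -> nat) :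
    (forall x y, (f x y <= N) = (y < g x))%N -> (forall x y, x ^ 2 <= f x y)%N ->
    (forall x y, (0 < x -> 0 < f x y))%N ->
    (forall x y, y <= f x y)%N ->
    `|\sum_(1 <= n < N.+1) \sum_(1 <= x < n.+1) \sum_(0 <= y < n.+1)
       qweight x y * (f x y == n)%N%:Z| <= s%:Z.
  move=> fg fx f0 fy.
  have -> : \sum_(1 <= n < N.+1) \sum_(1 <= x < n.+1) \sum_(0 <= y < n.+1)
       qweight x y * (f x y == n)%N%:Z = \sum_(1 <= x < s.+1) \sum_(0 <= y < g x) qweight x y.
    transitivity (\sum_(1 <= n < N.+1) \sum_(1 <= x < s.+1) \sum_(0 <= y < N.+1)
       qweight x y * (f x y == n)%N%:Z).
      rewrite !big_nat; apply: eq_bigr => n hn.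
      have z1 x : \sum_(0 <= y < n.+1) qweight x y * (f x y == n)%N%:Z =
         \sum_(0 <= y < N.+1) qweight x y * (f x y == n)%N%:Z.
        rewrite [RHS](big_cat_nat _ (n := n.+1)) //=; last by lia.
        rewrite [X in _ + X]big_nat [X in _ + X]big1 ?addr0 // => y hy.
        by have := fy x y; case: eqP => [|_ _]; rewrite ?mulr0 //; lia.
      have z2 x : (s < x)%N || (n < x)%N -> \sum_(0 <= y < n.+1) qweight x y * (f x y == n)%N%:Z = 0.
        move=> hx; rewrite big1 // => y _; have := fx x y; case: eqP => [|_ _]; rewrite ?mulr0 //.
        by move=> ->; nia.
      under [RHS]eq_bigr do rewrite -z1.
      case: (leqP n s) => ns.
        rewrite [RHS](big_cat_nat _ (n := n.+1)) //=.
        rewrite [X in _ + X]big_nat [X in _ + X]big1 ?addr0 // => x hx.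
        by rewrite z2 //; lia.
      rewrite [LHS](big_cat_nat _ (n := s.+1)) //=; last by lia.
      rewrite [X in _ + X]big_nat [X in _ + X]big1 ?addr0 // => x hx.
      by rewrite z2 //; lia.
    rewrite exchange_big /= !big_nat; apply: eq_bigr => x hx.
    rewrite exchange_big /=.
    have gN : (g x <= N.+1)%N.
      by rewrite leqNgt; apply/negP; rewrite -fg; have := fy x N.+1; lia.
    rewrite (big_cat_nat _ (n := g x)) //= [X in _ + X]big_nat [X in _ + X]big1 ?addr0 => [|y hy].
      rewrite !big_nat; apply: eq_bigr => y hy; rewrite -big_distrr /=.
      have fN : (0 < f x y <= N)%N by rewrite fg f0; lia.
      rewrite (bigD1_seq (f x y)) ?iota_uniq ?mem_index_iota //= eqxx big1 ?addr0 ?mulr1 //.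
      by move=> i /negPf; rewrite eq_sym => ->.
    rewrite big_nat big1 // => n hn.
    by case: eqP => [|_]; rewrite ?mulr0 // => e; have := fg x y; lia.
  apply: le_trans (ler_norm_sum _ _ _) _.
  apply: le_trans (ler_sum _ (fun x _ => norm_sum_qweight_le x (g x))) _.
  by rewrite sumr_const_nat subn1 /= -[_ *+ _]mulr_natl mulr1 natz.
have ex (f : nat -> nat -> nat) : (forall x y, y <= f x y)%N ->
    (forall x y z, y <= z -> f x y <= f x z)%N ->
   exists g : nat -> nat, forall x y, ((f x y <= N) = (y < g x))%N.
  move=> fy fm; have e x : exists y, (N < f x y)%N by exists N.+1; apply: fy.
  exists (fun x => ex_minn (e x)) => x y; case: ex_minnP => m Nm mP.
  apply/idP/idP => h; last by rewrite leqNgt; apply/negP => /mP; lia.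
  by rewrite ltnNge; apply/negP => /(fm x) h'; lia.
have sq y : (y <= y ^ 2)%N by case: y => // y; rewrite expnS expn1 leq_pmulr.
have sqm y z : (y <= z -> y ^ 2 <= z ^ 2)%N by rewrite leq_sqr.
have [g0 hg0] := ex (fun x y => x ^ 2 + 6 * y ^ 2)%N
  ltac:(move=> x y; have := sq y; lia) ltac:(move=> x y z /sqm; lia).
have [g1 hg1] := ex (fun x y => 2 * x ^ 2 + 3 * y ^ 2)%N
  ltac:(move=> x y; have := sq y; lia) ltac:(move=> x y z /sqm; lia).
have h0 := half _ _ hg0 ltac:(lia) ltac:(move=> x y; have := sq x; lia)
  ltac:(move=> x y; have := sq y; lia).
have h1 := half _ _ hg1 ltac:(lia) ltac:(move=> x y; have := sq x; lia)
  ltac:(move=> x y; have := sq y; lia).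
rewrite mul2n -addnn PoszD; apply: le_trans (lerD h0 h1).
apply: le_trans (ler_normD _ _).
rewrite -big_split /= le_eqVlt; apply/orP; left; apply/eqP; congr `|_|.
apply: eq_bigr => n _; rewrite /qcoef -big_split; apply: eq_bigr => x _ /=.
by rewrite -big_split; apply: eq_bigr => y _ /=; rewrite -mulrDr -PoszD.
Qed.

(** * Power series over F_2 and Gaussian binomials *)

Local Notation poly2 := {poly 'F_2}.

Lemma addpp2 (p : poly2) : p + p = 0.
Proof.
rewrite -mulr2n -mulr_natl -polyC1 -polyCMn.
by rewrite (_ : 1 *+ 2 = 0 :> 'F_2) ?mul0r //; apply: val_inj.
Qed.

(** Congruence modulo X^N, which plays the role of equality of power series.
    In characteristic 2 the sum p + q is also the difference. *)
Definition eqX (N : nat) (p q : poly2) := 'X^N %| (p + q).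

Lemma eqXP N (p q : poly2) : reflect (forall i, (i < N)%N -> p`_i = q`_i) (eqX N p q).
Proof.
have e2 (a b : 'F_2) : (a + b == 0) = (a == b).
  by rewrite addr_eq0; congr (_ == _); case: b => [[|[|[]]]] // h; apply: val_inj.
apply: (iffP idP) => [/dvdpP[r e] i iN|h].
  apply/eqP; rewrite -e2 -coefD e coefMXn iN //.
apply/dvdpP; exists (drop_poly N (p + q)).
rewrite -{1}[p + q](poly_take_drop N) (_ : take_poly N _ = 0) ?add0r //.
apply/polyP => i; rewrite coef_take_poly coef0; case: ifP => // iN.
by apply/eqP; rewrite coefD e2 h.
Qed.

Lemma eqX_refl N p : eqX N p p.
Proof. by rewrite /eqX addpp2 dvdp0. Qed.

Lemma eqX_sym N p q : eqX N p q -> eqX N q p.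
Proof. by rewrite /eqX addrC. Qed.

Lemma eqX_trans N p q r : eqX N p q -> eqX N q r -> eqX N p r.
Proof.
move=> /eqXP h1 /eqXP h2; apply/eqXP => i iN; rewrite h1 // h2 //.
Qed.

Lemma eqXM N p q p' q' : eqX N p p' -> eqX N q q' -> eqX N (p * q) (p' * q').
Proof.
rewrite /eqX => h1 h2.
have -> : p * q + p' * q' = (p + p') * q + p' * (q + q').
  by rewrite mulrDl mulrDr addrA -(addrA (p * q)) addpp2 addr0.
by apply: dvdp_add; [apply: dvdp_mulr|apply: dvdp_mull].
Qed.

Lemma eqXD N p q p' q' : eqX N p p' -> eqX N q q' -> eqX N (p + q) (p' + q').
Proof. by rewrite /eqX addrACA; apply: dvdp_add. Qed.

Lemma eqX_leq M N p q : (M <= N)%N -> eqX N p q -> eqX M p q.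
Proof. by move=> MN /eqXP h; apply/eqXP => i iM; apply: h; apply: leq_trans MN. Qed.

Lemma eqX_cancel N (p q r : poly2) : p`_0 != 0 -> eqX N (p * q) (p * r) -> eqX N q r.
Proof.
rewrite /eqX -mulrDr => p0; rewrite Gauss_dvdpr //.
apply: coprimep_expl; rewrite coprimep_sym -[ 'X ]subr0 -polyC0 coprimep_XsubC.
by rewrite /root horner_coef0.
Qed.

Lemma eqX_X N k p q : eqX N p q -> eqX (k + N) ('X^k * p) ('X^k * q).
Proof. by rewrite /eqX -mulrDr exprD => h; rewrite dvdp_mul. Qed.

Lemma sqr_comp2 (p : poly2) : p ^+ 2 = p \Po 'X^2.
Proof.
elim/poly_ind: p => [|p c IH]; first by rewrite expr0n comp_poly0.
rewrite comp_polyD comp_polyM comp_polyX comp_polyC -IH sqrrD exprMn.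
rewrite -mulr_natr -polyC_natr (_ : 2%:R = 0 :> 'F_2) ?mulr0 ?addr0; last exact: val_inj.
by congr (_ + _); rewrite -polyC_exp; congr _%:P; case: c => [[|[|[]]]] // h; apply: val_inj.
Qed.

Section Gauss.
Variable Q : poly2.

(** Gaussian binomial coefficients in the variable Q. *)
Fixpoint gbin (n k : nat) : poly2 :=
  match n, k with
  | _, 0 => 1
  | 0, _.+1 => 0
  | n'.+1, k'.+1 => gbin n' k'.+1 + Q ^+ (n' - k') * gbin n' k'
  end.

Lemma gbinS n k : gbin n.+1 k.+1 = gbin n k.+1 + Q ^+ (n - k) * gbin n k.
Proof. by []. Qed.

Lemma gbin0 n : gbin n 0 = 1. Proof. by case: n. Qed.

Lemma gbin_small n k : (n < k)%N -> gbin n k = 0.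
Proof.
elim: n k => [|n IH] [|k] //= nk; rewrite !IH ?mulr0 ?addr0 //.
exact: ltnW.
Qed.

Arguments gbin : simpl never.

(** The q-binomial theorem. It is kept homogeneous in u and v so that negative
    powers can be avoided when it is specialized. *)
Lemma gbin_prod n (u v : poly2) :
  \prod_(0 <= i < n) (u + v * Q ^+ i) =
  \sum_(0 <= k < n.+1) Q ^+ 'C(k, 2) * gbin n k * u ^+ (n - k) * v ^+ k.
Proof.
elim: n => [|n IH]; first by rewrite big_nil big_nat1 gbin0 !mulr1 expr0.
rewrite big_nat_recr //= IH mulrDr !mulr_suml.
rewrite [RHS]big_nat_recl // gbin0 [in LHS]big_nat_recl // gbin0.
rewrite [in X in _ + X = _]big_nat_recr //=.
under [X in _ = _ + X]eq_bigr do rewrite gbinS mulrDr mulrDl mulrDl.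
rewrite big_split /= [X in _ = _ + (X + _)]big_nat_recr //= (gbin_small (ltnSn n)) mulr0 !mul0r addr0.
rewrite !subn0 bin0n /= !expr0 !mul1r !mulr1 -exprSr -!addrA; congr (_ + _).
congr (_ + _).
  rewrite !big_nat; apply: eq_bigr => i hi.
  by rewrite (_ : (n.+1 - i.+1 = (n - i.+1).+1)%N) ?exprSr; [ring|lia].
transitivity (\sum_(0 <= i < n.+1) Q ^+ 'C(i, 2) * gbin n i * u ^+ (n - i) * v ^+ i * (v * Q ^+ n)).
  by rewrite big_nat_recr.
rewrite !big_nat; apply: eq_bigr => i hi; rewrite subSS binS bin1 exprD exprS.
have -> : Q ^+ n = Q ^+ i * Q ^+ (n - i) by rewrite -exprD; congr (_ ^+ _); lia.
ring.
Qed.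

Definition qpoch (n : nat) : poly2 := \prod_(1 <= m < n.+1) (1 + Q ^+ m).

Lemma qpochS n : qpoch n.+1 = qpoch n * (1 + Q ^+ n.+1).
Proof. by rewrite /qpoch big_nat_recr. Qed.

(** The formula for Gaussian binomials as quotients of q-factorials, without
    division. *)
Lemma gbin_fact n k : (k <= n)%N -> gbin n k * qpoch k * qpoch (n - k) = qpoch n.
Proof.
elim: n k => [|n IH] [|k] // kn.
- by rewrite gbin0 /qpoch big_geq // !mulr1.
- by rewrite gbin0 subn0 mul1r [X in X * _]big_geq // mul1r.
rewrite subSS gbinS mulrDl mulrDl.
have h2 : Q ^+ (n - k) * gbin n k * qpoch k.+1 * qpoch (n - k) =
    Q ^+ (n - k) * (1 + Q ^+ k.+1) * qpoch n.
  by rewrite -(IH k) // qpochS; ring.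
have h1 : gbin n k.+1 * qpoch k.+1 * qpoch (n - k) = (1 + Q ^+ (n - k)) * qpoch n.
  move: kn; rewrite ltnS leq_eqVlt => /orP[/eqP ->|kn].
    by rewrite gbin_small // !mul0r subnn addpp2 mul0r.
  by rewrite -(IH k.+1) // (_ : (n - k = (n - k.+1).+1)%N) ?qpochS; [ring|lia].
rewrite h1 h2 -mulrDl qpochS mulrC; congr (_ * _).
rewrite mulrDr mulr1 -exprD (_ : (n - k + k.+1 = n.+1)%N); last by lia.
by rewrite addrA -(addrA 1) addpp2 addr0.
Qed.
End Gauss.

Lemma coef0_prod1X (I : seq nat) (f : nat -> nat) :
  {in I, forall i, 0 < f i}%N -> (\prod_(i <- I) (1 + 'X^(f i)) : poly2)`_0 != 0.
Proof.
move=> f0; rewrite -horner_coef0 horner_prod prodf_seq_neq0; apply/allP => i iI /=.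
by rewrite !hornerE expr0n eqn0Ngt f0 // addr0 oner_eq0.
Qed.

(** The factors beyond the m-th are 1 modulo X^(c (m + 1)), so these products
    stabilize. *)
Lemma qpoch_eqX c m n : (0 < c)%N -> (m <= n)%N ->
  eqX (c * m.+1) (qpoch 'X^c n) (qpoch 'X^c m).
Proof.
move=> c0; elim: n => [|n IH]; first by rewrite leqn0 => /eqP ->; apply: eqX_refl.
rewrite leq_eqVlt => /orP[/eqP ->|mn]; first exact: eqX_refl.
apply: eqX_trans (IH mn); rewrite qpochS.
rewrite /eqX mulrDr mulr1 addrAC addpp2 add0r dvdp_mull // -exprM dvdp_exp2l //.
by rewrite leq_mul2l; apply/orP; right.
Qed.

(** * The triple product over F_2 *)

Lemma eqX_sum N (I : seq nat) (f g : nat -> poly2) :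
  (forall i, i \in I -> eqX N (f i) (g i)) -> eqX N (\sum_(i <- I) f i) (\sum_(i <- I) g i).
Proof.
elim: I => [|i I IH] h; first by rewrite !big_nil eqX_refl.
rewrite !big_cons; apply: eqXD; first by apply: h; rewrite inE eqxx.
by apply: IH => j jI; apply: h; rewrite inE jI orbT.
Qed.

(** Near the middle, Gaussian binomials converge to the inverse of the
    infinite product; cancelling the product of n factors avoids inverses. *)
Lemma gbin_qpoch_eqX c n k : (0 < c)%N -> (k <= 2 * n)%N ->
  eqX (c * (minn k (2 * n - k)).+1) (gbin 'X^c (2 * n) k * qpoch 'X^c n) 1.
Proof.
move=> c0 kn; set m := minn _ _; pose q := qpoch 'X^c.
have mk : (m <= k)%N by rewrite geq_minl.
have mnk : (m <= 2 * n - k)%N by rewrite geq_minr.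
have mn : (m <= n)%N by rewrite /m; lia.
have h i : (m <= i)%N -> eqX (c * m.+1) (q i) (q n).
  by move=> mi; apply: eqX_trans (qpoch_eqX c0 mi) _; apply/eqX_sym/qpoch_eqX.
apply: (@eqX_cancel _ (q n)).
  rewrite /q /qpoch; under eq_bigr do rewrite -exprM.
  by apply: coef0_prod1X => i; rewrite mem_index_iota muln_gt0 c0; lia.
rewrite mulr1 mulrCA.
have e : gbin 'X^c (2 * n) k * (q k * q (2 * n - k)%N) = q (2 * n)%N.
  by rewrite mulrA; apply: gbin_fact.
apply: eqX_trans (h (2 * n)%N _); last by lia.
rewrite -e; apply: eqXM; first exact: eqX_refl.
by apply: eqXM; apply: eqX_sym; apply: h.
Qed.

Lemma bin2D n j : ('C(n + j, 2) = 'C(n, 2) + 'C(j, 2) + n * j)%N.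
Proof.
elim: j => [|j IH]; first by rewrite addn0 bin0n muln0 !addn0.
by rewrite addnS !binS !bin1 IH; lia.
Qed.

Lemma bin2_sqr j : (2 * 'C(j, 2) + j = j * j)%N.
Proof. by elim: j => [//|j IH]; rewrite binS bin1; lia. Qed.

Section Jacobi.
Variables (c b n : nat).
Hypotheses (c0 : (0 < c)%N) (bc : (b < c)%N).

(** The exponent c j (j - 1) / 2 + b j of the theta series at the possibly
    negative integer j = k - n. *)
Definition jexp k :=
  if (n <= k)%N then (c * 'C(k - n, 2) + b * (k - n))%N
  else (c * 'C((n - k).+1, 2) - b * (n - k))%N.

Definition jprod : poly2 :=
  \prod_(0 <= i < n) (1 + 'X^(c * i + b)) * \prod_(0 <= i < n) (1 + 'X^(c * i.+1 - b)).

Lemma jexpE k : (k <= 2 * n)%N ->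
  ((b * n + c * 'C(n, 2) + c * (n * n)) + jexp k =
   c * 'C(k, 2) + c * n * (2 * n - k) + b * k)%N.
Proof.
move=> k2; rewrite /jexp; case: leqP => nk.
  have [j ej] : exists j, k = (n + j)%N by exists (k - n)%N; lia.
  subst k; rewrite addKn bin2D (_ : (2 * n - (n + j) = n - j)%N); last by lia.
  have [i ei] : exists i, n = (j + i)%N by exists (n - j)%N; lia.
  by rewrite ei addKn; lia.
have [j ej] : exists j, n = (k + j)%N by exists (n - k)%N; lia.
rewrite ej addKn bin2D binS bin1 (_ : (2 * (k + j) - k = k + j + j)%N); last by lia.
have h := congr1 (muln c) (bin2_sqr j).
have hb : (b * j <= c * ('C(j, 2) + j))%N.
  by rewrite mulnDr -[(b * j)%N]add0n leq_add // leq_mul2r ltnW ?orbT.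
by lia.
Qed.

(** The finite form of the triple product: the q-binomial theorem for 2 n
    factors. A power of X clears the negative exponents and is cancelled at
    the end. *)
Lemma jprod_sum : jprod = \sum_(0 <= k < (2 * n).+1) 'X^(jexp k) * gbin 'X^c (2 * n) k.
Proof.
have X0 : 'X^(b * n + c * 'C(n, 2) + c * (n * n)) != 0 :> poly2 by rewrite expf_neq0 ?polyX_eq0.
(* both sides become the product of the X^(c n) + X^(b + c i) for i < 2 n *)
apply: (mulfI X0).
transitivity (\prod_(0 <= i < 2 * n) ('X^c ^+ n + 'X^b * 'X^c ^+ i) : poly2); last first.
  rewrite gbin_prod big_distrr /= !big_nat; apply: eq_bigr => k hk.
  rewrite mulrA -exprD jexpE; last by lia.
  rewrite 2!exprD -!exprM -!mulrA; congr (_ * _).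
  by rewrite [RHS]mulrA [RHS]mulrC mulnA.
rewrite (big_cat_nat _ (n := n)) //=; last by lia.
rewrite -[X in index_iota X (2 * n)]add0n big_addn (_ : (2 * n - n = n)%N); last by lia.
have -> : \prod_(0 <= i < n) ('X^c ^+ n + 'X^b * 'X^c ^+ (i + n)) =
   'X^(c * (n * n)) * \prod_(0 <= i < n) (1 + 'X^(c * i + b)) :> poly2.
  have -> : 'X^(c * (n * n)) = \prod_(0 <= i < n) 'X^(c * n) :> poly2.
    by rewrite prodr_const_nat subn0 -exprM mulnA.
  rewrite -big_split /=; apply: eq_bigr => i _.
  by rewrite -!exprM mulrDr mulr1 -!exprD; congr (_ + 'X^_); lia.
have -> : \prod_(0 <= i < n) ('X^c ^+ n + 'X^b * 'X^c ^+ i) =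
   'X^(b * n + c * 'C(n, 2)) * \prod_(0 <= i < n) (1 + 'X^(c * i.+1 - b)) :> poly2.
  rewrite [X in _ = _ * X]big_nat_rev /=.
  have -> : 'X^(b * n + c * 'C(n, 2)) = \prod_(0 <= i < n) 'X^(b + c * i) :> poly2.
    rewrite -expr_sum big_split /= -big_distrr /= sum_nat_const_nat subn0 bin2_sum mulnC //.
  rewrite -big_split /= !big_nat; apply: eq_bigr => i hi.
  rewrite mulrDr mulr1 -!exprM -!exprD addrC; congr ('X^_ + 'X^_).
  rewrite (_ : (0 + n - i.+1).+1 = n - i)%N; last by lia.
  have : (b <= c * (n - i))%N by apply: leq_trans (ltnW bc) _; rewrite leq_pmulr //; lia.
  by rewrite mulnBr; have : (c * i <= c * n)%N; [rewrite leq_mul2l; lia | lia].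
rewrite /jprod exprD; ring.
Qed.

(** Jacobi's triple product. In its finite form each Gaussian binomial times
    the product of the 1 + X^(c m) is congruent to 1, with an error that the
    monomial X^(jexp k) pushes beyond X^(c n). *)
Lemma jacobi_triple : eqX (c * n) (qpoch 'X^c n * jprod)
  (1 + \sum_(0 <= j < n) ('X^(c * 'C(j.+1, 2) + b * j.+1) + 'X^(c * 'C(j.+2, 2) - b * j.+1))).
Proof.
have -> : 1 + \sum_(0 <= j < n) ('X^(c * 'C(j.+1, 2) + b * j.+1) + 'X^(c * 'C(j.+2, 2) - b * j.+1))
   = \sum_(0 <= k < (2 * n).+1) 'X^(jexp k) :> poly2.
  rewrite [RHS](big_cat_nat _ (n := n)) //=; last by lia.
  rewrite [X in _ = _ + X]big_ltn; last by lia.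
  rewrite big_split /= addrA addrC; congr (_ + _).
    rewrite [RHS]big_nat_rev !big_nat; apply: eq_bigr => j hj.
    rewrite /jexp ifF; last by lia.
    by rewrite (_ : n - (0 + n - j.+1) = j.+1)%N //; lia.
  congr (_ + _).
    by rewrite /jexp leqnn subnn bin0n !muln0.
  rewrite -[n.+1 in RHS]add0n big_addn (_ : ((2 * n).+1 - n.+1 = n)%N); last by lia.
  apply: eq_bigr => j _; rewrite /jexp ifT; last by lia.
  by rewrite (_ : j + n.+1 - n = j.+1)%N //; lia.
rewrite jprod_sum big_distrr /=; apply: eqX_sum => k; rewrite mem_index_iota => hk.
rewrite mulrCA -[X in eqX _ _ X]mulr1.
have kn : (k <= 2 * n)%N by lia.
apply: eqX_leq; last first.
  by apply: eqX_X; rewrite mulrC; apply: gbin_qpoch_eqX kn.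
rewrite /jexp; case: (leqP n k) => nk.
  have [j ej] : exists j, k = (n + j)%N by exists (k - n)%N; lia.
  rewrite ej addKn (_ : minn _ _ = n - j)%N; last by lia.
  have hj : (j <= 'C(j, 2) + 1)%N by have := bin2_sqr j; nia.
  apply: (@leq_trans (c * ('C(j, 2) + (n - j).+1))); last by lia.
  by rewrite leq_mul2l; lia.
have [j ej] : exists j, n = (k + j)%N by exists (n - k)%N; lia.
rewrite {2}ej addKn (_ : minn _ _ = k)%N; last by lia.
have hj : (j <= 'C(j, 2) + 1)%N by have := bin2_sqr j; nia.
have hb : (b * j <= c * j)%N by rewrite leq_mul2r ltnW ?orbT.
rewrite binS bin1; apply: (@leq_trans (c * ('C(j, 2) + k.+1))); last by lia.
by rewrite leq_mul2l; lia.
Qed.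
End Jacobi.

(** * The generating function of A at odd arguments *)

Lemma qpochX_eqX k m n N : (0 < k)%N -> (N <= m)%N -> (N <= n)%N ->
  eqX N (qpoch 'X^k m) (qpoch 'X^k n).
Proof.
move=> k0 Nm Nn.
have h i : (N <= i)%N -> eqX N (qpoch 'X^k i) (qpoch 'X^k N).
  by move=> Ni; apply: eqX_leq (qpoch_eqX k0 Ni); nia.
by apply: eqX_trans (h _ Nm) _; apply/eqX_sym/h.
Qed.

Lemma qpoch_comp j k n : (0 < k)%N -> qpoch 'X^j n \Po 'X^k = qpoch 'X^(k * j) n.
Proof.
move=> k0; rewrite /qpoch rmorph_prod; apply: eq_bigr => i _ /=.
by rewrite comp_polyD comp_polyC -!exprM comp_Xn_poly -exprM mulnA.
Qed.

Lemma qpoch_sqr j n : qpoch 'X^j n ^+ 2 = qpoch 'X^(2 * j) n.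
Proof. by rewrite sqr_comp2 qpoch_comp. Qed.

Lemma qpoch_coef0 k n : (0 < k)%N -> (qpoch 'X^k n)`_0 != 0.
Proof.
move=> k0; rewrite /qpoch; under eq_bigr do rewrite -exprM.
by apply: coef0_prod1X => i; rewrite mem_index_iota muln_gt0 k0; lia.
Qed.

Lemma coef0M_neq0 (p q : poly2) : p`_0 != 0 -> q`_0 != 0 -> (p * q)`_0 != 0.
Proof. by move=> p0 q0; rewrite -horner_coef0 hornerM mulf_neq0 ?horner_coef0. Qed.

(** The exponents congruent to 0, 1 and 2 modulo 3 together exhaust all
    exponents. *)
Lemma jprod31 n : qpoch 'X^3 n * jprod 3 1 n = qpoch 'X^1 (3 * n).
Proof.
elim: n => [|n IH]; first by rewrite muln0 /jprod /qpoch !big_geq // !mulr1.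
have [e1 e2 e3] : [/\ 3 * n + 1 = (3 * n).+1, 3 * n.+1 - 1 = (3 * n).+2 &
  3 * n.+1 = (3 * n).+3]%N by split; lia.
rewrite e3 !qpochS -IH /jprod !big_nat_recr //= e1 e2 -!exprM !mul1n e3; ring.
Qed.

(** Both sides contain the exponents of each residue class modulo 6 equally
    often. *)
Lemma jprod61 n : qpoch 'X^2 (3 * n) * qpoch 'X^3 (2 * n) * jprod 6 1 n =
  qpoch 'X^1 (6 * n) * qpoch 'X^6 n.
Proof.
elim: n => [|n IH]; first by rewrite !muln0 /jprod /qpoch !big_geq // !mulr1.
have [e3 e2 e6] : [/\ 3 * n.+1 = (3 * n).+3, 2 * n.+1 = (2 * n).+2 &
    6 * n.+1 = (6 * n).+4.+2]%N by split; lia.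
rewrite e3 e2 {1}e6 !qpochS.
transitivity (qpoch 'X^2 (3 * n) * qpoch 'X^3 (2 * n) * jprod 6 1 n *
   ((1 + 'X^((6 * n).+1)) * (1 + 'X^((6 * n).+2)) * (1 + 'X^((6 * n).+3)) * (1 + 'X^((6 * n).+4))
    * (1 + 'X^((6 * n).+4.+1)) * (1 + 'X^((6 * n).+4.+2)) * (1 + 'X^((6 * n).+4.+2)))); last first.
  by rewrite IH -!exprM !mul1n e6; ring.
rewrite /jprod !big_nat_recr //= -!exprM.
have [f1 f2 f3] : [/\ 2 * (3 * n).+1 = (6 * n).+2, 2 * (3 * n).+2 = (6 * n).+4 &
  2 * (3 * n).+3 = (6 * n).+4.+2]%N by split; lia.
have [g1 g2 [g3 g4]] : [/\ 3 * (2 * n).+1 = (6 * n).+3, 3 * (2 * n).+2 = (6 * n).+4.+2 &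
  6 * n + 1 = (6 * n).+1 /\ 6 * n.+1 - 1 = (6 * n).+4.+1]%N by split; lia.
rewrite f1 f2 f3 g1 g2 g3 g4; ring.
Qed.

Definition is_sqr (m : nat) : bool := has (fun a => a * a == m)%N (iota 0 m.+1).

Lemma is_sqrP m : reflect (exists a, (a * a = m)%N) (is_sqr m).
Proof.
apply: (iffP hasP) => [[a _ /eqP <-]|[a <-]]; first by exists a.
by exists a => //; rewrite mem_iota; nia.
Qed.

Lemma sum_sqr (K m : nat) : (m < K)%N -> (\sum_(0 <= a < K) (a * a == m) = is_sqr m)%N.
Proof.
move=> mK; case: is_sqrP => [[a am]|h].
  rewrite (bigD1_seq a) ?iota_uniq ?mem_index_iota //=; last by nia.
  rewrite am eqxx big1 // => b ba; apply/eqP; rewrite eqb0; apply/eqP => bm.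
  by move/eqP: ba; apply; nia.
by rewrite big1 // => a _; apply/eqP; rewrite eqb0; apply/eqP => am; apply: h; exists a.
Qed.

(** The theta series with exponents (a^2 - 1) / 3 for a prime to 3, in the
    shape that the triple product gives it. *)
Definition theta6 n : poly2 :=
  1 + \sum_(0 <= j < n) ('X^(6 * 'C(j.+1, 2) + 1 * j.+1) + 'X^(6 * 'C(j.+2, 2) - 1 * j.+1)).

Definition theta3 n : poly2 :=
  1 + \sum_(0 <= j < n) ('X^(3 * 'C(j.+1, 2) + 1 * j.+1) + 'X^(3 * 'C(j.+2, 2) - 1 * j.+1)).

(** The exponents are the integers (a^2 - 1) / 3 for a = 1, a = 3 j + 2 and a
    = 3 j + 4. *)
Lemma theta6_sum n : theta6 n = \sum_(0 <= a < 3 * n + 2 | ~~ (3 %| a)%N) 'X^((a * a) %/ 3).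
Proof.
rewrite /theta6; elim: n => [|n IH].
  rewrite big_geq // addr0 (_ : (3 * 0 + 2 = 2)%N) // big_mkcond big_nat_recr //= big_nat1.
  by rewrite (_ : (3 %| 0)%N = true) // add0r.
rewrite big_nat_recr //= addrA IH (_ : (3 * n.+1 + 2 = (3 * n + 2).+3)%N); last by lia.
have [h1 h2 h3] : [/\ (3 %| 3 * n + 2) = false, (3 %| (3 * n + 2).+1) = true &
  (3 %| (3 * n + 2).+2) = false]%N by split; lia.
rewrite [RHS]big_mkcond !big_nat_recr //= h1 h2 h3 -big_mkcond addr0 -!addrA /=; congr (_ + _).
have := bin2_sqr n; rewrite !binS !bin1 bin0 => h.
congr ('X^_ + 'X^_); lia.
Qed.

Lemma coprime6E a : coprime a 6 = ~~ (2 %| a)%N && ~~ (3 %| a)%N.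
Proof. by rewrite (_ : 6 = 2 * 3)%N // coprimeMr !(coprime_sym a) !prime_coprime. Qed.

(** The exponents are the integers (a^2 - 1) / 24 for a = 1, a = 6 j + 5 and a
    = 6 j + 7. *)
Lemma theta3_sum n : theta3 n = \sum_(0 <= a < 6 * n + 2 | coprime a 6) 'X^((a * a) %/ 24).
Proof.
rewrite /theta3; elim: n => [|n IH].
  rewrite big_geq // addr0 (_ : (6 * 0 + 2 = 2)%N) // big_mkcond big_nat_recr //= big_nat1.
  by rewrite (_ : coprime 0 6 = false) // add0r.
rewrite big_nat_recr //= addrA IH (_ : (6 * n.+1 + 2 = (6 * n + 2).+4.+2)%N); last by lia.
have [h1 h2 h3] : [/\ coprime (6 * n + 2) 6 = false, coprime (6 * n + 2).+1 6 = false &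
  coprime (6 * n + 2).+2 6 = false] by rewrite !coprime6E; split; lia.
have [h4 h5 h6] : [/\ coprime (6 * n + 2).+3 6 = true, coprime (6 * n + 2).+4 6 = false &
  coprime (6 * n + 2).+4.+1 6 = true] by rewrite !coprime6E; split; lia.
rewrite [RHS]big_mkcond !big_nat_recr //= h1 h2 h3 h4 h5 h6 -big_mkcond !addr0 -!addrA /=.
congr (_ + _); have := bin2_sqr n; rewrite !binS !bin1 bin0 => h.
congr ('X^_ + 'X^_); lia.
Qed.

Lemma coef_sqr_sum (K d i : nat) (P : pred nat) : (1 < d)%N ->
  (forall a, P a -> exists m, a * a = d * m + 1)%N ->
  (forall a, (a * a = d * i + 1)%N -> P a) -> (d * i + 1 < K)%N ->
  (\sum_(0 <= a < K | P a) 'X^((a * a) %/ d) : poly2)`_i = (is_sqr (d * i + 1))%:R.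
Proof.
move=> d1 P1 P2 dK; rewrite coef_sum -(sum_sqr dK) natr_sum big_mkcond /=.
apply: eq_bigr => a _; rewrite coefXn; case: (boolP (P a)) => [/P1[m am]|nP].
  rewrite am mulnC divnMDl ?divn_small // ?addn0; last by lia.
  congr ((nat_of_bool _)%:R); apply/eqP/eqP => [->|]; first by rewrite mulnC.
  by rewrite mulnC => /addIn/eqP; rewrite eqn_mul2l => /orP[/eqP|/eqP]; lia.
by case: eqP => // /P2 h; rewrite h in nP.
Qed.

Lemma theta6_coef n i : (3 * i + 1 < 3 * n + 2)%N -> (theta6 n)`_i = (is_sqr (3 * i + 1))%:R.
Proof.
move=> h; rewrite theta6_sum coef_sqr_sum //; last first.
  by move=> a aa; apply/negP => /dvdnP[b ab]; move: aa; rewrite ab; lia.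
move=> a; have [q [r [-> rb]]] : exists q r, a = (3 * q + r)%N /\ (r < 3)%N.
  by exists (a %/ 3)%N, (a %% 3)%N; rewrite mulnC -divn_eq ltn_mod.
case: r rb => [|[|[|//]]] _; first by lia.
- by exists (3 * q * q + 2 * q)%N; lia.
- by exists (3 * q * q + 4 * q + 1)%N; lia.
Qed.

Lemma theta3_coef n i : (24 * i + 1 < 6 * n + 2)%N -> (theta3 n)`_i = (is_sqr (24 * i + 1))%:R.
Proof.
move=> h; rewrite theta3_sum coef_sqr_sum //; last first.
  move=> a aa; rewrite coprime6E; apply/andP.
  by split; apply/negP => /dvdnP[b ab]; move: aa; rewrite ab; lia.
move=> a; rewrite coprime6E.
have [q [r [-> rb]]] : exists q r, a = (12 * q + r)%N /\ (r < 12)%N.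
  by exists (a %/ 12)%N, (a %% 12)%N; rewrite mulnC -divn_eq ltn_mod.
move=> hr; have : (r = 1 \/ r = 5 \/ r = 7 \/ r = 11)%N by lia.
case=> [->|[->|[->|->]]].
- by exists (6 * q * q + q)%N; lia.
- by exists (6 * q * q + 5 * q + 1)%N; lia.
- by exists (6 * q * q + 7 * q + 2)%N; lia.
- by exists (6 * q * q + 11 * q + 5)%N; lia.
Qed.

(** Euler's pentagonal number theorem modulo 2: the generalized pentagonal
    numbers i are those for which 24 i + 1 is a square. *)
Lemma euler_coef m i : (i < m)%N -> (qpoch 'X^1 m)`_i = (is_sqr (24 * i + 1))%:R.
Proof.
move=> im; pose n := (24 * i + m)%N.
rewrite -(@theta3_coef n); last by rewrite /n; lia.
transitivity (qpoch 'X^1 (3 * n))`_i.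
  by have /eqXP -> // := @qpochX_eqX 1 m (3 * n) m isT (leqnn _) ltac:(rewrite /n; lia).
rewrite -jprod31.
by have /eqXP -> // := @jacobi_triple 3 1 n isT isT; rewrite /n; lia.
Qed.

Lemma euler3_coef m i : (i < m)%N ->
  (qpoch 'X^3 m)`_i = ((3 %| i)%N && is_sqr (8 * i + 1))%:R.
Proof.
move=> im; rewrite -(qpoch_comp 1 m (isT : (0 < 3)%N)) coef_comp_poly_Xn //.
case: ifP => [/dvdnP[j ij]|//]; rewrite ij mulnK // euler_coef; last by lia.
by rewrite (_ : (24 * j + 1 = 8 * (j * 3) + 1)%N) //; lia.
Qed.

(** Write f_k for the product of the 1 + X^(k m). The triple product and
    [jprod61] give f_2 f_3 T = f_1 f_6^2 for the theta series T. Since f_2 =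
    f_1^2 and f_6 = f_3^2 in characteristic 2, this simplifies to f_1 T =
    f_3^3. *)
Lemma euler_theta N : eqX N (qpoch 'X^1 N * theta6 N) (qpoch 'X^3 N ^+ 3).
Proof.
have J : eqX N (qpoch 'X^6 N * jprod 6 1 N) (theta6 N).
  by apply: eqX_leq (@jacobi_triple 6 1 N isT isT); lia.
have e2 : eqX N (qpoch 'X^2 (3 * N)) (qpoch 'X^1 N ^+ 2).
  by rewrite qpoch_sqr; apply: qpochX_eqX; lia.
have e3 : eqX N (qpoch 'X^3 (2 * N)) (qpoch 'X^3 N) by apply: qpochX_eqX; lia.
have e1 : eqX N (qpoch 'X^1 (6 * N)) (qpoch 'X^1 N) by apply: qpochX_eqX; lia.
have c0 : (qpoch 'X^1 N * qpoch 'X^3 N)`_0 != 0 by apply: coef0M_neq0; apply: qpoch_coef0.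
apply: (eqX_cancel c0).
have h1 : eqX N (qpoch 'X^1 N ^+ 2 * qpoch 'X^3 N * theta6 N)
   (qpoch 'X^2 (3 * N) * qpoch 'X^3 (2 * N) * (qpoch 'X^6 N * jprod 6 1 N)).
  by apply: eqX_sym; apply: eqXM J; apply: eqXM.
have h2 : eqX N (qpoch 'X^1 (6 * N) * qpoch 'X^6 N * qpoch 'X^6 N)
    (qpoch 'X^1 N * qpoch 'X^6 N * qpoch 'X^6 N).
  by do 2 (apply: eqXM; last exact: eqX_refl).
move: h1; rewrite mulrCA jprod61 [X in eqX _ _ X]mulrC => h1.
have := eqX_trans h1 h2; rewrite -(qpoch_sqr 3).
by congr (eqX _ _ _); ring.
Qed.

(** Factors that are even series pass through the extraction of odd exponents. *)
Lemma odd_part_mul (p h : poly2) : odd_poly (p * (h \Po 'X^2)) = odd_poly p * h.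
Proof.
apply/polyP => i; rewrite coef_odd_poly.
rewrite -{1}[p]poly_even_odd mulrDl mulrAC -!comp_polyM coefD coefMX /=.
rewrite !coef_comp_poly_Xn //= ifF ?add0r; last by lia.
by rewrite -muln2 dvdn_mull // mulnK.
Qed.

Lemma odd_part_eqX N p q : eqX (2 * N) p q -> eqX N (odd_poly p) (odd_poly q).
Proof.
by move=> /eqXP h; apply/eqXP => i iN; rewrite !coef_odd_poly h //; lia.
Qed.

Lemma dvd2_sqr a : (2 %| a * a)%N = (2 %| a)%N.
Proof. by rewrite Euclid_dvdM // orbb. Qed.

(** If 3 i + 1 is a square a^2 with i odd, then a is even and 3 j + 1 = (a /
    2)^2 with i = 4 j + 1. So the odd exponents of the series T are 2 (2 j) +
    1 for the exponents j of T, and the odd part of T is T(X^2) = T^2. *)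
Lemma theta6_odd N : eqX N (odd_poly (theta6 (2 * N))) (theta6 (2 * N) ^+ 2).
Proof.
apply/eqXP => i iN; rewrite coef_odd_poly sqr_comp2 coef_comp_poly_Xn //.
rewrite theta6_coef; last by lia.
case: ifP => [/dvdnP[j ij]|i2].
  rewrite ij mulnK // theta6_coef; last by lia.
  congr ((nat_of_bool _)%:R); apply/is_sqrP/is_sqrP => -[a ha]; last by exists (2 * a)%N; lia.
  have : (2 %| a)%N by rewrite -dvd2_sqr; lia.
  by case/dvdnP=> b ab; exists b; rewrite ab in ha; lia.
case: is_sqrP => // -[a ha]; exfalso; move/negP: i2; apply.
have : (2 %| a)%N by rewrite -dvd2_sqr; lia.
by case/dvdnP=> b ab; rewrite ab in ha; lia.
Qed.

(** The factors of exponent up to M suffice for the coefficients of index up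
    to M. *)
Definition gfA (M : nat) : poly2 := \prod_(0 <= i < M.+1) (if (3 %| i)%N then 1 else 1 + 'X^i).

Lemma gfA_euler M : gfA (3 * M) * qpoch 'X^3 M = qpoch 'X^1 (3 * M).
Proof.
elim: M => [|M IH]; first by rewrite muln0 /gfA big_nat1 /qpoch !big_geq // mul1r.
have [e3 h1 h2] : [/\ 3 * M.+1 = (3 * M).+3, (3 %| (3 * M).+1) = false &
  (3 %| (3 * M).+2) = false]%N by split; lia.
have h3 : (3 %| (3 * M).+3)%N by lia.
rewrite /gfA in IH *.
rewrite e3 !big_nat_recr //= -/(gfA _) in IH *.
rewrite !qpochS -IH h1 h2 h3 -!exprM !mul1n e3; ring.
Qed.

Lemma gfA_eqX m M : (m <= M)%N -> eqX m.+1 (gfA M) (gfA m).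
Proof.
elim: M => [|M IH]; first by rewrite leqn0 => /eqP ->; apply: eqX_refl.
rewrite leq_eqVlt => /orP[/eqP ->|mM]; first exact: eqX_refl.
apply: eqX_trans (IH mM); rewrite /gfA [X in eqX _ X _]big_nat_recr //=.
case: ifP => _; first by rewrite mulr1 eqX_refl.
rewrite /eqX mulrDr mulr1 addrAC addpp2 add0r dvdp_mull // dvdp_exp2l //.
Qed.

(** Expanding the product over subsets of exponents, each partition
    contributes exactly one monomial. *)
Lemma A_coef m : (A m)%:R = (gfA m)`_m :> 'F_2.
Proof.
rewrite /gfA big_mkord.
have -> : \prod_(i < m.+1) (if (3 %| i)%N then 1 else 1 + 'X^i) =
   \prod_(i < m.+1) ((if (3 %| i)%N then 0 else 'X^i) + 1) :> poly2.
  by apply: eq_bigr => i _; case: ifP; rewrite ?add0r // addrC.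
rewrite bigA_distr coef_sum /A -sum1_card natr_sum big_mkcond /=.
apply: eq_big => S; rewrite ?inE // => _.
rewrite /is_distinct12_partition.
case: (boolP [forall i in S, _]) => [/forall_inP h|nh] /=; last first.
  case/forall_inPn: nh => i iS hi; rewrite (bigD1 i) //= iS ifT ?mul0r ?coef0 //.
  move: hi; case: {iS} i => i /= _; lia.
have -> : \prod_(i < m.+1) (if i \in S then if (3 %| i)%N then 0 else 'X^i else 1) =
    'X^(\sum_(i in S) i) :> poly2.
  rewrite expr_sum [RHS]big_mkcond /=; apply: eq_bigr => i _.
  by case: ifP => // iS; rewrite ifF //; have := h _ iS; lia.
by rewrite coefXn eq_sym; case: eqP.
Qed.

(** With g the generating function, T the theta series and f_k as before, g
    f_3 = f_1 and f_1 T = f_3^3 give g f_3^4 = T f_1^2. As f_3^4 and f_1^2 are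
    series in X^2, taking odd parts replaces them by f_3^2 and f_1, and T by
    T^2. The result h f_3^2 = T^2 f_1 = T f_3^3 for the odd part h of g
    simplifies to h = f_3 T. *)
Lemma odd_A_coef n (N : nat) : (n < N)%N ->
  (A (2 * n + 1))%:R = (qpoch 'X^3 (2 * N) * theta6 (2 * N))`_n :> 'F_2.
Proof.
move=> nN; have G : eqX (2 * N) (gfA (3 * (2 * N)) * qpoch 'X^3 (2 * N)) (qpoch 'X^1 (2 * N)).
  by rewrite gfA_euler; apply: qpochX_eqX; lia.
set e3 := qpoch 'X^3 (2 * N) in G *; set e1 := qpoch 'X^1 _ in G *.
set T := theta6 (2 * N) in G *; set g := gfA _ in G.
have TE : eqX (2 * N) (e1 * T) (e3 ^+ 3) by apply: euler_theta.
have h1 : eqX (2 * N) (g * (e3 ^+ 2 \Po 'X^2)) (T * (e1 \Po 'X^2)).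
  rewrite -!sqr_comp2.
  have -> : g * e3 ^+ 2 ^+ 2 = g * e3 * e3 ^+ 3 by ring.
  have -> : T * e1 ^+ 2 = e1 * (e1 * T) by ring.
  by apply: eqXM => //; apply: eqX_sym.
have := odd_part_eqX h1; rewrite !odd_part_mul => h2.
have h3 : eqX N (odd_poly g * e3 ^+ 2) (T * e3 ^+ 3).
  apply: eqX_trans h2 _; apply: (@eqX_trans _ _ (T ^+ 2 * e1)).
    by apply: eqXM; [apply: theta6_odd|apply: eqX_refl].
  rewrite expr2 -mulrA; apply: eqXM; first exact: eqX_refl.
  by rewrite mulrC; apply: eqX_leq TE; lia.
have h4 : eqX N (odd_poly g) (e3 * T).
  have c0 : (e3 ^+ 2)`_0 != 0 by rewrite expr2; apply: coef0M_neq0; apply: qpoch_coef0.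
  apply: (eqX_cancel c0).
  by move: h3; congr (eqX _ _ _); ring.
move/eqXP: h4 => <- //; rewrite coef_odd_poly A_coef addn1 mul2n.
by have /eqXP -> := @gfA_eqX n.*2.+1 (3 * (2 * N)) ltac:(lia).
Qed.

Lemma A_sum_sqr n : (A (2 * n + 1))%:R =
  \sum_(0 <= i < n.+1) (((3 %| i)%N && is_sqr (8 * i + 1)) && is_sqr (3 * (n - i) + 1))%:R :> 'F_2.
Proof.
rewrite (@odd_A_coef n n.+1) // coefM big_mkord; apply: eq_bigr => i _.
rewrite euler3_coef; last by have := ltn_ord i; lia.
rewrite theta6_coef; last by lia.
by rewrite -natrM mulnb.
Qed.

(** * The parity of A as a coefficient *)

Lemma F2_intr_eq (a b : int) : odd (absz a) = odd (absz b) -> a%:~R = b%:~R :> 'F_2.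
Proof.
move=> h; apply/eqP; rewrite -subr_eq0 -rmorphB /= (@intr_Fp_eq0 2) //; lia.
Qed.

(** Modulo 2 the weights 0 and 2 vanish. Where 3 does not divide x the first
    form is 1 modulo 3, while 24 n + 11 is 2 modulo 3, and y = 0 would make
    the second form even. *)
Lemma qweight_F2 n x y :
  (qweight x y * ((x ^ 2 + 6 * y ^ 2 == 24 * n + 11) + (2 * x ^ 2 + 3 * y ^ 2 == 24 * n + 11))%N%:Z)%:~R
  = ([&& ~~ (3 %| x), ~~ (3 %| y) & 2 * x ^ 2 + 3 * y ^ 2 == 24 * n + 11]%N)%:R :> 'F_2.
Proof.
rewrite pmulrn; apply: F2_intr_eq; rewrite /qweight.
case: (boolP (3 %| x)%N) => //= nx.
have -> : (x ^ 2 + 6 * y ^ 2 == 24 * n + 11)%N = false.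
  apply/negP => /eqP h; have [q [r [xe rb]]] : exists q r, x = (3 * q + r)%N /\ (r < 3)%N.
    by exists (x %/ 3)%N, (x %% 3)%N; rewrite mulnC -divn_eq ltn_mod.
  by case: r rb xe => [|[|[|//]]] _ xe; subst x; lia.
case: eqP => [->|_] /=; first by case: eqP => //; lia.
by case: (3 %| y)%N; case: eqP.
Qed.

Lemma is_sqr4 m : is_sqr (4 * m) = is_sqr m.
Proof.
apply/is_sqrP/is_sqrP => -[a ha]; last by exists (2 * a)%N; lia.
have : (2 %| a)%N by rewrite -dvd2_sqr; lia.
by case/dvdnP=> b ab; exists b; rewrite ab in ha; lia.
Qed.

Lemma mod3_sqr (a m : nat) : (a * a = m)%N -> (3 %| a)%N = (3 %| m)%N.
Proof. by move=> <-; rewrite Euclid_dvdM // orbb. Qed.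

(** From 2 x^2 + 3 y^2 = 24 n + 11 one gets that y is odd and x even. Then i
    is determined by y^2 = 8 i + 1, and (x / 2)^2 = 3 (n - i) + 1. *)
Lemma repr_index_sum n x y :
  (\sum_(0 <= i < n.+1) [&& 3 %| i, y * y == 8 * i + 1 & x * x == 4 * (3 * (n - i) + 1)]
  = [&& ~~ (3 %| x), ~~ (3 %| y) & 2 * x ^ 2 + 3 * y ^ 2 == 24 * n + 11])%N.
Proof.
case: (boolP [&& ~~ (3 %| x), _ & _])%N => [/and3P[nx ny /eqP e]|nh].
  have [q [r [ye rb]]] : exists q r, y = (8 * q + r)%N /\ (r < 8)%N.
    by exists (y %/ 8)%N, (y %% 8)%N; rewrite mulnC -divn_eq ltn_mod.
  have [i yi] : exists i, (y * y = 8 * i + 1)%N.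
    case: r rb ye => [|[|[|[|[|[|[|[|//]]]]]]]] _ ye; subst y; try by exfalso; lia.
    - by exists (8 * q * q + 2 * q)%N; lia.
    - by exists (8 * q * q + 6 * q + 1)%N; lia.
    - by exists (8 * q * q + 10 * q + 3)%N; lia.
    - by exists (8 * q * q + 14 * q + 6)%N; lia.
  have i_n : (i <= n)%N by lia.
  have i3 : (3 %| i)%N.
    have [s [t [yt tb]]] : exists s t, y = (3 * s + t)%N /\ (t < 3)%N.
      by exists (y %/ 3)%N, (y %% 3)%N; rewrite mulnC -divn_eq ltn_mod.
    by case: t tb yt => [|[|[|//]]] _ yt; clear ye; subst y; lia.
  rewrite (bigD1_seq i) ?iota_uniq ?mem_index_iota //= i3 yi eqxx /=.
  rewrite big1 => [|j ji]; last first.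
    by apply/eqP; rewrite eqb0 !negb_and; apply/or3P/Or32; lia.
  have -> : (x * x == 4 * (3 * (n - i) + 1))%N by apply/eqP; lia.
  by [].
rewrite big_nat big1 // => i hi; apply/eqP; rewrite eqb0; apply: contra nh.
case/and3P=> /dvdnP[k ik] /eqP yi /eqP xi.
rewrite (mod3_sqr yi) (mod3_sqr xi); apply/and3P; split; try lia.
Qed.

Lemma A_qcoef n : (A (2 * n + 1))%:R = (qcoef (24 * n + 11))%:~R :> 'F_2.
Proof.
rewrite A_sum_sqr /qcoef; set N := (24 * n + 11)%N.
rewrite rmorph_sum /=.
transitivity (\sum_(0 <= x < N.+1) \sum_(0 <= y < N.+1)
    ([&& ~~ (3 %| x), ~~ (3 %| y) & 2 * x ^ 2 + 3 * y ^ 2 == N]%N)%:R : 'F_2); last first.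
  rewrite [LHS]big_ltn // [X in X + _]big1 ?add0r //; apply: eq_bigr => x _.
  by rewrite rmorph_sum; apply: eq_bigr => y _; apply/esym/qweight_F2.
under [RHS]eq_bigr do under eq_bigr do rewrite -repr_index_sum natr_sum.
under [RHS]eq_bigr do rewrite exchange_big /=.
rewrite exchange_big /= !big_nat; apply: eq_bigr => i hi.
transitivity ((3 %| i)%N%:R * (\sum_(0 <= y < N.+1) (y * y == 8 * i + 1)%N%:R) *
   (\sum_(0 <= x < N.+1) (x * x == 4 * (3 * (n - i) + 1))%N%:R) : 'F_2).
  rewrite -!natr_sum !sum_sqr ?is_sqr4 -?natrM ?mulnb //; rewrite /N; lia.
rewrite mulr_sumr; apply: eq_bigr => x _; rewrite mulrAC mulr_sumr.
by apply: eq_bigr => y _; rewrite -!natrM !mulnb; congr ((nat_of_bool _)%:R); rewrite andbAC andbA.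
Qed.

Lemma odd_A n : odd (A (2 * n + 1)) = odd (absz (qcoef (24 * n + 11))).
Proof.
have h (m : nat) : odd m = ((m%:R : 'F_2) != 0).
  by rewrite -(dvdn_pcharf (pchar_Fp (isT : prime 2))) dvdn2 negbK.
rewrite h A_qcoef h; congr (_ != _); rewrite pmulrn; apply: F2_intr_eq; lia.
Qed.

(** * Logarithmic derivatives of Dirichlet series *)

(** Having exactly one prime divisor characterizes the prime powers above 1. *)
Definition ppow (d : nat) : bool := size (primes d) == 1.

Lemma ppow_pfactor p j : prime p -> (0 < j)%N -> ppow (p ^ j).
Proof. by move=> pr j0; rewrite /ppow primesX // primes_prime. Qed.

Lemma ppowP d : ppow d -> exists p j, [/\ prime p, (0 < j)%N & d = (p ^ j)%N].
Proof.
rewrite /ppow; case E : (primes d) => [|p [|//]] // _.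
have := mem_primes p d; rewrite E mem_head => /esym/and3P[pr d0 pd].
have : p.-nat d by rewrite /pnat d0 E /= andbT inE.
case/p_natP=> j dj; exists p, j; split=> //; case: j dj => // dj.
by move: pd; rewrite dj dvdn1 => /eqP p1; rewrite p1 in pr.
Qed.

Lemma sum_dvdn_mul (V : nmodType) (g : nat -> V) (d X : nat) : (0 < d)%N ->
  \sum_(1 <= n < X.+1 | (d %| n)%N) g n = \sum_(1 <= m < (X %/ d).+1) g (d * m)%N.
Proof.
move=> d0; rewrite -[RHS](big_map (muln d) xpredT g) -[LHS]big_filter.
apply: perm_big; apply: uniq_perm.
- by rewrite filter_uniq ?iota_uniq.
- by rewrite map_inj_uniq ?iota_uniq // => a b /eqP; rewrite eqn_pmul2l // => /eqP.
move=> n; rewrite mem_filter mem_index_iota; apply/idP/mapP => [/andP[dn hn]|[m]].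
  exists (n %/ d)%N; last by rewrite mulnC divnK.
  rewrite mem_index_iota ltnS leq_div2r ?andbT; last by lia.
  by rewrite divn_gt0 // dvdn_leq //; lia.
rewrite mem_index_iota ltnS leq_divRL // => hm ->; rewrite dvdn_mulr //=.
by rewrite muln_gt0 d0 ltnS mulnC; lia.
Qed.

(** Summation over n and its divisors d, rearranged as a sum over pairs d, m
    with d m <= X. *)
Lemma sum_dirichlet (V : nmodType) (h : nat -> nat -> V) (X : nat) :
  \sum_(1 <= n < X.+1) \sum_(1 <= d < n.+1 | (d %| n)%N) h d (n %/ d)%N =
  \sum_(1 <= d < X.+1) \sum_(1 <= m < (X %/ d).+1) h d m.
Proof.
transitivity (\sum_(1 <= n < X.+1) \sum_(1 <= d < X.+1 | (d %| n)%N) h d (n %/ d)%N).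
  rewrite !big_nat; apply: eq_bigr => n hn.
  rewrite [RHS](big_cat_nat _ (n := n.+1)) //=; last by lia.
  rewrite [X in _ = _ + X]big_nat_cond [X in _ = _ + X]big1 ?addr0 // => d.
  by move=> /andP[hd /dvdn_leq]; lia.
rewrite (exchange_big_dep xpredT) //= !big_nat; apply: eq_bigr => d hd.
rewrite sum_dvdn_mul; last by lia.
by apply: eq_bigr => m _; rewrite mulKn //; lia.
Qed.

Lemma sum_ppow (V : nmodType) (g : nat -> V) n : (0 < n)%N ->
  \sum_(1 <= d < n.+1 | (d %| n)%N && ppow d) g d =
  \sum_(p <- primes n) \sum_(1 <= j < (logn p n).+1) g (p ^ j)%N.
Proof.
move=> n0.
have -> : \sum_(p <- primes n) \sum_(1 <= j < (logn p n).+1) g (p ^ j)%N =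
   \sum_(d <- [seq (p ^ j)%N | p <- primes n, j <- index_iota 1 (logn p n).+1]) g d.
  by rewrite big_allpairs_dep.
rewrite -[LHS]big_filter; apply: perm_big; apply: uniq_perm.
- by rewrite filter_uniq ?iota_uniq.
- apply: allpairs_uniq_dep; first exact: primes_uniq.
    by move=> p _; apply: iota_uniq.
  move=> [p j] [q k] /allpairsPdep[p' [j' [+ + e1]]] /allpairsPdep[q' [k' [+ + e2]]] /=.
  case: e1 => -> ->; case: e2 => -> -> /=.
  rewrite !mem_primes !mem_index_iota => /andP[prp _] hj /andP[prq _] hk e.
  have pq : p' = q'.
    have : (p' %| q' ^ k')%N by rewrite -e dvdn_exp //; lia.
    by rewrite Euclid_dvdX // dvdn_prime2 // => /andP[/eqP].
  by move: e; rewrite pq => /(congr1 (logn q')); rewrite !pfactorK // => ->.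
move=> d; rewrite mem_filter mem_index_iota; apply/idP/allpairsPdep.
  move=> /andP[/andP[dn /ppowP[p [j [pr j0 dj]]]] hd]; exists p, j.
  rewrite mem_primes pr n0 mem_index_iota j0 ltnS -pfactor_dvdn // -dj dn; split => //.
  by rewrite (dvdn_trans _ dn) // dj dvdn_exp.
move=> [p [j [+ + ->]]]; rewrite mem_primes mem_index_iota => /and3P[pr _ pn] /andP[j0 jl].
rewrite ppow_pfactor // pfactor_dvdn // -ltnS jl expn_gt0 prime_gt0 //= ltnS.
by apply: dvdn_leq => //; rewrite pfactor_dvdn // -ltnS.
Qed.

Section PowerSums.
Variables t e : int.

(** Two consecutive power sums of the roots of T^2 - t T + e, the recurrence
    being of order two. *)
Fixpoint psum2 (j : nat) : int * int :=
  if j is j'.+1 then let ab := psum2 j' in (ab.2, t * ab.2 - e * ab.1) else (2, t).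

Definition psum j := (psum2 j).1.

Lemma psumS j : psum j.+2 = t * psum j.+1 - e * psum j.
Proof. by []. Qed.

(** Newton's identities for two roots: the power sums against the complete
    homogeneous symmetric functions, or any solution of the recurrence with
    the same first ratio. *)
Lemma psum_conv (g : nat -> int) : g 1%N = t * g 0%N ->
  (forall k, g k.+2 = t * g k.+1 - e * g k) ->
  forall k, k%:Z * g k = \sum_(1 <= j < k.+1) psum j * g (k - j)%N.
Proof.
move=> g1 gS k.
suff : k%:Z * g k = \sum_(1 <= j < k.+1) psum j * g (k - j)%N /\
    k.+1%:Z * g k.+1 = \sum_(1 <= j < k.+2) psum j * g (k.+1 - j)%N by case.
elim: k => [|k [IH0 IH1]].
  by split; [rewrite big_geq // mul0r|rewrite big_nat1 subnn mul1r g1].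
split => //; rewrite big_ltn // big_add1 /=.
rewrite big_add1 /= in IH1.
have -> : \sum_(1 <= i < k.+2) psum i.+1 * g (k.+2 - i.+1)%N =
    t * (k.+1%:Z * g k.+1) - e * (2 * g k + k%:Z * g k).
  rewrite IH1 IH0 big_add1 /= [X in _ - e * (_ + X)]big_add1 /=.
  transitivity (t * (\sum_(0 <= i < k.+1) psum i.+1 * g (k.+1 - i.+1)%N)
     - e * (\sum_(0 <= i < k.+1) psum i * g (k - i)%N)).
    rewrite !mulr_sumr -sumrB; apply: eq_bigr => i _; rewrite psumS !subSS; ring.
  congr (_ - _ * _).
  by rewrite big_nat_recl // subn0.
by rewrite gS subn1 /=; rewrite /psum /=; lia.
Qed.

End PowerSums.

Lemma psum_bound t e j : (t, e) \in [:: (2, 1); (-1, 1); (0, -1); (1, 0); (0, 0)] ->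
  -1 <= psum t e j <= 2.
Proof.
rewrite /psum !inE => /orP[|/orP[|/orP[|/orP[|]]]] /eqP[-> ->].
- suff -> : psum2 2 1 j = (2, 2) by []. by elim: j => //= j ->.
- suff : psum2 (-1) 1 j \in [:: (2, -1); (-1, -1); (-1, 2)].
    by rewrite !inE => /or3P[] /eqP ->.
  elim: j => //= j; by rewrite !inE => /or3P[] /eqP ->.
- suff : psum2 0 (-1) j \in [:: (2, 0); (0, 2)].
    by rewrite !inE => /orP[] /eqP ->.
  elim: j => //= j; by rewrite !inE => /orP[] /eqP ->.
- suff : psum2 1 0 j \in [:: (2, 1); (1, 1)].
    by rewrite !inE => /orP[] /eqP ->.
  elim: j => //= j; by rewrite !inE => /orP[] /eqP ->.
- suff : psum2 0 0 j \in [:: (2, 0); (0, 0)].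
    by rewrite !inE => /orP[] /eqP ->.
  elim: j => //= j; by rewrite !inE => /orP[] /eqP ->.
Qed.

(** The function p^j -> c p j * ln p is the sequence of coefficients of minus
    the logarithmic derivative of the Dirichlet series of f. The logarithms
    are dropped by treating one prime at a time: multiplying f by the p-adic
    valuation is a convolution with c p. *)
Definition logder (V : pzRingType) (f : nat -> V) (c : nat -> nat -> V) :=
  forall p n, prime p -> (0 < n)%N ->
  (logn p n)%:R * f n = \sum_(1 <= j < (logn p n).+1) c p j * f (n %/ p ^ j)%N.

(** The Hecke relation is a recurrence of order two along the powers of p, so
    Newton's identities apply. *)
Lemma logder_qcoef : logder qcoef (fun p j => psum (qcoef p) (chi p) j).
Proof.
move=> p n pr n0; have p0 := prime_gt0 pr.
have [m cm nE] := pfactor_coprime pr n0.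
have nm : (p %| m)%N = false by apply/negbTE; rewrite -prime_coprime.
pose g k := qcoef (p ^ k * m).
have gS k : g k.+2 = qcoef p * g k.+1 - chi p * g k.
  rewrite /g expnS -mulnA qcoef_Hecke // /odiv expnS -mulnA dvdn_mulr ?dvdnn // mulKn //.
have g1 : g 1%N = qcoef p * g 0%N.
  by rewrite /g expn1 expn0 mul1n qcoef_Hecke // /odiv nm mulr0 subr0.
have -> : qcoef n = g (logn p n) by rewrite /g {1}nE mulnC.
rewrite natz (psum_conv g1 gS) !big_nat; apply: eq_bigr => j hj; congr (_ * _).
rewrite /g {2}nE; congr qcoef.
have -> : (logn p n = (logn p n - j) + j)%N by lia.
by rewrite expnD mulnA mulnK ?expn_gt0 ?p0 // addnK mulnC.
Qed.

Section Mangoldt.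
Variable R : realType.
Implicit Types (f : nat -> R) (c : nat -> nat -> R).

(** The von Mangoldt function twisted by c: its value at p^j is c p j * ln p. *)
Definition mangoldt c (d : nat) : R :=
  if ppow d then c (pdiv d) (logn (pdiv d) d) * ln (pdiv d)%:R else 0.

Lemma mangoldt_pfactor c p j : prime p -> (0 < j)%N ->
  mangoldt c (p ^ j)%N = c p j * ln p%:R.
Proof.
case: j => // j pr _.
by rewrite /mangoldt ppow_pfactor // pdiv_pfactor // pfactorK.
Qed.

Lemma ln_primes n : (0 < n)%N -> ln (n%:R : R) = \sum_(p <- primes n) (logn p n)%:R * ln p%:R.
Proof.
move=> n0; rewrite {1}(prod_prime_decomp n0) prime_decompE big_map /= big_seq [RHS]big_seq.
have : {in primes n, forall p, 0 < p}%N.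
  by move=> p; rewrite mem_primes => /andP[/prime_gt0].
elim: (primes n) => [|p s IH] h; first by rewrite -!big_seq !big_nil ln1.
rewrite -!big_seq in IH *; rewrite !big_cons natrM natrX lnM ?posrE; last 2 first.
- by rewrite exprn_gt0 // ltr0n h ?mem_head.
- rewrite ltr0n big_seq; apply: prodn_cond_gt0 => q qs.
  by rewrite expn_gt0 h // inE qs orbT.
rewrite IH; last by move=> q qs; apply: h; rewrite inE qs orbT.
by rewrite lnXn ?ltr0n ?h ?mem_head // mulr_natl.
Qed.

(** Writing ln n as the sum of the logarithms of its prime factors turns the
    identities at single primes into the convolution identity for f * ln. *)
Lemma logder_mangoldt f c n : logder f c -> (0 < n)%N ->
  f n * ln n%:R = \sum_(1 <= d < n.+1 | (d %| n)%N) mangoldt c d * f (n %/ d)%N.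
Proof.
move=> lf n0; rewrite ln_primes // mulr_sumr.
transitivity (\sum_(1 <= d < n.+1 | (d %| n)%N && ppow d) mangoldt c d * f (n %/ d)%N); last first.
  rewrite [RHS]big_mkcond [LHS]big_mkcond; apply: eq_bigr => d _.
  by rewrite /mangoldt; case: (_ %| _)%N => //=; case: ppow; rewrite ?mul0r.
rewrite (sum_ppow (fun d => mangoldt c d * f (n %/ d)%N)) // big_seq [RHS]big_seq.
apply: eq_bigr => p; rewrite mem_primes => /and3P[pr _ _].
rewrite mulrCA mulrA lf // mulr_suml !big_nat; apply: eq_bigr => j hj.
by rewrite mangoldt_pfactor 1?mulrAC //; lia.
Qed.

Lemma logder1 : logder (fun=> 1) (fun _ _ => 1 : R).
Proof.
move=> p n pr n0; rewrite mulr1; under eq_bigr do rewrite mulr1.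
by rewrite sumr_const_nat subn1.
Qed.

Lemma chi1 : chi 1 = 1. Proof. by []. Qed.

Lemma logder_chi : logder (fun n => (chi n)%:~R) (fun p j => (chi (p ^ j))%:~R : R).
Proof.
move=> p n pr n0; transitivity (\sum_(1 <= j < (logn p n).+1) (chi n)%:~R : R).
  by rewrite sumr_const_nat subn1 mulr_natl.
rewrite !big_nat; apply: eq_bigr => j hj.
rewrite -intrM -chiM mulnC divnK // pfactor_dvdn //; lia.
Qed.

Lemma logder_qcoefR : logder (fun n => (qcoef n)%:~R)
  (fun p j => (psum (qcoef p) (chi p) j)%:~R : R).
Proof.
move=> p n pr n0; have := congr1 (intmul (1 : R)) (logder_qcoef pr n0).
rewrite rmorphM /= natz -pmulrn => ->; rewrite rmorph_sum /=.
by apply: eq_bigr => j _; rewrite rmorphM.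
Qed.

Lemma sum_logder f c X : logder f c ->
  \sum_(1 <= n < X.+1) f n * ln n%:R / n%:R =
  \sum_(1 <= d < X.+1) mangoldt c d / d%:R * \sum_(1 <= m < (X %/ d).+1) f m / m%:R.
Proof.
move=> lf; under [RHS]eq_bigr do rewrite mulr_sumr.
rewrite -(sum_dirichlet (fun d m => mangoldt c d / d%:R * (f m / m%:R))).
rewrite !big_nat; apply: eq_bigr => n hn; rewrite (logder_mangoldt lf) ?mulr_suml; last by lia.
rewrite big_nat_cond [RHS]big_nat_cond; apply: eq_bigr => d /andP[hd dn].
rewrite mulrACA -invfM; congr (_ * _ / _); rewrite -natrM; congr (_%:R).
by rewrite mulnC divnK.
Qed.

End Mangoldt.

(** * Chebyshev and Mertens estimates *)

Section Sums.
Variable R : realType.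
Implicit Types (f g w : nat -> R) (c : nat -> nat -> R).

Local Notation rt n := (Num.sqrt (n%:R : R)).

Lemma rt_ge0 n : 0 <= rt n. Proof. exact: sqrtr_ge0. Qed.
Lemma rt_gt0 n : (0 < n)%N -> 0 < rt n. Proof. by rewrite sqrtr_gt0 ltr0n. Qed.
Lemma rt_sqr n : rt n * rt n = n%:R. Proof. by rewrite -expr2 sqr_sqrtr. Qed.
Lemma rt_le m n : (m <= n)%N -> rt m <= rt n.
Proof. by move=> mn; rewrite ler_sqrt ?ler_nat. Qed.

Lemma lnS_sub n : (0 < n)%N -> ln (n.+1%:R : R) - ln n%:R <= n%:R^-1.
Proof.
move=> n0; have n0R : 0 < n%:R :> R by rewrite ltr0n.
rewrite -ln_div ?posrE ?ltr0n //.
have -> : n.+1%:R / n%:R = 1 + n%:R^-1 :> R by rewrite -natr1 mulrDl mul1r divff ?lt0r_neq0 // addrC.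
apply: le_ln1Dx; apply: lt_trans (_ : 0 < _); rewrite ?invr_gt0 //; lra.
Qed.

Lemma ln_nat_ge0 n : 0 <= ln (n%:R : R).
Proof. by case: n => [|n]; [rewrite ln0|rewrite ln_ge0 // ler1n]. Qed.

Lemma ln_nat_le m n : (m <= n)%N -> ln (m%:R : R) <= ln n%:R.
Proof.
case: m => [|m] mn; first by rewrite ln0 // ln_nat_ge0.
by rewrite ler_ln ?posrE ?ltr0n ?ler_nat //; lia.
Qed.

(** Abel summation: a bound for partial sums survives multiplication by
    decreasing weights. *)
Lemma abel_le g w (C : R) :
  (forall n, 0 <= w n) -> (forall n, (0 < n)%N -> w n.+1 <= w n) ->
  (forall X, \sum_(1 <= n < X.+1) g n <= C * X%:R) ->
  forall X, \sum_(1 <= n < X.+1) g n * w n <= C * \sum_(1 <= n < X.+1) w n.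
Proof.
move=> w0 wd gC X.
have H Y : \sum_(1 <= n < Y.+1) (g n - C) <= 0.
  by rewrite sumrB sumr_const_nat subn1 /= -mulr_natr subr_le0.
suff : \sum_(1 <= n < X.+1) (g n - C) * w n <= (\sum_(1 <= n < X.+1) (g n - C)) * w X.
  move=> h; rewrite mulr_sumr -subr_le0 -sumrB.
  under eq_bigr do rewrite -mulrBl.
  by apply: le_trans h _; rewrite mulr_le0_ge0.
elim: X => [|X IH]; first by rewrite !big_geq // mul0r.
rewrite big_nat_recr //= [X in _ <= X * _]big_nat_recr //= [leRHS]mulrDl lerD2r.
case: X IH => [|X] IH; first by rewrite !big_geq // mul0r.
by apply: le_trans IH _; rewrite ler_wnM2l // wd.
Qed.

Lemma sum_inv_rt X : \sum_(1 <= n < X.+1) (rt n)^-1 <= 2 * rt X.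
Proof.
elim: X => [|X IH]; first by rewrite big_geq // mulr_ge0.
rewrite big_nat_recr //=; apply: le_trans (lerD IH (lexx _)) _.
have h0 := rt_ge0 X; have h1 := rt_gt0 (isT : (0 < X.+1)%N).
have : rt X.+1 * rt X.+1 = rt X * rt X + 1 by rewrite !rt_sqr natr1.
move: (rt X) (rt X.+1) h0 h1 => a b a0 b0 e.
rewrite -subr_ge0 -(pmulr_rge0 _ b0) mulrBr mulrDr mulfV ?gt_eqF //.
by have := sqr_ge0 (b - a); nra.
Qed.

Lemma sum_inv_harm (X : nat) : (0 < X)%N -> \sum_(1 <= n < X.+1) (n%:R : R)^-1 <= 1 + ln X%:R.
Proof.
elim: X => // X IH _; case: X IH => [|X] IH.
  by rewrite big_nat1 ln1 invr1 addr0.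
rewrite big_nat_recr //=; apply: le_trans (lerD (IH isT) (lexx _)) _.
rewrite -addrA lerD2l -lerBrDl.
have X0 : 0 < X.+1%:R :> R by rewrite ltr0n.
have : ln (X.+1%:R / X.+2%:R : R) <= X.+1%:R / X.+2%:R - 1.
  have r0 : 0 < X.+1%:R / X.+2%:R :> R by rewrite divr_gt0.
  move: (_ / _) r0 => r r0.
  have := @le_ln1Dx R (r - 1); rewrite (addrC 1) subrK; apply; lra.
have -> : X.+1%:R / X.+2%:R - 1 = - X.+2%:R^-1 :> R.
  have e : X.+1%:R = X.+2%:R - 1 :> R by rewrite -[X.+2%:R]natr1 addrK.
  have : X.+2%:R != 0 :> R by rewrite pnatr_eq0.
  by rewrite e; move: (X.+2%:R : R) => c c0; field.
rewrite ln_div ?posrE ?ltr0n //; move: (ln _) (ln _) (_^-1) => a b c h; lra.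
Qed.

(** The sum telescopes against 2 / sqrt k. *)
Lemma sum_inv_pow32 X : (0 < X)%N ->
  \sum_(1 <= k < X.+1) (k%:R * rt k)^-1 <= 3 - 2 / rt X.
Proof.
elim: X => // X IH _; case: X IH => [|X] IH.
  by rewrite big_nat1 sqrtr1 mul1r invr1; lra.
rewrite big_nat_recr //=; apply: le_trans (lerD (IH isT) (lexx _)) _.
have h0 := rt_gt0 (isT : (0 < X.+1)%N); have h1 := rt_gt0 (isT : (0 < X.+2)%N).
have h2 := rt_sqr X.+1; have h3 := rt_sqr X.+2.
have h4 := rt_le (leqnSn X.+1).
have e : rt X.+2 * rt X.+2 = rt X.+1 * rt X.+1 + 1 by rewrite h2 h3 natr1.
move: (rt X.+1) (rt X.+2) h0 h1 h3 h4 e {IH h2} => a b a0 b0 hb ab e.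
rewrite -hb -addrA lerD2l -subr_ge0.
have -> : - (2 / b) - (- (2 / a) + (b * b * b)^-1) = (2 * b * b * (b - a) - a) / (a * (b * b * b)).
  by field; rewrite !gt_eqF.
apply: divr_ge0; last by rewrite !mulr_ge0 // ltW.
have : (b - a) * (b + a) = 1 by rewrite -subr_sqr !expr2 e; ring.
nra.
Qed.

Definition vonMangoldt : nat -> R := mangoldt (fun _ _ => 1).

Local Notation Lam := vonMangoldt.

Lemma Lam_ge0 d : 0 <= Lam d.
Proof. by rewrite /vonMangoldt /mangoldt; case: ifP => // _; rewrite mul1r ln_nat_ge0. Qed.

Lemma sum_ln_Lam X : \sum_(1 <= n < X.+1) ln (n%:R : R) =
  \sum_(1 <= d < X.+1) Lam d * (X %/ d)%:R.
Proof.
transitivity (\sum_(1 <= n < X.+1) \sum_(1 <= d < n.+1 | (d %| n)%N) Lam d).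
  rewrite !big_nat; apply: eq_bigr => n hn.
  rewrite -[LHS]mul1r (logder_mangoldt (@logder1 R)); last by lia.
  by apply: eq_bigr => d _; rewrite mulr1.
rewrite (sum_dirichlet (fun d _ => Lam d)); apply: eq_bigr => d _.
by rewrite sumr_const_nat subn1 mulr_natr.
Qed.

Lemma sum_ln_le X : \sum_(1 <= n < X.+1) ln (n%:R : R) <= X%:R * ln X%:R.
Proof.
apply: (@le_trans _ _ (\sum_(1 <= n < X.+1) ln (X%:R : R))).
  by rewrite !big_nat; apply: ler_sum => n hn; apply: ln_nat_le; lia.
by rewrite sumr_const_nat subn1 /= mulr_natl.
Qed.

Lemma sum_ln_ge X : X%:R * ln X%:R - X%:R <= \sum_(1 <= n < X.+1) ln (n%:R : R).
Proof.
elim: X => [|X IH]; first by rewrite big_geq // mul0r subr0.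
rewrite big_nat_recr //=; apply: le_trans (lerD IH (lexx _)).
case: X {IH} => [|X]; first by rewrite ln1; lra.
have := lnS_sub (isT : (0 < X.+1)%N); rewrite -(ler_pM2l (_ : 0 < X.+1%:R)) ?ltr0n // divff ?pnatr_eq0 //.
rewrite -[X.+2%:R]natr1; set a := X.+1%:R; set l := ln (a + 1); set m := ln a.
by nra.
Qed.

Lemma ln2_le1 : ln (2 : R) <= 1.
Proof. by have := @le_ln1Dx R 1 ltac:(lra). Qed.

(** Chebyshev's argument: the logarithm of the central binomial coefficient of
    2 n is at most 2 n, and it is the sum of Lam d times (2 n) %/ d - 2 (n %/
    d), which is nonnegative, and at least 1 when n < d <= 2 n. *)
Lemma psi_dyadic n : \sum_(n.+1 <= d < (2 * n).+1) Lam d <= 2 * n%:R.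
Proof.
have h1 : \sum_(1 <= m < (2 * n).+1) ln (m%:R : R) <= 2 * \sum_(1 <= m < n.+1) ln m%:R + 2 * n%:R.
  elim: n => [|n IH]; first by rewrite !big_geq // !mulr0 addr0.
  rewrite (_ : (2 * n.+1).+1 = (2 * n).+3)%N; last by lia.
  rewrite 2!(big_nat_recr _ _ _ (ltn0Sn _)) /= [X in 2 * X]big_nat_recr //=.
  have l2 := ln2_le1.
  have e2 : ln ((2 * n).+2%:R : R) = ln 2 + ln n.+1%:R.
    by rewrite -lnM ?posrE ?ltr0n // -natrM; congr (ln _%:R); lia.
  have e1 := ln_nat_le (leqnSn (2 * n).+1); rewrite e2 in e1.
  have e3 : n.+1%:R = n%:R + 1 :> R by rewrite natr1.
  move: (ln (2 * n).+1%:R) (ln (2 * n).+2%:R) (ln n.+1%:R) e1 e2 => u v z e1 e2.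
  rewrite e3; lra.
have e : \sum_(1 <= m < n.+1) ln m%:R = \sum_(1 <= d < (2 * n).+1) Lam d * (n %/ d)%:R.
  rewrite sum_ln_Lam [RHS](big_cat_nat _ (n := n.+1)) //=; last by lia.
  rewrite [X in _ = _ + X]big_nat [X in _ = _ + X]big1 ?addr0 // => d hd.
  by rewrite divn_small ?mulr0 //; lia.
move: h1; rewrite sum_ln_Lam e mulr_sumr -lerBlDl -sumrB; apply: le_trans.
rewrite [leRHS](big_cat_nat _ (n := n.+1)) //=; last by lia.
apply: ler_wpDl.
  apply: sumr_ge0 => d _; rewrite mulrCA -mulrBr mulr_ge0 ?Lam_ge0 // subr_ge0 -natrM ler_nat.
  case: d => [|d]; first by rewrite !divn0.
  by rewrite leq_divRL // -mulnA leq_mul2l leq_trunc_div orbT.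
rewrite !big_nat; apply: ler_sum => d hd.
rewrite (@divn_small n) ?mulr0 ?subr0; last by lia.
rewrite ler_peMr ?Lam_ge0 // ler1n divn_gt0; lia.
Qed.

(** Dyadic summation of [psi_dyadic]. *)
Lemma chebyshev X : \sum_(1 <= d < X.+1) Lam d <= 4 * X%:R.
Proof.
elim/ltn_ind: X => X IH.
have [->|[->|X2]] : X = 0%N \/ X = 1%N \/ (1 < X)%N by lia.
- by rewrite big_geq // mulr0.
- by rewrite big_nat1 /vonMangoldt /mangoldt (_ : ppow 1 = false) // mulr_ge0.
pose n := (X./2 + odd X)%N.
have nX : (n < X)%N by rewrite /n; lia.
apply: (@le_trans _ _ (\sum_(1 <= d < (2 * n).+1) Lam d)).
  rewrite [leRHS](big_cat_nat _ (n := X.+1)) //=; last by rewrite /n; lia.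
  by rewrite lerDl sumr_ge0 // => d _; apply: Lam_ge0.
rewrite (big_cat_nat _ (n := n.+1)) //=; last by rewrite /n; lia.
apply: le_trans (lerD (IH _ nX) (psi_dyadic n)) _.
by rewrite -!natrM -natrD ler_nat /n; lia.
Qed.

(** Mertens' first theorem, comparing ln (X!) with the sum of Lam d * (X %/
    d); Chebyshev's bound controls the fractional parts. *)
Lemma mertens X : (0 < X)%N -> -1 <= \sum_(1 <= d < X.+1) Lam d / d%:R - ln X%:R <= 4.
Proof.
move=> X0; have X0R : 0 < X%:R :> R by rewrite ltr0n.
have e : X%:R * \sum_(1 <= d < X.+1) Lam d / d%:R = \sum_(1 <= d < X.+1) Lam d * (X%:R / d%:R).
  by rewrite mulr_sumr; apply: eq_bigr => d _; rewrite mulrCA.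
apply/andP; split; rewrite -(ler_pM2l X0R) mulrBr e.
  apply: le_trans (_ : _ <= \sum_(1 <= d < X.+1) Lam d * (X %/ d)%:R - X%:R * ln X%:R) _.
    by rewrite -sum_ln_Lam; have := sum_ln_ge X; lra.
  rewrite lerD2r !big_nat; apply: ler_sum => d hd; apply: ler_wpM2l; first exact: Lam_ge0.
  by rewrite ler_pdivlMr ?ltr0n -?natrM ?ler_nat ?leq_trunc_div //; lia.
apply: le_trans (_ : \sum_(1 <= d < X.+1) Lam d * ((X %/ d)%:R + 1) - X%:R * ln X%:R <= _).
  rewrite lerD2r !big_nat; apply: ler_sum => d hd; apply: ler_wpM2l; first exact: Lam_ge0.
  rewrite ler_pdivrMr ?ltr0n -?natrM ?natr1 ?ler_nat; last by lia.
  by rewrite -natrM ler_nat ltnW // ltn_ceil //; lia.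
under eq_bigr do rewrite mulrDr mulr1.
rewrite big_split /= -sum_ln_Lam.
have := sum_ln_le X; have := chebyshev X; lra.
Qed.

Lemma sum_Lam_rt X : \sum_(1 <= d < X.+1) Lam d / rt d <= 8 * rt X.
Proof.
apply: le_trans (@abel_le Lam (fun n => (rt n)^-1) 4 _ _ chebyshev X) _.
- by move=> n; rewrite invr_ge0.
- by move=> n n0; rewrite lef_pV2 ?posrE ?rt_gt0 // rt_le.
by have := sum_inv_rt X; lra.
Qed.

Lemma exists_ln_ge (K : R) : exists z0 : nat, forall z, (z0 <= z)%N -> K <= ln (z%:R : R).
Proof.
exists (Num.truncn (expR K)).+1 => z hz.
rewrite -[leLHS]expRK ler_ln ?posrE ?expR_gt0 //; last by rewrite ltr0n; lia.
by apply/ltW; apply: lt_le_trans (truncnS_gt _) _; rewrite ler_nat.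
Qed.

(** The quotient X %/ d is at least X / (2 d). *)
Lemma inv_rt_div X d : (0 < d)%N -> (d <= X)%N -> (rt (X %/ d))^-1 <= 2 * rt d / rt X.
Proof.
move=> d0 dX; have q0 : (0 < X %/ d)%N by rewrite divn_gt0.
have X0 : (0 < X)%N by lia.
rewrite ler_pdivlMr ?rt_gt0 // -ler_pdivlMl ?invr_gt0 ?rt_gt0 // invrK.
rewrite mulrCA -[leRHS]ger0_norm ?mulr_ge0 // -sqrtr_sqr -[rt X]ger0_norm // -sqrtr_sqr.
rewrite ler_sqrt ?sqr_ge0 // !exprMn !expr2 !rt_sqr -!natrM ler_nat.
by have := divn_eq X d; have := ltn_pmod X d0; nia.
Qed.

(** Partial sums of the Dirichlet series of f at 1. *)
Definition hsum f (X : nat) : R := \sum_(1 <= n < X.+1) f n / n%:R.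

Lemma hsumS f X : hsum f X.+1 = hsum f X + f X.+1 / X.+1%:R.
Proof. by rewrite /hsum big_nat_recr. Qed.

Section Cancel.
Variables (f : nat -> R) (C : R).
Hypothesis fC : forall X, `|\sum_(1 <= n < X.+1) f n| <= C * rt X.

Lemma cancel_const_ge0 : 0 <= C.
Proof. by have := fC 1; rewrite sqrtr1 mulr1; apply: le_trans. Qed.

(** Abel summation: partial sums of size sqrt n against the decrements 1 / n^2
    of 1 / n leave a tail of size 1 / sqrt X. *)
Lemma hsum_cauchy X Y : (0 < X <= Y)%N -> `|hsum f Y - hsum f X| <= 4 * C / rt X.
Proof.
case/andP=> X0 XY; have C0 := cancel_const_ge0.
pose U n := \sum_(1 <= m < n.+1) f m.
have UB n : (0 < n)%N -> `|U n / n.+1%:R| <= C / rt n.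
  move=> n0; rewrite normrM normfV (ger0_norm (ler0n _ n.+1)).
  rewrite ler_pdivrMr ?ltr0n // mulrAC ler_pdivlMr ?rt_gt0 //.
  apply: le_trans (ler_wpM2r (rt_ge0 n) (fC n)) _.
  by rewrite -mulrA rt_sqr ler_wpM2l // ler_nat.
have key : `|(hsum f Y - U Y / Y.+1%:R) - (hsum f X - U X / X.+1%:R)|
    <= 2 * C * ((rt X)^-1 - (rt Y)^-1).
  elim: Y XY => [|Y IH]; first by rewrite leqn0 => /eqP ->; rewrite !subrr normr0 mulr0.
  rewrite leq_eqVlt => /orP[/eqP ->|XY]; first by rewrite !subrr normr0 mulr0.
  have Y0 : (0 < Y)%N by lia.
  have e : hsum f Y.+1 - U Y.+1 / Y.+2%:R =
     (hsum f Y - U Y / Y.+1%:R) + U Y.+1 * (Y.+1%:R^-1 - Y.+2%:R^-1).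
    have -> : U Y.+1 = U Y + f Y.+1 by rewrite /U big_nat_recr.
    by rewrite hsumS; ring.
  rewrite e addrAC; apply: le_trans (ler_normD _ _) _.
  apply: le_trans (lerD (IH XY) (lexx _)) _.
  have st : `|U Y.+1 * (Y.+1%:R^-1 - Y.+2%:R^-1)| <= 2 * C * ((rt Y)^-1 - (rt Y.+1)^-1).
    have d0 : 0 <= Y.+1%:R^-1 - Y.+2%:R^-1 :> R.
      by rewrite subr_ge0 lef_pV2 ?posrE ?ltr0n // ler_nat.
    rewrite normrM (ger0_norm d0).
    apply: le_trans (ler_wpM2r d0 (fC _)) _.
    rewrite (mulrC 2) -!mulrA ler_wpM2l //.
    have e1 : rt Y.+1 * rt Y.+1 = rt Y * rt Y + 1 by rewrite !rt_sqr natr1.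
    have e2 : Y.+2%:R = rt Y.+1 * rt Y.+1 + 1 by rewrite !rt_sqr natr1.
    have e3 := rt_sqr Y.+1.
    move: (rt_gt0 Y0) (rt_gt0 (isT : (0 < Y.+1)%N)) e1 e2 e3.
    move: (rt Y) (rt Y.+1) => a b a0 b0 e1 e2 e3.
    rewrite e2 -e3 -subr_ge0.
    have -> : 2 * (a^-1 - b^-1) - b * ((b * b)^-1 - (b * b + 1)^-1) =
       (2 * (b - a) * (b * b + 1) - a) / (a * b * (b * b + 1)).
      by field; rewrite !gt_eqF // addr_gt0 // mulr_gt0.
    apply: divr_ge0; last by rewrite !mulr_ge0 ?addr_ge0 ?mulr_ge0 // ltW.
    have : (b - a) * (b + a) = 1 by rewrite -subr_sqr !expr2 e1; ring.
    have : a <= b by nra.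
    nra.
  by apply: le_trans (lerD (lexx _) st) _; lra.
have hY : C / rt Y <= C / rt X.
  by rewrite ler_wpM2l // lef_pV2 ?posrE ?rt_gt0 ?rt_le //; lia.
have Y0 : 0 <= 2 * C * (rt Y)^-1 by rewrite !mulr_ge0 // invr_ge0.
have := UB X X0; have := UB Y ltac:(lia).
move: key hY Y0; rewrite !ler_norml.
move: ((rt X)^-1) ((rt Y)^-1) (U Y / _) (U X / _) (hsum f Y) (hsum f X) => p q u v s t.
rewrite mulrBr -!(mulrA _ C); move: (C * p) (C * q) => {}p {}q.
move=> /andP[k1 k2] h Y0 /andP[a1 a2] /andP[b1 b2]; apply/andP; split; lra.
Qed.

(** Abel summation against the logarithm, whose increments 1 / k beat the
    error 1 / sqrt k of [hsum_cauchy]. *)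
Lemma hsum_ln_bounded X : `|\sum_(1 <= n < X.+1) f n * ln n%:R / n%:R| <= 12 * C.
Proof.
have C0 := cancel_const_ge0.
have -> : \sum_(1 <= n < X.+1) f n * ln n%:R / n%:R =
    \sum_(1 <= k < X) (ln k.+1%:R - ln k%:R) * (hsum f X - hsum f k).
  case: X => [|X]; first by rewrite !big_geq.
  elim: X => [|X IH]; first by rewrite big_nat1 big_geq // ln1 mulr0 mul0r.
  rewrite big_nat_recr //= IH [RHS]big_nat_recr //= [hsum f X.+2]hsumS.
  have -> : \sum_(1 <= k < X.+1) (ln k.+1%:R - ln k%:R) * (hsum f X.+1 + f X.+2 / X.+2%:R - hsum f k)
     = \sum_(1 <= k < X.+1) (ln k.+1%:R - ln k%:R) * (hsum f X.+1 - hsum f k)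
     + ln X.+1%:R * (f X.+2 / X.+2%:R).
    transitivity (\sum_(1 <= k < X.+1) ((ln k.+1%:R - ln k%:R) * (hsum f X.+1 - hsum f k)
        + (ln k.+1%:R - ln k%:R) * (f X.+2 / X.+2%:R))).
      by apply: eq_bigr => k _; ring.
    rewrite big_split /= -mulr_suml; congr (_ + _ * _).
    by rewrite (telescope_sumr (fun k => ln k%:R)) // ln1 subr0.
  by ring.
apply: le_trans (ler_norm_sum _ _ _) _.
apply: (@le_trans _ _ (\sum_(1 <= k < X) 4 * C * (k%:R * rt k)^-1)).
  rewrite !big_nat; apply: ler_sum => k hk.
  have k0 : (0 < k)%N by lia.
  rewrite normrM invfM mulrCA; apply: ler_pM => //.
    rewrite ger0_norm; first exact: lnS_sub.
    by rewrite subr_ge0 ln_nat_le.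
  by apply: hsum_cauchy; lia.
rewrite -mulr_sumr; case: X => [|[|X]]; try by rewrite big_geq // mulr0 mulr_ge0.
have := sum_inv_pow32 (isT : (0 < X.+1)%N).
have : 0 <= 2 / rt X.+1 by rewrite mulr_ge0 // invr_ge0.
nra.
Qed.

Variable c : nat -> nat -> R.
Hypotheses (fc : logder f c) (c2 : forall p j, prime p -> (0 < j)%N -> `|c p j| <= 2).

Lemma mangoldt_le d : `|mangoldt c d| <= 2 * Lam d.
Proof.
rewrite /vonMangoldt /mangoldt; case: ifP => [/ppowP[p [j [pr j0 ->]]]|_]; last by rewrite normr0 mulr0.
case: j j0 => // j _; rewrite pdiv_pfactor // pfactorK // normrM mul1r.
rewrite (ger0_norm (ln_nat_ge0 _)); apply: ler_wpM2r; [exact: ln_nat_ge0|exact: c2].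
Qed.

(** Mertens' argument for a Dirichlet series not vanishing at 1. The bounded
    sum of f n * ln n / n is the sum of mangoldt c d / d * hsum f (X %/ d).
    Replacing hsum f (X %/ d) by hsum f X costs O(1) in total, because the
    error sqrt (d / X) is summable against the von Mangoldt function; it
    remains to divide by hsum f X. *)
Lemma mertens_twisted (c0 : R) (X0 : nat) : 0 < c0 ->
  (forall X, (X0 <= X)%N -> c0 <= `|hsum f X|) ->
  exists K, forall X, `|\sum_(1 <= d < X.+1) mangoldt c d / d%:R| <= K.
Proof.
move=> c0p hX; have C0 := cancel_const_ge0.
pose M X := \sum_(1 <= d < X.+1) mangoldt c d / d%:R.
have triv X : `|M X| <= 2 * \sum_(1 <= d < X.+1) Lam d / d%:R.
  apply: le_trans (ler_norm_sum _ _ _) _; rewrite mulr_sumr; apply: ler_sum => d _.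
  by rewrite normrM normfV (ger0_norm (ler0n _ d)) mulrA ler_wpM2r ?invr_ge0 // mangoldt_le.
have big X : (0 < X)%N -> (X0 <= X)%N -> `|M X| <= 140 * C / c0.
  move=> Xp XX0; rewrite ler_pdivlMr // mulrC.
  apply: le_trans (ler_wpM2r (normr_ge0 _) (hX X XX0)) _.
  rewrite -normrM mulrC.
  have -> : M X * hsum f X = \sum_(1 <= n < X.+1) f n * ln n%:R / n%:R
      - \sum_(1 <= d < X.+1) mangoldt c d / d%:R * (hsum f (X %/ d) - hsum f X).
    rewrite (sum_logder _ fc) -sumrB /M mulr_suml; apply: eq_bigr => d _; rewrite /hsum; ring.
  apply: le_trans (ler_normB _ _) _.
  have e1 : `|\sum_(1 <= d < X.+1) mangoldt c d / d%:R * (hsum f (X %/ d) - hsum f X)| <= 128 * C.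
    apply: le_trans (ler_norm_sum _ _ _) _.
    apply: (@le_trans _ _ (\sum_(1 <= d < X.+1) (16 * C / rt X) * (Lam d / rt d))).
      rewrite !big_nat; apply: ler_sum => d hd.
      have d0 : (0 < d)%N by lia.
      have q0 : (0 < X %/ d)%N by rewrite divn_gt0 //; lia.
      rewrite normrM normrM normfV (ger0_norm (ler0n _ d)).
      have hd1 : `|hsum f (X %/ d) - hsum f X| <= 4 * C / rt (X %/ d).
        by rewrite distrC; apply: hsum_cauchy; rewrite q0 leq_div.
      have hq : (rt (X %/ d))^-1 <= 2 * rt d / rt X by apply: inv_rt_div; lia.
      apply: le_trans (ler_pM _ _ (ler_wpM2r _ (mangoldt_le d)) hd1) _ => //.
      apply: (@le_trans _ _ (2 * Lam d / d%:R * (4 * C * (2 * rt d / rt X)))).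
        rewrite ler_wpM2l ?mulr_ge0 ?Lam_ge0 ?invr_ge0 //.
        by rewrite ler_wpM2l // mulr_ge0.
      rewrite le_eqVlt; apply/orP; left; apply/eqP.
      move: (rt_sqr d) (rt_gt0 d0) (rt_gt0 Xp); move: (rt d) (rt X) => a b <- a0 b0.
      by field; rewrite !gt_eqF.
    rewrite -mulr_sumr; apply: le_trans (ler_wpM2l _ (sum_Lam_rt X)) _.
      by rewrite !mulr_ge0 ?invr_ge0.
    rewrite le_eqVlt; apply/orP; left; apply/eqP.
    by field; rewrite gt_eqF ?rt_gt0.
  by have := hsum_ln_bounded X; lra.
(* below X0 the bound for the von Mangoldt function itself is enough *)
exists (140 * C / c0 + 2 * (ln X0.+1%:R + 4)) => X.
have p1 : 0 <= 140 * C / c0 by rewrite !mulr_ge0 // invr_ge0 ltW.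
have p2 : 0 <= ln (X0.+1%:R : R) by apply: ln_nat_ge0.
case: (posnP X) => [->|X1]; first by rewrite big_geq // normr0; lra.
case: (leqP X0 X) => XX0; first by have := big X X1 XX0; rewrite /M; lra.
have := triv X; have /andP[_] := mertens X1; have : ln (X%:R : R) <= ln X0.+1%:R.
  by apply: ln_nat_le; lia.
by rewrite /M; lra.
Qed.

End Cancel.

End Sums.

(** * Primes in the classes of the cubic character *)

(** The partial sums of chi in a form that evaluates by computation. *)
Fixpoint csum (X : nat) : int := if X is X'.+1 then csum X' + chi X else 0.

Lemma csumE X : \sum_(1 <= n < X.+1) chi n = csum X.
Proof. by elim: X => [|X IH]; [rewrite big_geq|rewrite big_nat_recr //= IH]. Qed.

(** The partial sums have period 24. *)
Lemma chi_sum_bounds X : 0 <= \sum_(1 <= n < X.+1) chi n <= 4.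
Proof.
rewrite csumE.
have per Y : csum (Y + 24) = csum Y.
  elim: Y => [|Y IH]; first by vm_compute.
  by rewrite addSn /= IH -[chi (Y + 24).+1]chi_modn -[chi Y.+1]chi_modn -addSn modnDr.
have perq q r : csum (r + q * 24) = csum r.
  by elim: q => [|q IH]; rewrite ?addn0 // mulSnr addnA per.
rewrite (divn_eq X 24) addnC perq.
have /allP h : all (fun r => 0 <= csum r <= 4) (iota 0 24) by vm_compute.
by apply: h; rewrite mem_iota ltn_mod.
Qed.

Section Windows.
Variable R : realType.
Local Notation rt n := (Num.sqrt (n%:R : R)).
Local Notation chiR := (fun n => (chi n)%:~R : R).
Local Notation qR := (fun n => (qcoef n)%:~R : R).
Local Notation Lam := (vonMangoldt R).

Lemma chi_cancel X : `|\sum_(1 <= n < X.+1) chiR n| <= 4 * rt X.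
Proof.
case: X => [|X]; first by rewrite big_geq // normr0 mulr_ge0.
have /andP[h0 h4] := chi_sum_bounds X.+1.
rewrite -rmorph_sum /= ger0_norm ?ler0z //.
apply: (@le_trans _ _ 4); first by rewrite (_ : 4 = 4%:~R) ?ler_int.
by rewrite ler_peMr // -[leLHS]sqrtr1 ler_sqrt // ler1n.
Qed.

(** Abel summation: the partial sums of chi are nonnegative, so the first
    difference 1 - 1/2 is a lower bound. *)
Lemma chi_hsum_ge X : (0 < X)%N -> 1 / 2 <= hsum chiR X.
Proof.
move=> X0; pose U n := \sum_(1 <= m < n.+1) chiR m.
have U0 n : 0 <= U n.
  by have /andP[h0 _] := chi_sum_bounds n; rewrite /U -rmorph_sum ler0z.
suff : 1 / 2 + U X / X.+1%:R <= hsum chiR X.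
  by apply: le_trans; rewrite lerDl mulr_ge0.
elim: X X0 => // X IH _; case: X IH => [|X] IH.
  by rewrite /U /hsum !big_nat1 chi1 invr1; lra.
rewrite hsumS; apply: le_trans (lerD (IH isT) (lexx _)).
rewrite -addrA lerD2l -mulrDl.
have -> : U X.+1 + chiR X.+2 = U X.+2 by rewrite /U [in RHS]big_nat_recr.
by rewrite ler_wpM2l // lef_pV2 ?posrE ?ltr0n // ler_nat.
Qed.

Lemma qcoef_cancel X : `|\sum_(1 <= n < X.+1) qR n| <= 2 * rt X.
Proof.
have [s /andP[h1 h2]] := exists_sqrtn X.
have := @norm_sum_qcoef_le X s ltac:(lia).
rewrite -rmorph_sum /= -intr_norm -(ler_int R) => h; apply: le_trans h _.
rewrite -pmulrn natrM ler_pM2l // -[s%:R]ger0_norm // -sqrtr_sqr ler_sqrt //.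
by rewrite -natrX ler_nat; lia.
Qed.

Lemma norm_chi_le2 p j : prime p -> (0 < j)%N -> `|(chi (p ^ j))%:~R : R| <= 2.
Proof.
move=> _ _; rewrite /chi; case: ifP => _; first by rewrite normr1 ler1n.
by case: ifP => _; rewrite ?normrN ?normr1 ?normr0 ?ler1n.
Qed.

Lemma norm_psum_qcoef_le2 p j : prime p -> (0 < j)%N -> `|(psum (qcoef p) (chi p) j)%:~R : R| <= 2.
Proof.
move=> pr _; have /andP[h1 h2] := psum_bound j (qcoef_prime pr).
by rewrite -intr_norm (_ : 2 = 2%:~R :> R) // ler_int ler_norml; lia.
Qed.

(** This is ln u <= u at u = sqrt n. *)
Lemma ln_le_rt n : ln (n%:R : R) <= 2 * rt n.
Proof.
case: n => [|n]; first by rewrite ln0 // mulr_ge0.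
have h := rt_gt0 R (isT : (0 < n.+1)%N).
rewrite -(rt_sqr R n.+1) lnM ?posrE // rt_sqr.
by have := ln_sublinear h; lra.
Qed.

Lemma sum_if_le (s : seq nat) (P : pred nat) (e : nat) (c : R) : uniq s -> 0 <= c ->
  \sum_(d <- s | P d) (if e == d then c else 0) <= c.
Proof.
move=> us c0; rewrite big_mkcond /=; case: (boolP (e \in s)) => es.
  rewrite (bigD1_seq e) //= eqxx big1 ?addr0; first by case: ifP.
  by move=> d /negPf; rewrite eq_sym => ->; case: ifP.
rewrite big_seq big1 // => d ds; case: eqP => [e_d|_]; last by case: ifP.
by rewrite -e_d (negPf es) in ds.
Qed.

(** The powers p^j with j >= 2 contribute a convergent series, bounded by the
    sum of 2 ln p / p^2 with ln p <= 2 sqrt p. *)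
Lemma sum_ppow_nonprime X :
  \sum_(1 <= d < X.+1 | ppow d && ~~ prime d) Lam d / d%:R <= 24.
Proof.
apply: (@le_trans _ _ (\sum_(1 <= d < X.+1 | ppow d && ~~ prime d)
  \sum_(2 <= p < X.+1) \sum_(2 <= j < X.+1) (if (p ^ j == d)%N then ln p%:R / (p ^ j)%:R else 0))).
  rewrite big_nat_cond [leRHS]big_nat_cond; apply: ler_sum => d /andP[hd /andP[pd npd]].
  have [p [j [pr j0 dj]]] := ppowP pd.
  have p2 := prime_gt1 pr.
  have j2 : (1 < j)%N.
    by case: j j0 dj => [//|[|//]] _ dj; rewrite dj expn1 pr in npd.
  have pd' : (p <= d)%N by rewrite dj -{1}[p]expn1 leq_exp2l.
  have jd : (j < d)%N by rewrite dj ltn_expl.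
  rewrite (bigD1_seq p) ?iota_uniq ?mem_index_iota //=; last by lia.
  rewrite (bigD1_seq j) ?iota_uniq ?mem_index_iota //=; last by lia.
  rewrite -dj eqxx {1}dj /vonMangoldt mangoldt_pfactor // mul1r -addrA lerDl.
  have pos p' j' : 0 <= (if (p' ^ j' == d)%N then ln p'%:R / (p' ^ j')%:R else 0 : R).
    by case: ifP => // _; rewrite mulr_ge0 ?invr_ge0 ?ln_nat_ge0.
  by rewrite addr_ge0 // sumr_ge0 // => p' _; rewrite ?sumr_ge0.
rewrite exchange_big /=.
have geo (p J : nat) : (1 < p)%N -> \sum_(2 <= j < J) ((p ^ j)%:R : R)^-1 <= 2 / (p%:R * p%:R).
  move=> p2; have p2R : 2 <= p%:R :> R by rewrite ler_nat.
  case: (leqP J 2) => J2; first by rewrite big_geq // !mulr_ge0 // invr_ge0 mulr_ge0.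
  suff : \sum_(2 <= j < J) ((p ^ j)%:R : R)^-1 <= 2 / (p%:R * p%:R) - (p ^ J.-1)%:R^-1.
    by have : 0 <= ((p ^ J.-1)%:R : R)^-1; [rewrite invr_ge0|lra].
  elim: J J2 => // J IH; rewrite ltnS leq_eqVlt => /orP[/eqP <-|J2].
    by rewrite big_nat1 /= expnS expn1 natrM; lra.
  rewrite big_nat_recr /=; last by lia.
  apply: le_trans (lerD (IH J2) (lexx _)) _.
  have -> : (p ^ J = p * p ^ J.-1)%N by rewrite -expnS prednK //; lia.
  rewrite natrM !invfM.
  have h : 0 <= ((p ^ J.-1)%:R : R)^-1 by rewrite invr_ge0.
  have : p%:R^-1 <= 1 / 2 :> R.
    by rewrite -[p%:R^-1]mul1r ler_pdivrMr ?ltr0n; [lra|lia].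
  by move: (p%:R^-1) ((p ^ J.-1)%:R^-1) h => u v h hu; nra.
apply: (@le_trans _ _ (\sum_(2 <= p < X.+1) 4 * (p%:R * rt p)^-1)).
  rewrite !big_nat; apply: ler_sum => p hp.
  rewrite exchange_big /=.
  apply: (@le_trans _ _ (\sum_(2 <= j < X.+1) ln p%:R * (p ^ j)%:R^-1)).
    apply: ler_sum => j _; apply: sum_if_le; first exact: iota_uniq.
    by rewrite mulr_ge0 ?invr_ge0 ?ln_nat_ge0.
  rewrite -mulr_sumr.
  have p2 : (1 < p)%N by lia.
  apply: le_trans (ler_pM _ _ (ln_le_rt p) (geo p X.+1 p2)) _.
  - exact: ln_nat_ge0.
  - by apply: sumr_ge0 => j _; rewrite invr_ge0.
  move: (rt_sqr R p) (rt_gt0 R (ltnW p2)); move: (rt p) => a <- a0.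
  by rewrite le_eqVlt; apply/orP; left; apply/eqP; field; rewrite gt_eqF.
rewrite -mulr_sumr; case: (leqP X 1) => X1; first by rewrite big_geq // mulr0.
have := sum_inv_pow32 R (ltnW X1); rewrite big_ltn; last by lia.
rewrite mul1r sqrtr1 invr1.
have : 0 <= 2 / rt X by rewrite mulr_ge0 // invr_ge0.
by lra.
Qed.

Definition psum_primes (c : nat -> nat -> R) X := \sum_(1 <= p < X.+1 | prime p) c p 1%N * (ln p%:R / p%:R).

(** Mertens sums over prime powers and over primes differ by a bounded amount. *)
Lemma mangoldt_primes c X : (forall p j, prime p -> (0 < j)%N -> `|c p j| <= 2) ->
  `|\sum_(1 <= d < X.+1) mangoldt c d / d%:R - psum_primes c X| <= 48.
Proof.
move=> c2; have -> : \sum_(1 <= d < X.+1) mangoldt c d / d%:R - psum_primes c X =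
   \sum_(1 <= d < X.+1 | ppow d && ~~ prime d) mangoldt c d / d%:R.
  apply/eqP; rewrite subr_eq; apply/eqP.
  rewrite /psum_primes [X in _ = X + _]big_mkcond [X in _ = _ + X]big_mkcond -big_split /=.
  apply: eq_bigr => p _; case: (boolP (prime p)) => pr.
    by rewrite andbF add0r -{1}[p]expn1 mangoldt_pfactor // mulrA.
  by rewrite andbT addr0; case: ifP => // np; rewrite /mangoldt np mul0r.
apply: le_trans (ler_norm_sum _ _ _) _.
apply: (@le_trans _ _ (2 * \sum_(1 <= d < X.+1 | ppow d && ~~ prime d) Lam d / d%:R)).
  rewrite mulr_sumr; apply: ler_sum => d _.
  by rewrite normrM normfV (ger0_norm (ler0n _ d)) mulrA ler_wpM2r ?invr_ge0 // mangoldt_le.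
by have := sum_ppow_nonprime X; lra.
Qed.
Lemma mertens_prime : exists K : R, forall X, (0 < X)%N ->
  `|psum_primes (fun _ _ => 1) X - ln X%:R| <= K.
Proof.
exists 52 => X X0.
have := @mangoldt_primes (fun _ _ => 1) X ltac:(move=> *; rewrite normr1; lra).
have := mertens R X0; rewrite -/(vonMangoldt R) !ler_norml => /andP[a b] /andP[d e].
by apply/andP; split; rewrite /vonMangoldt in a b; lra.
Qed.

Lemma mertens_chi : exists K : R, forall X,
  `|psum_primes (fun p j => (chi (p ^ j))%:~R) X| <= K.
Proof.
have [K hK] := @mertens_twisted R chiR 4 chi_cancel _ (@logder_chi R) norm_chi_le2 (1/2) 1 ltac:(lra)
  (fun X X1 => le_trans (chi_hsum_ge X1) (ler_norm _)).
exists (K + 48) => X; have := mangoldt_primes X norm_chi_le2; have := hK X.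
rewrite !ler_norml => /andP[a b] /andP[d e]; apply/andP; split; lra.
Qed.

(** The weight 1 - chi p selects the inert primes, up to the primes 2 and 3. *)
Lemma chi_pair_window : exists K : R, forall y w, (0 < y <= w)%N ->
  (ln w%:R - ln y%:R) - K <= \sum_(y.+1 <= p < w.+1 | prime p) (1 - (chi p)%:~R) * (ln p%:R / p%:R).
Proof.
have [K1 h1] := mertens_prime; have [K2 h2] := mertens_chi.
exists (2 * K1 + 2 * K2) => y w /andP[y0 yw].
have e : \sum_(y.+1 <= p < w.+1 | prime p) (1 - (chi p)%:~R) * (ln p%:R / p%:R) =
   (psum_primes (fun _ _ => 1) w - psum_primes (fun p j => (chi (p ^ j))%:~R) w)
   - (psum_primes (fun _ _ => 1) y - psum_primes (fun p j => (chi (p ^ j))%:~R) y) :> R.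
  have d z : psum_primes (fun _ _ => 1) z - psum_primes (fun p j => (chi (p ^ j))%:~R) z =
      \sum_(1 <= p < z.+1 | prime p) (1 - (chi p)%:~R) * (ln p%:R / p%:R).
    by rewrite /psum_primes -sumrB; apply: eq_bigr => p _; rewrite mulrBl expn1.
  by rewrite !d [X in _ = X - _](big_cat_nat _ (n := y.+1)) //= addrAC subrr add0r.
have w0 : (0 < w)%N by lia.
have := h1 w w0; have := h1 y y0; have := h2 w; have := h2 y.
rewrite e !ler_norml => /andP[? ?] /andP[? ?] /andP[? ?] /andP[? ?]; lra.
Qed.

(** Dirichlet convolution. *)
Definition dconv (f g : nat -> R) n := \sum_(1 <= d < n.+1 | (d %| n)%N) f d * g (n %/ d)%N.

Lemma dconv_sym (phi : nat -> R) n : (0 < n)%N ->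
  \sum_(1 <= d < n.+1 | (d %| n)%N) phi d = \sum_(1 <= d < n.+1 | (d %| n)%N) phi (n %/ d)%N.
Proof.
move=> n0; rewrite -[LHS]big_filter -[RHS]big_filter -[RHS](big_map (fun d => n %/ d)%N xpredT phi).
have ud : uniq [seq d <- index_iota 1 n.+1 | (d %| n)%N] by rewrite filter_uniq ?iota_uniq.
have md d : (d \in [seq d <- index_iota 1 n.+1 | (d %| n)%N]) = (d %| n)%N.
  rewrite mem_filter mem_index_iota; case: (boolP (d %| n)%N) => // dn /=.
  by rewrite (dvdn_gt0 n0 dn) ltnS dvdn_leq.
have dd d : (d %| n)%N -> (n %/ (n %/ d) = d)%N by move=> dn; rewrite divnA // mulKn.
apply: perm_big; apply: uniq_perm => //.
  rewrite map_inj_in_uniq // => a b; rewrite !md => an bn e.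
  by rewrite -(dd a an) e dd.
move=> d; rewrite md; apply/idP/mapP => [dn|[b + ->]].
  by exists (n %/ d)%N; rewrite ?md ?dvdn_div ?dd.
by rewrite md; apply: dvdn_div.
Qed.

Lemma dconvC f g n : (0 < n)%N -> dconv f g n = dconv g f n.
Proof.
move=> n0; rewrite /dconv dconv_sym // big_mkcond [RHS]big_mkcond.
by apply: eq_bigr => d _; case: ifP => // dn; rewrite mulrC divnA // mulKn.
Qed.

Lemma logder_dconvl f g c p n : logder f c -> prime p -> (0 < n)%N ->
  \sum_(1 <= d < n.+1 | (d %| n)%N) (logn p d)%:R * f d * g (n %/ d)%N =
  \sum_(1 <= j < (logn p n).+1) c p j * dconv f g (n %/ p ^ j)%N.
Proof.
move=> lf pr n0.
transitivity (\sum_(1 <= d < n.+1 | (d %| n)%N) \sum_(1 <= j < (logn p n).+1 | (p ^ j %| d)%N)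
    c p j * f (d %/ p ^ j)%N * g (n %/ d)%N).
  rewrite big_nat_cond [RHS]big_nat_cond; apply: eq_bigr => d /andP[hd dn].
  have d0 : (0 < d)%N by lia.
  rewrite -mulr_suml; congr (_ * _); rewrite lf //.
  have ll : (logn p d <= logn p n)%N by apply: dvdn_leq_log.
  rewrite [RHS](big_cat_nat _ (n := (logn p d).+1)) //=.
  rewrite [X in _ = _ + X]big_nat_cond [X in _ = _ + X]big1 ?addr0 => [|j].
    rewrite big_nat [RHS]big_nat_cond; apply: eq_big => // j.
    by case: (boolP (_ <= _ < _)%N) => // hj; rewrite pfactor_dvdn //; lia.
  by move=> /andP[hj]; rewrite pfactor_dvdn //; lia.
rewrite (exchange_big_dep xpredT) //= !big_nat; apply: eq_bigr => j hj.
have pj : (p ^ j %| n)%N by rewrite pfactor_dvdn //; lia.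
have pj0 : (0 < p ^ j)%N by rewrite expn_gt0 prime_gt0.
rewrite big_mkcondl /= sum_dvdn_mul // /dconv mulr_sumr [RHS]big_mkcond /=.
apply: eq_bigr => m _; rewrite mulKn // mulnC -dvdn_divRL // mulnC divnMA.
by case: ifP => // _; rewrite mulrA.
Qed.

(** The logarithmic derivative of a product is the sum of the logarithmic
    derivatives. *)
Lemma logder_dconv f g c c' : logder f c -> logder g c' ->
  logder (dconv f g) (fun p j => c p j + c' p j).
Proof.
move=> lf lg p n pr n0; under eq_bigr do rewrite mulrDl.
rewrite big_split /= -(logder_dconvl g lf pr n0).
have -> : \sum_(1 <= j < (logn p n).+1) c' p j * dconv f g (n %/ p ^ j)%N =
   \sum_(1 <= j < (logn p n).+1) c' p j * dconv g f (n %/ p ^ j)%N.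
  rewrite !big_nat; apply: eq_bigr => j hj; congr (_ * _); apply: dconvC.
  by rewrite divn_gt0 ?expn_gt0 ?prime_gt0 // dvdn_leq // pfactor_dvdn //; lia.
rewrite -(logder_dconvl f lg pr n0) [X in _ = _ + X]dconv_sym // -big_split /= /dconv mulr_sumr.
rewrite [LHS]big_nat_cond [RHS]big_nat_cond; apply: eq_bigr => d /andP[hd dn].
have -> : (n %/ (n %/ d) = d)%N by rewrite divnA // mulKn.
have -> : logn p n = (logn p d + logn p (n %/ d))%N.
  have d0 : (0 < d)%N by lia.
  have q0 : (0 < n %/ d)%N by rewrite divn_gt0 // dvdn_leq.
  by rewrite -lognM // mulnC divnK.
by rewrite natrD; ring.
Qed.

(** If the logarithmic derivative has nonnegative coefficients then so has the
    series, by induction on n in f * ln = mangoldt * f. *)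
Lemma logder_ge0 (f : nat -> R) c : logder f c -> (forall p j, prime p -> (0 < j)%N -> 0 <= c p j) ->
  f 1%N = 1 -> forall n, (0 < n)%N -> 0 <= f n.
Proof.
move=> lf c0 f1; elim/ltn_ind => n IH n0.
case: (ltnP 1 n) => n1; last by rewrite (_ : n = 1%N) ?f1 //; lia.
have ln0 : 0 < ln (n%:R : R) by rewrite ln_gt0 // ltr1n.
rewrite -(pmulr_lge0 _ ln0) (logder_mangoldt lf) //.
rewrite big_nat_cond; apply: sumr_ge0 => d /andP[hd dn].
have d0 : (0 < d)%N by lia.
have q0 : (0 < n %/ d)%N by rewrite divn_gt0 // dvdn_leq.
rewrite /mangoldt; case: ifP => [/ppowP[p [j [pr j0 dj]]]|_]; last by rewrite mul0r.
have d1 : (1 < d)%N by rewrite dj; apply: leq_trans (prime_gt1 pr) _; rewrite -{1}[p]expn1 leq_exp2l // prime_gt1.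
apply: mulr_ge0; last by apply: IH => //; rewrite ltn_Pdiv.
rewrite dj; case: j j0 {dj} => // j _; rewrite pdiv_pfactor // pfactorK //.
by rewrite mulr_ge0 ?ln_nat_ge0 // c0.
Qed.

(** The convolution of 1 and qcoef, whose Dirichlet series is the zeta
    function of a cubic field. *)
Definition cubic_coef : nat -> R := dconv (fun=> 1) qR.

(** The power sums attached to qcoef are at least -1, and the factor 1 adds 1
    to them. *)
Lemma cubic_coef_ge0 n : (0 < n)%N -> 0 <= cubic_coef n.
Proof.
apply: (logder_ge0 (logder_dconv (@logder1 R) (@logder_qcoefR R))) => [p j pr j0|].
  have /andP[h _] := psum_bound j (qcoef_prime pr).
  by rewrite -(ler_int R) in h; rewrite mulrN1z in h; lra.
by rewrite /dconv big_mkcond big_nat1 /= divn1 qcoef1 mulr1.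
Qed.

Lemma cubic_coef_inert q : prime q -> (3 < q)%N -> chi q = -1 -> cubic_coef q = 1.
Proof.
move=> pr q3 ch; have := qcoef_prime pr; rewrite ch !inE /= => h.
have q0 : qcoef q = 0 by move: h; rewrite !xpair_eqE /= !andbF !orbF /= andbT => /eqP.
rewrite /cubic_coef /dconv big_mkcond big_nat_recr /=; last by lia.
rewrite dvdnn divnn (ltnW (ltnW (ltnW q3))) qcoef1 mulr1 big_ltn; last by lia.
rewrite dvd1n divn1 q0 mulr0 add0r big_nat big1 ?add0r // => d hd.
case: ifP => // dq; exfalso; move: dq => /(prime_nt_dvdP pr (_ : d != 1%N)); lia.
Qed.

Lemma sum_cubic X :
  \sum_(1 <= n < X.+1) cubic_coef n / n%:R = \sum_(1 <= d < X.+1) d%:R^-1 * hsum qR (X %/ d).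
Proof.
under [RHS]eq_bigr do rewrite mulr_sumr.
rewrite -(sum_dirichlet (fun d m => d%:R^-1 * (qR m / m%:R))).
rewrite !big_nat; apply: eq_bigr => n hn; rewrite /cubic_coef /dconv mulr_suml.
rewrite [LHS]big_nat_cond [RHS]big_nat_cond; apply: eq_bigr => d /andP[hd dn].
by rewrite mul1r mulrCA -invfM -natrM mulnC divnK.
Qed.

(** If hsum of qcoef at Y were O(1 / sqrt Y), then the sum of the cubic
    coefficients over n would be O(1), as the sum of 1 / d * sqrt (d / X) is
    bounded. *)
Lemma sum_cubic_bounded (B : R) X : (forall Y, (0 < Y)%N -> `|hsum qR Y| <= B / rt Y) ->
  \sum_(1 <= n < X.+1) cubic_coef n / n%:R <= 4 * B.
Proof.
move=> hB; have B0 : 0 <= B.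
  by have := hB 1%N isT; rewrite sqrtr1 divr1; apply: le_trans.
rewrite sum_cubic.
apply: (@le_trans _ _ (\sum_(1 <= d < X.+1) (2 * B / rt X) * (rt d)^-1)).
  rewrite !big_nat; apply: ler_sum => d hd.
  have d0 : (0 < d)%N by lia.
  have q0 : (0 < X %/ d)%N by rewrite divn_gt0 //; lia.
  apply: (@le_trans _ _ (d%:R^-1 * (B * (2 * rt d / rt X)))).
    apply: ler_wpM2l; first by rewrite invr_ge0.
    apply: le_trans (ler_norm _) _; apply: le_trans (hB _ q0) _.
    by apply: ler_wpM2l => //; apply: inv_rt_div; lia.
  have X0 : (0 < X)%N by lia.
  move: (rt_sqr R d) (rt_gt0 R d0) (rt_gt0 R X0); move: (rt d) (rt X) => a b <- a0 b0.
  by rewrite le_eqVlt; apply/orP; left; apply/eqP; field; rewrite !gt_eqF.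
rewrite -mulr_sumr; case: X => [|X]; first by rewrite big_geq // mulr0 mulr_ge0.
apply: le_trans (ler_wpM2l _ (sum_inv_rt _ _)) _.
  by rewrite mulr_ge0 ?invr_ge0 // mulr_ge0.
rewrite le_eqVlt; apply/orP; left; apply/eqP.
by field; rewrite gt_eqF ?rt_gt0.
Qed.

(** A window from z to z^2 carries at least a constant mass of reciprocals of
    inert primes. *)
Lemma inert_window : exists z0 : nat, (3 < z0)%N /\ forall z, (z0 <= z)%N ->
  1 / 8 <= \sum_(z.+1 <= q < (z * z).+1 | prime q && (chi q == -1)) (q%:R : R)^-1.
Proof.
have [K hK] := chi_pair_window.
have [z0 hz0] := exists_ln_ge (2 * K).
exists (z0 + 4)%N; split=> [|z hz]; first by lia.
have z0' : (0 < z)%N by lia.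
have := hK z (z * z)%N ltac:(nia); rewrite natrM lnM ?posrE ?ltr0n //.
set L := ln z%:R => h.
have L0 : 0 < L by rewrite ln_gt0 // ltr1n; lia.
have hL := hz0 z ltac:(lia).
rewrite -(ler_pM2l (_ : 0 < 4 * L)); last by rewrite mulr_gt0.
apply: le_trans (_ : L - K <= _); first by rewrite -/L in hL; lra.
rewrite addrK in h; apply: le_trans h _; rewrite mulr_sumr.
rewrite [leRHS]big_mkcondr [leLHS]big_nat_cond [leRHS]big_nat_cond.
apply: ler_sum => q /andP[hq pr].
have q3 : (3 < q)%N by lia.
have q0 : 0 <= (q%:R : R)^-1 by rewrite invr_ge0.
have /orP[/eqP -> | /eqP ->] := chi_prime pr q3; first by rewrite subrr mul0r.
rewrite eqxx mulrN1z opprK mulrA ler_wpM2r //.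
have : ln (q%:R : R) <= 2 * L.
  have -> : 2 * L = ln (z * z)%:R by rewrite natrM lnM ?posrE ?ltr0n // /L; ring.
  by apply: ln_nat_le; lia.
have := ln_nat_ge0 R q; lra.
Qed.

Lemma inert_diverge (B : R) : exists X, B < \sum_(1 <= q < X.+1 | prime q && (chi q == -1) && (3 < q)%N) (q%:R : R)^-1.
Proof.
have [z0 [z03 hz]] := inert_window.
suff h k : exists X, (z0 <= X)%N /\
   k%:R / 8 <= \sum_(1 <= q < X.+1 | prime q && (chi q == -1) && (3 < q)%N) (q%:R : R)^-1.
  have [X [_ hX]] := h (Num.truncn (8 * B)).+1.
  exists X; apply: lt_le_trans hX; have := truncnS_gt (8 * B); lra.
elim: k => [|k [X [zX hX]]].
  by exists z0; split=> //; rewrite mul0r sumr_ge0 // => q _; rewrite invr_ge0.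
exists (X * X)%N; split; first by nia.
rewrite (big_cat_nat _ (n := X.+1)) //=; last by nia.
have -> : \sum_(X.+1 <= q < (X * X).+1 | prime q && (chi q == -1) && (3 < q)%N) (q%:R : R)^-1
   = \sum_(X.+1 <= q < (X * X).+1 | prime q && (chi q == -1)) (q%:R : R)^-1.
  rewrite big_nat_cond [RHS]big_nat_cond; apply: eq_bigl => q.
  by case: (boolP (X < q < (X * X).+1)%N) => //= hq; rewrite (_ : (3 < q)%N) ?andbT //; lia.
have e : k.+1%:R = k%:R + 1 :> R by rewrite natr1.
by have := hz X zX; rewrite e; lra.
Qed.

(** Nonvanishing at 1 of the Dirichlet series of qcoef. If |hsum Y| <= 8 /
    sqrt Y held for all Y, the cubic coefficients would have a bounded
    harmonic sum, contradicting the divergence of the sum of the reciprocals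
    of the inert primes. At a Y where it fails, [hsum_cauchy] keeps all later
    sums away from 0. *)
Lemma qcoef_hsum_lower : exists c0 : R, exists X0 : nat, 0 < c0 /\
  forall X, (X0 <= X)%N -> c0 <= `|hsum qR X|.
Proof.
case: (pselect (forall Y, (0 < Y)%N -> `|hsum qR Y| <= 8 / rt Y)) => [h|].
  exfalso; have [X hX] := inert_diverge (4 * 8).
  have := sum_cubic_bounded X h; rewrite leNgt => /negP; apply.
  apply: lt_le_trans hX _; rewrite big_mkcond /= !big_nat; apply: ler_sum => q hq.
  case: ifP => [/andP[/andP[pr /eqP ch] q3]|_].
    by rewrite cubic_coef_inert // mul1r.
  by rewrite mulr_ge0 ?invr_ge0 // cubic_coef_ge0 //; lia.
move=> /existsNP[Y] /not_implyP[Y0] /negP; rewrite -ltNge => hY.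
exists (`|hsum qR Y| - 8 / rt Y), Y; split; first by rewrite subr_gt0.
move=> X YX; have := hsum_cauchy qcoef_cancel (_ : 0 < Y <= X)%N; rewrite Y0 YX => /(_ isT) h.
have := ler_normB (hsum qR X) (hsum qR X - hsum qR Y).
rewrite opprB addrC subrK => h2.
have : 4 * 2 / rt Y = 8 / rt Y by rewrite -natrM.
lra.
Qed.

Lemma mertens_qcoef : exists K : R, forall X,
  `|psum_primes (fun p j => (psum (qcoef p) (chi p) j)%:~R) X| <= K.
Proof.
have [c0 [X0 [c0p hX]]] := qcoef_hsum_lower.
have [K hK] := mertens_twisted qcoef_cancel (@logder_qcoefR R) norm_psum_qcoef_le2 c0p hX.
exists (K + 48) => X; have := mangoldt_primes X norm_psum_qcoef_le2; have := hK X.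
rewrite !ler_norml => /andP[a b] /andP[d e]; apply/andP; split; lra.
Qed.

(** Counting conjugacy classes by characters: 1 + chi - qcoef is 3 at the
    elements of order three of the symmetric group on three letters and 0 at
    the others. *)
Lemma one_chi_qcoefE p : prime p -> (3 < p)%N ->
  1 + chi p - qcoef p = if qcoef p == -1 then 3 else 0.
Proof.
move=> pr p3; have := qcoef_prime pr; have := chi_prime pr p3.
by rewrite !inE => /orP[/eqP -> | /eqP ->] /orP[|/orP[|/orP[|/orP[|]]]] /eqP[->].
Qed.

(** A third of the primes, in logarithmic measure on long windows, have qcoef
    p = -1. *)
Lemma cubic_nonsplit_window : exists K : R, forall y w, (3 <= y <= w)%N ->
  (ln w%:R - ln y%:R) / 3 - K <= \sum_(y.+1 <= p < w.+1 | prime p && (qcoef p == -1)) ln p%:R / p%:R.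
Proof.
have [K1 h1] := mertens_prime; have [K2 h2] := mertens_chi; have [K3 h3] := mertens_qcoef.
exists (K1 + K2 + K3) => y w /andP[y3 yw].
pose S z := psum_primes (fun _ _ => 1) z + psum_primes (fun p j => (chi (p ^ j))%:~R) z
   - psum_primes (fun p j => (psum (qcoef p) (chi p) j)%:~R) z.
have e : S w - S y = 3 * \sum_(y.+1 <= p < w.+1 | prime p && (qcoef p == -1)) ln p%:R / p%:R.
  have d z : S z = \sum_(1 <= p < z.+1 | prime p) (1 + (chi p)%:~R - (qcoef p)%:~R) * (ln p%:R / p%:R).
    by rewrite /S /psum_primes -big_split -sumrB; apply: eq_bigr => p _; rewrite mulrBl mulrDl expn1.
  rewrite !d [X in X - _ = _](big_cat_nat _ (n := y.+1)) //= addrAC subrr add0r.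
  rewrite mulr_sumr [RHS]big_mkcondr [LHS]big_nat_cond [RHS]big_nat_cond.
  apply: eq_bigr => p /andP[hp pr].
  have p3 : (3 < p)%N by lia.
  have := one_chi_qcoefE pr p3; case: ifP => _ h.
    by rewrite -[3]/(3%:~R) -h rmorphB rmorphD.
  have -> : 1 + (chi p)%:~R - (qcoef p)%:~R = 0 :> R; last by rewrite mul0r.
  by have := congr1 (intmul (1 : R)) h; rewrite rmorphB rmorphD.
have w0 : (0 < w)%N by lia. have y0 : (0 < y)%N by lia.
have := h1 w w0; have := h1 y y0; have := h2 w; have := h2 y; have := h3 w; have := h3 y.
move: e; rewrite /S !ler_norml => e /andP[? ?] /andP[? ?] /andP[? ?] /andP[? ?] /andP[? ?] /andP[? ?].
lra.
Qed.

End Windows.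

(** * The lower bound *)

(** The factor 2310 = 2 * 3 * 5 * 7 * 11 keeps 5, 7 and 11 free for moving
    residue classes modulo 24. *)
Definition good (m : nat) : bool := odd (absz (qcoef m)) && coprime m 2310.

Lemma odd_qcoefM (p m : nat) : prime p -> ~~ (p %| m)%N ->
  odd (absz (qcoef (p * m))) = odd (absz (qcoef p)) && odd (absz (qcoef m)).
Proof.
by move=> pr /negPf pm; rewrite qcoef_Hecke // /odiv pm mulr0 subr0 abszM oddM.
Qed.

Lemma good1 : good 1. Proof. by rewrite /good qcoef1 coprime1n. Qed.

Lemma good_mul m p : prime p -> (11 < p)%N -> qcoef p = -1 -> ~~ (p %| m)%N ->
  good m -> good (m * p).
Proof.
move=> pr p11 q1 pm /andP[om cm]; rewrite /good mulnC odd_qcoefM // q1 om coprimeMl cm andbT /=.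
rewrite prime_coprime // andbT; apply/negP => h.
have : p \in primes 2310 by rewrite mem_primes pr.
by rewrite (_ : primes 2310 = [:: 2; 3; 5; 7; 11]%N) // !inE; lia.
Qed.

Lemma leq_double_divn X m : (0 < m)%N -> (m <= X)%N -> (X <= 2 * (X %/ m) * m)%N.
Proof.
move=> m0 mX; rewrite -mulnA mul2n -addnn {1}(divn_eq X m) leq_add2l.
by rewrite (leq_trans (ltnW (ltn_pmod X m0))) // leq_pmull // divn_gt0.
Qed.

Section Lower.
Variable R : realType.

(** The primes that are inert in the cubic field. *)
Definition nsprime p := prime p && (qcoef p == -1).

Lemma sum_sub_le (s t : seq nat) (g : nat -> R) : uniq s -> uniq t ->
  {subset s <= t} -> (forall n, 0 <= g n) -> \sum_(n <- s) g n <= \sum_(n <- t) g n.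
Proof.
move=> us ut st g0; rewrite [leRHS](bigID (mem s)) /= -[leLHS]addr0 lerD ?sumr_ge0 //.
rewrite le_eqVlt; apply/orP; left; apply/eqP; rewrite -[RHS]big_filter; apply: perm_big.
apply: uniq_perm; rewrite ?filter_uniq // => n; rewrite mem_filter.
by case: (boolP (n \in s)) => //= /st ->.
Qed.

(** A product m p with m <= z < p determines both factors, so distinct pairs
    give distinct integers. *)
Lemma good_products (g : nat -> R) (Y : nat -> nat) (z X : nat) :
  (11 <= z)%N -> (forall n, 0 <= g n) -> (forall m, 0 < m <= z -> m * Y m <= X)%N ->
  \sum_(1 <= m < z.+1 | good m) \sum_(z.+1 <= p < (Y m).+1 | nsprime p) g (m * p)%N
  <= \sum_(z.+1 <= N < X.+1 | good N) g N.
Proof.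
move=> z11 g0 hY.
rewrite -[leRHS]big_filter -[leLHS]big_filter.
have -> : \sum_(m <- [seq m <- index_iota 1 z.+1 | good m])
    \sum_(z.+1 <= p < (Y m).+1 | nsprime p) g (m * p)%N =
  \sum_(N <- [seq (m * p)%N | m <- [seq m <- index_iota 1 z.+1 | good m],
     p <- [seq p <- index_iota z.+1 (Y m).+1 | nsprime p]]) g N.
  by rewrite big_allpairs_dep /=; apply: eq_bigr => m _; rewrite big_filter.
apply: sum_sub_le => //.
- apply: allpairs_uniq_dep; first by rewrite filter_uniq ?iota_uniq.
    by move=> m _; rewrite filter_uniq ?iota_uniq.
  move=> [m p] [m' p'] /allpairsPdep[a [b [+ + [-> ->]]]] /allpairsPdep[a' [b' [+ + [-> ->]]]] /=.
  rewrite !mem_filter !mem_index_iota => /andP[_ ha] /andP[/andP[prb _] hb].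
  move=> /andP[_ ha'] /andP[/andP[prb' _] hb'] e.
  have bb : b = b'.
    have : (b %| a' * b')%N by rewrite -e dvdn_mull.
    rewrite Euclid_dvdM // => /orP[/dvdn_leq|]; first by lia.
    by rewrite dvdn_prime2 // => /eqP.
  move: e; rewrite bb => /eqP; rewrite eqn_pmul2r; last by lia.
  by move=> /eqP ->.
- by rewrite filter_uniq ?iota_uniq.
move=> N /allpairsPdep[m [p [+ + ->]]]; rewrite !mem_filter !mem_index_iota.
move=> /andP[gm hm] /andP[/andP[pr /eqP q1] hp]; apply/andP; split.
  apply: good_mul => //; first by lia.
  by apply/negP => /dvdn_leq; lia.
have := hY m ltac:(lia); nia.
Qed.

Definition gsum (z : nat) : R := \sum_(1 <= m < z.+1 | good m) (m%:R)^-1.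

Lemma gsum_le y z : (y <= z)%N -> gsum y <= gsum z.
Proof.
move=> yz; rewrite /gsum [leRHS](big_cat_nat _ (n := y.+1)) //= lerDl sumr_ge0 //.
Qed.

Lemma gsum_ge1 z : (0 < z)%N -> 1 <= gsum z.
Proof.
move=> z0; apply: le_trans (gsum_le z0).
by rewrite /gsum big_mkcond big_nat1 good1 invr1.
Qed.

(** The primes with qcoef p = -1 between z and z^2 have a sum of reciprocals
    of about (1/3) (ln z) / (2 ln z), hence at least 1/10, and the products of
    those with the integers up to z are at most z^3. *)
Lemma gsum_cube : exists z1 : nat, (11 <= z1)%N /\
  forall z, (z1 <= z)%N -> 11 / 10 * gsum z <= gsum (z ^ 3).
Proof.
have [K hK] := cubic_nonsplit_window R.
have [z0 hz0] := exists_ln_ge (15 / 2 * K).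
exists (z0 + 11)%N; split=> [|z hz]; first by lia.
have L0 : 0 < ln (z%:R : R) by rewrite ln_gt0 // ltr1n; lia.
have hP : 1 / 10 <= \sum_(z.+1 <= p < (z * z).+1 | nsprime p) (p%:R : R)^-1.
  have := hK z (z * z)%N ltac:(nia); rewrite natrM lnM ?posrE ?ltr0n //; try lia.
  have := hz0 z ltac:(lia); move: L0; set L := ln z%:R => L0 hL h.
  rewrite -(ler_pM2l (_ : 0 < 2 * L)); last by rewrite mulr_gt0.
  apply: le_trans (_ : (L + L - L) / 3 - K <= _); first by lra.
  apply: le_trans h _; rewrite mulr_sumr [leLHS]big_nat_cond [leRHS]big_nat_cond.
  apply: ler_sum => p /andP[hp _]; rewrite ler_wpM2r ?invr_ge0 //.
  have -> : 2 * L = ln (z * z)%:R by rewrite natrM lnM ?posrE ?ltr0n ?/L; [ring|lia|lia].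
  by apply: ln_nat_le; lia.
have := @good_products (fun n => (n%:R)^-1) (fun _ => z * z)%N z (z ^ 3) ltac:(lia).
move=> /(_ (fun n => ltac:(by rewrite invr_ge0))) => H.
have {}H := H ltac:(move=> m hm; rewrite (_ : z ^ 3 = z * (z * z))%N ?leq_mul2r; [lia|by rewrite !expnS expn0; lia]).
rewrite [leRHS]/gsum (big_cat_nat _ (n := z.+1)) //=; last by rewrite !expnS expn0; nia.
rewrite -/(gsum z); apply: le_trans (lerD (lexx _) H).
have -> : \sum_(1 <= m < z.+1 | good m) \sum_(z.+1 <= p < (z * z).+1 | nsprime p) ((m * p)%:R : R)^-1
   = gsum z * \sum_(z.+1 <= p < (z * z).+1 | nsprime p) (p%:R : R)^-1.
  rewrite /gsum mulr_suml; apply: eq_bigr => m _; rewrite mulr_sumr.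
  by apply: eq_bigr => p _; rewrite natrM invfM.
have g1 : 1 <= gsum z by apply: gsum_ge1; lia.
nra.
Qed.

Lemma pow3_root : (3 : R) `^ (12%:R^-1) <= 11 / 10.
Proof.
have -> : 11 / 10 = ((11 / 10) ^+ 12) `^ (12%:R^-1) :> R.
  by rewrite -powR_mulrn -?powRrM ?mulfV ?powRr1 //; lra.
apply: ge0_ler_powR; rewrite ?nnegrE ?invr_ge0 //.
rewrite (_ : 12 = 3 * 2 * 2)%N // !exprM.
have h3 : 133 / 100 <= (11 / 10) ^+ 3 :> R by rewrite !exprS expr0; lra.
have h6 : 176 / 100 <= ((11 / 10) ^+ 3) ^+ 2 :> R by rewrite expr2; nra.
by rewrite expr2; nra.
Qed.

(** Iterating [gsum_cube] k times multiplies ln z by 3^k and the sum by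
    (11/10)^k, and [pow3_root] compares the two. *)
Lemma gsum_lower : exists c : R, exists z1 : nat, 0 < c /\
  forall z, (z1 <= z)%N -> c * (ln z%:R) `^ (12%:R^-1) <= gsum z.
Proof.
have [z1 [z11 hz]] := gsum_cube.
have L0 : 0 < ln (z1%:R : R) by rewrite ln_gt0 // ltr1n; lia.
pose D := (ln (z1%:R : R)) `^ (12%:R^-1).
have D0 : 0 < D by rewrite powR_gt0.
have hk k : (11 / 10) ^+ k <= gsum (z1 ^ (3 ^ k)).
  elim: k => [|k IH]; first by rewrite expr0 gsum_ge1 // expn_gt0; lia.
  rewrite expnSr expnM exprS; apply: le_trans (_ : 11 / 10 * gsum (z1 ^ 3 ^ k) <= _).
    by rewrite ler_pM2l //; lra.
  apply: hz; rewrite -{1}[z1]expn1 leq_exp2l ?expn_gt0 //; lia.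
exists ((11 / 10 * D)^-1), z1; split=> [|z z1z]; first by rewrite invr_gt0 mulr_gt0 //; lra.
have [k /andP[k1 k2]] : exists k, (z1 ^ (3 ^ k) <= z < z1 ^ (3 ^ k.+1))%N.
  have ex : exists k, (z < z1 ^ (3 ^ k))%N.
    exists z; apply: (@leq_trans (2 ^ (3 ^ z))); last by rewrite leq_exp2r ?expn_gt0 //; lia.
    by apply: leq_trans (ltn_expl z (isT : 1 < 3)%N) _; apply/ltnW/ltn_expl.
  case: (ex_minnP ex) => -[|k] hk1 hmin; first by move: hk1; rewrite expn0 expn1; lia.
  by exists k; rewrite hk1 andbT leqNgt; apply/negP => /hmin; lia.
apply: le_trans (le_trans (hk k) (gsum_le k1)).
rewrite ler_pdivrMl; last by rewrite mulr_gt0 //; lra.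
have -> : 11 / 10 * D * (11 / 10) ^+ k = (11 / 10) ^+ k.+1 * D :> R by rewrite exprS; ring.
apply: le_trans (_ : ((3 : R) ^+ k.+1 * ln z1%:R) `^ (12%:R^-1) <= _).
  apply: ge0_ler_powR; rewrite ?nnegrE ?invr_ge0 ?ln_nat_ge0 //.
    by rewrite mulr_ge0 ?exprn_ge0 ?ln_nat_ge0.
  have -> : (3 : R) ^+ k.+1 * ln z1%:R = ln (z1 ^ (3 ^ k.+1))%:R.
    by rewrite natrX lnXn ?ltr0n; [rewrite -[RHS]mulr_natl natrX|lia].
  by apply: ln_nat_le; lia.
rewrite powRM ?exprn_ge0 ?ln_nat_ge0 // -/D; apply: ler_wpM2r; first exact: ltW.
rewrite -powR_mulrn // -powRrM mulrC powRrM powR_mulrn ?powR_ge0 //.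
by apply: lerXn2r; rewrite ?nnegrE ?powR_ge0 ?pow3_root //; lra.
Qed.

(** For K0 large the window from w / K0 to w contains primes of total weight
    ln p / p at least 1, and each has weight at most about K0 ln X / w. *)
Lemma nsprime_count : exists K0 : nat, exists w0 : nat, (0 < K0)%N /\
  forall w X, (w0 <= w <= X)%N ->
  w%:R / (2 * K0%:R * ln X%:R) <=
     (\sum_((w %/ K0).+1 <= p < w.+1 | nsprime p) 1%N)%:R :> R.
Proof.
have [K hK] := cubic_nonsplit_window R.
have [K0 hK0] := exists_ln_ge (3 * K + 3).
exists K0.+1, (3 * K0.+1)%N; split => // w X /andP[w0 wX].
set y := (w %/ K0.+1)%N.
have y3 : (3 <= y)%N by rewrite /y leq_divRL.
have yw : (y <= w)%N by rewrite leq_div.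
have := hK y w; rewrite y3 yw => /(_ isT) h.
have l1 : 3 * K + 3 <= ln (w%:R : R) - ln y%:R.
  apply: le_trans (hK0 K0.+1 (leqnSn _)) _.
  have hh : (K0.+1 * y <= w)%N by rewrite mulnC leq_trunc_div.
  have y0 : 0 < y%:R :> R by rewrite ltr0n (leq_trans _ y3).
  have w0' : 0 < w%:R :> R by rewrite ltr0n (leq_trans _ yw) ?(leq_trans _ y3).
  rewrite -ln_div ?posrE // ler_ln ?posrE ?divr_gt0 //.
  by rewrite ler_pdivlMr // -natrM ler_nat.
have L0 : 0 < ln (X%:R : R) by rewrite ln_gt0 // ltr1n; lia.
have y0 : 0 < y%:R :> R by rewrite ltr0n; lia.
have h2 : 1 <= \sum_(y.+1 <= p < w.+1 | nsprime p) ln X%:R / y%:R :> R.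
  apply: le_trans (_ : _ <= \sum_(y.+1 <= p < w.+1 | nsprime p) ln p%:R / p%:R) _.
    by apply: le_trans h; lra.
  rewrite big_nat_cond [leRHS]big_nat_cond; apply: ler_sum => p /andP[hp _].
  apply: ler_pM; rewrite ?ln_nat_ge0 ?invr_ge0 //; first by apply: ln_nat_le; lia.
  by rewrite lef_pV2 ?posrE ?ltr0n ?ler_nat; lia.
have e : \sum_(y.+1 <= p < w.+1 | nsprime p) ln X%:R / y%:R =
   (\sum_(y.+1 <= p < w.+1 | nsprime p) 1%N)%:R * (ln X%:R / y%:R) :> R.
  by rewrite natr_sum mulr_suml; apply: eq_bigr => p _; rewrite mul1r.
move: h2; rewrite e mulrA ler_pdivlMr // mul1r => h2.
rewrite ler_pdivrMr; last by rewrite !mulr_gt0 ?ltr0n.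
have wy : w%:R <= 2 * K0.+1%:R * y%:R :> R.
  by rewrite -!natrM ler_nat mulnAC leq_double_divn //; apply: leq_trans w0; rewrite leq_pmull.
apply: le_trans wy _; rewrite mulrCA; apply: ler_wpM2l; last by [].
by rewrite mulr_ge0.
Qed.

Lemma exists_root4 (X : nat) : exists z, (z ^ 4 <= X < z.+1 ^ 4)%N.
Proof.
elim: X => [|X [z /andP[h1 h2]]]; first by exists 0%N.
case: (ltnP X.+1 (z.+1 ^ 4)) => h; first by exists z; lia.
have e : (X.+1 = z.+1 ^ 4)%N by lia.
by exists z.+1; rewrite e leqnn /= ltn_exp2r.
Qed.

(** The integers m p with m up to X^(1/4) and p a prime between X / (K0 m) and
    X / m number at least a multiple of X / (m ln X) for each m. Summing over
    m brings in the factor gsum, which is at least (ln X)^(1/12) up to a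
    constant. *)
Lemma good_count_lower : exists c : R, exists X0 : nat, 0 < c /\
  forall X, (X0 <= X)%N ->
  c * (X%:R / (ln X%:R) `^ (11%:R / 12%:R)) <= (\sum_(1 <= N < X.+1 | good N) 1%N)%:R.
Proof.
have [c [z1 [c0 hz]]] := gsum_lower.
have [K0 [w0 [K0p hw]]] := nsprime_count.
pose Z := (z1 + w0 + 2 * K0 + 11)%N.
exists (c / (4 * K0%:R) / 8 `^ (12%:R^-1)), (Z ^ 4)%N; split.
  by rewrite !divr_gt0 ?mulr_gt0 ?powR_gt0 ?ltr0n.
move=> X ZX; have [z /andP[zX Xz]] := exists_root4 X.
have Zz : (Z <= z)%N.
  rewrite leqNgt; apply/negP => h.
  have : (z.+1 ^ 4 <= Z ^ 4)%N by rewrite leq_exp2r.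
  by move: ZX Xz; move: (z.+1 ^ 4)%N (Z ^ 4)%N => a b; lia.
have z0 : (0 < z)%N by apply: leq_trans Zz; rewrite /Z addn_gt0 orbT.
have [z11 [zz1 [zw zK]]] : (11 <= z)%N /\ (z1 <= z)%N /\ (w0 <= z)%N /\ (2 * K0 <= z)%N.
  by move: Zz; rewrite /Z; clear; lia.
have z4 : (z ^ 4 = z * z * z * z)%N by rewrite !expnS expn0 muln1 !mulnA.
have X1 : (z <= X)%N by apply: leq_trans zX; rewrite -{1}[z]expn1 leq_pexp2l.
have LX : 0 < ln (X%:R : R) by rewrite ln_gt0 // ltr1n; apply: leq_trans X1; lia.
have H := @good_products (fun=> 1) (fun m => X %/ m)%N z X z11 (fun=> ler01) _.
have {}H := H ltac:(by move=> m /andP[m0 _]; rewrite mulnC leq_trunc_div).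
rewrite natr_sum [leRHS](big_cat_nat _ (n := z.+1)) //=.
apply: ler_wpDl; first by apply: sumr_ge0.
apply: le_trans H.
have lower m : (0 < m <= z)%N -> X%:R / (4 * K0%:R * ln X%:R) * m%:R^-1 <=
    \sum_(z.+1 <= p < (X %/ m).+1 | nsprime p) 1 :> R.
  move=> /andP[m0 mz].
  have wz : (z * z * z <= X %/ m)%N.
    rewrite leq_divRL //; apply: leq_trans zX; rewrite z4 leq_mul2l mz orbT //.
  have zz : (z <= z * z)%N by rewrite leq_pmulr.
  have zzz : (z * z <= z * z * z)%N by rewrite leq_pmulr.
  have w0w : (w0 <= X %/ m <= X)%N.
    by rewrite leq_div andbT (leq_trans zw) // (leq_trans zz) // (leq_trans zzz).
  have zy : (z <= (X %/ m) %/ K0)%N.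
    rewrite leq_divRL //; apply: leq_trans (leq_trans zzz wz).
    by rewrite leq_mul2l; apply/orP; right; clear -zK; lia.
  apply: le_trans (_ : (X %/ m)%:R / (2 * K0%:R * ln X%:R) <= _).
    have hX : X%:R * m%:R^-1 <= 2 * (X %/ m)%:R :> R.
      rewrite ler_pdivrMr ?ltr0n // -!natrM ler_nat.
      by apply: leq_double_divn => //; apply: leq_trans X1.
    have u0 : 0 <= (4 * K0%:R * ln X%:R : R)^-1.
      by rewrite invr_ge0 !mulr_ge0 // ltW.
    have -> : (X %/ m)%:R / (2 * K0%:R * ln X%:R) = (4 * K0%:R * ln X%:R)^-1 * (2 * (X %/ m)%:R) :> R.
      by field; rewrite !gt_eqF ?ltr0n.
    by rewrite mulrAC mulrC ler_wpM2l.
  apply: le_trans (hw _ _ w0w) _; rewrite natr_sum.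
  rewrite [leRHS](big_cat_nat _ (n := ((X %/ m) %/ K0).+1)) //=; last by rewrite ltnS leq_div.
  by apply: ler_wpDl => //; apply: sumr_ge0.
apply: le_trans (_ : X%:R / (4 * K0%:R * ln X%:R) * gsum z <= _); last first.
  rewrite /gsum mulr_sumr big_nat_cond [leRHS]big_nat_cond.
  by apply: ler_sum => m /andP[hm _]; apply: lower; lia.
have lX8 : ln (X%:R : R) <= 8 * ln z%:R.
  have -> : 8 * ln z%:R = ln (z ^ 8)%:R :> R.
    by rewrite natrX lnXn ?ltr0n // -[RHS]mulr_natl.
  apply: ln_nat_le; apply/ltnW; apply: leq_trans Xz _.
  have -> : (z ^ 8 = (z * z) ^ 4)%N by rewrite mulnn -expnM.
  by rewrite leq_exp2r //; clear -z11; nia.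
have g := hz z zz1.
have p8 : (ln (X%:R : R)) `^ (12%:R^-1) <= 8 `^ (12%:R^-1) * (ln z%:R) `^ (12%:R^-1).
  rewrite -powRM ?ln_nat_ge0 //; apply: ge0_ler_powR; rewrite ?nnegrE ?invr_ge0 ?ln_nat_ge0 //.
  by rewrite mulr_ge0 ?ln_nat_ge0.
have split : (ln (X%:R : R)) `^ (11%:R / 12%:R) * (ln X%:R) `^ (12%:R^-1) = ln X%:R.
  rewrite -powRD; last by apply/implyP => /eqP h; move: LX; lra.
  rewrite (_ : 11%:R / 12%:R + 12%:R^-1 = 1 :> R) ?powRr1 ?ln_nat_ge0 //; lra.
have E0 : 0 < 8 `^ (12%:R^-1) :> R by rewrite powR_gt0.
have P0 : 0 < (ln (X%:R : R)) `^ (11%:R / 12%:R) by rewrite powR_gt0.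
have Q0 : 0 < (ln (X%:R : R)) `^ (12%:R^-1) by rewrite powR_gt0.
have K0R : 0 < K0%:R :> R by rewrite ltr0n.
apply: le_trans (_ : X%:R / (4 * K0%:R * ln X%:R) * (c * (ln z%:R) `^ (12%:R^-1)) <= _); last first.
  by apply: ler_wpM2l g; rewrite mulr_ge0 // invr_ge0 !mulr_ge0 // ltW.
move: p8 E0 P0 Q0 split.
set a := 8 `^ _; set b := (ln z%:R) `^ _; set P := _ `^ (11%:R / 12%:R); set Q := _ `^ (12%:R^-1).
move=> p8 a0 P0 Q0 <-; rewrite -subr_ge0.
have -> : X%:R / (4 * K0%:R * (P * Q)) * (c * b) - c / (4 * K0%:R) / a * (X%:R / P) =
   (c * X%:R) * (a * b - Q) / (4 * K0%:R * P * Q * a).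
  by field; rewrite !gt_eqF.
apply: divr_ge0; last by rewrite !mulr_ge0 // ltW.
by rewrite !mulr_ge0 ?subr_ge0 // ltW.
Qed.
End Lower.

(** * The upper bound *)

Definition splitnat (m : nat) : bool := all (fun p => chi p == 1) (primes m).

Lemma splitnatM m n : (0 < m)%N -> (0 < n)%N ->
  splitnat (m * n) = splitnat m && splitnat n.
Proof.
move=> m0 n0; rewrite /splitnat -all_cat; apply: eq_all_r => p.
by rewrite primesM // mem_cat.
Qed.

Lemma splitnat_chi m : (0 < m)%N -> splitnat m -> chi m = 1.
Proof.
elim/ltn_ind: m => m IH m0 sm.
case: (ltnP 1 m) => m1; last by rewrite (_ : m = 1%N) //; lia.
have pr := pdiv_prime m1; have [k] := dvdnP (pdiv_dvd m).
move: (pdiv m) pr => p pr ek.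
have k0 : (0 < k)%N by case: k ek => // ek; rewrite ek in m0.
have p1 := prime_gt1 pr; have p0 := prime_gt0 pr.
move: sm; rewrite ek splitnatM // => /andP[sk sp].
rewrite chiM IH // ?mul1r; last by rewrite [in ltnRHS]ek ltn_Pmulr.
by move: sp; rewrite /splitnat primes_prime //= andbT => /eqP.
Qed.

Definition sqrsplit (N : nat) : bool :=
  has (fun t => (t * t %| N)%N && splitnat (N %/ (t * t))) (iota 1 N).

(** Dividing the coordinates by their greatest common divisor t leaves a
    primitive representation of N / t^2, and an inert prime dividing it would
    divide both coordinates. *)
Lemma qform_sqrsplit d z N : qform d z = N%:Z -> coprime N 6 -> (0 < N)%N -> sqrsplit N.
Proof.
case: z => x y hN c6 N0; pose t := gcdz x y.
have [x0|nx0] := eqVneq t 0.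
  have : (x == 0) && (y == 0) by rewrite -gcdz_eq0 -/t x0.
  by move=> /andP[/eqP ex /eqP ey]; move: hN; rewrite ex ey /qform /=; case: d; lia.
have pos (a b : int) : 0 <= qform d (a, b).
  have sq (u : int) : 0 <= u ^+ 2 := sqr_ge0 u.
  by rewrite /qform /=; have := sq a; have := sq b; case: d {hN}; lia.
pose x' := (x %/ t)%Z; pose y' := (y %/ t)%Z.
have xE : x = t * x' by rewrite mulrC divzK // dvdz_gcdl.
have yE : y = t * y' by rewrite mulrC divzK // dvdz_gcdr.
have tt : t = (absz t)%:Z by rewrite gez0_abs // /t gcdz_ge0.
pose m := absz (qform d (x', y')).
have q0 : 0 <= qform d (x', y') := pos x' y'.
have mE : m%:Z = qform d (x', y') by rewrite /m gez0_abs.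
have NE : N = (absz t * absz t * m)%N.
  apply/eqP; rewrite -eqz_nat -hN !PoszM -!tt mE (_ : (x, y) = qscale t (x', y')); last first.
    by rewrite /qscale /= -xE -yE.
  by rewrite qform_scale expr2.
have t0 : (0 < absz t)%N by rewrite absz_gt0.
have m0 : (0 < m)%N by move: N0; rewrite NE !muln_gt0 => /andP[].
apply/hasP; exists (absz t).
  rewrite mem_iota t0 /= add1n ltnS NE -mulnA leq_pmulr // muln_gt0 t0 m0 //.
rewrite NE dvdn_mulr //= mulKn ?muln_gt0 ?t0 //.
apply/allP => p; rewrite mem_primes => /and3P[pr _ pm].
have p3 : (3 < p)%N.
  have : coprime p 6 by apply: coprime_dvdl c6; rewrite NE dvdn_mull.
  rewrite prime_coprime // => np; rewrite ltnNge; apply/negP => p3.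
  have : p = 2 \/ p = 3 by have := prime_gt1 pr; lia.
  by case=> e; rewrite e in np.
have /orP[//|/eqP ch] := chi_prime pr p3; exfalso.
have /andP[/= px py] : (p%:Z %| x')%Z && (p%:Z %| y')%Z.
  by apply: (@inert_prime_repr p d (x', y')) => //; rewrite -mE dvdzE.
have : (p%:Z %| gcdz x' y')%Z by rewrite dvdz_gcd px py.
suff -> : gcdz x' y' = 1 by rewrite dvdz1 /= => /eqP p1; rewrite p1 in pr.
have : t * gcdz x' y' = t * 1.
  have -> : t * gcdz x' y' = `|t|%N%:Z * gcdz x' y' by rewrite -tt.
  by rewrite mulz_gcdr -xE -yE mulr1.
by move/(mulfI nx0).
Qed.

Lemma qcoef_repr n : qcoef n != 0 ->
  exists x y : nat, (x ^ 2 + 6 * y ^ 2 = n \/ 2 * x ^ 2 + 3 * y ^ 2 = n)%N.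
Proof.
move=> nz; case: (pselect (exists x y : nat,
  (x ^ 2 + 6 * y ^ 2 = n \/ 2 * x ^ 2 + 3 * y ^ 2 = n)%N)) => // no.
case/negP: nz; apply/eqP; rewrite /qcoef big1 // => x _; rewrite big1 // => y _.
have -> : (x ^ 2 + 6 * y ^ 2 == n)%N = false.
  by apply/eqP => e; case: no; exists x, y; left.
have -> : (2 * x ^ 2 + 3 * y ^ 2 == n)%N = false.
  by apply/eqP => e; case: no; exists x, y; right.
by rewrite mulr0.
Qed.

Lemma odd_A_sqrsplit n : odd (A (2 * n + 1)) -> sqrsplit (24 * n + 11).
Proof.
rewrite odd_A => h.
have nz : qcoef (24 * n + 11) != 0 by apply: contraTneq h => ->.
have c6 : coprime (24 * n + 11) 6 by rewrite coprime6E; apply/andP; split; lia.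
have [x [y [e|e]]] := qcoef_repr nz.
  by apply: (@qform_sqrsplit false (x%:Z, y%:Z)) => //; rewrite /qform /=; lia.
by apply: (@qform_sqrsplit true (x%:Z, y%:Z)) => //; rewrite /qform /=; lia.
Qed.

Section Upper.
Variable R : realType.
Local Notation rt n := (Num.sqrt (n%:R : R)).
Local Notation chiR := (fun n => (chi n)%:~R : R).
Local Notation Lam := (vonMangoldt R).

(** The number of ideals of norm n in the quadratic field of -6. *)
Definition nrep : nat -> R := dconv (fun=> 1) chiR.

(** Its logarithmic derivative has the coefficients 1 + chi (p^j) >= 0. *)
Lemma nrep_ge0 n : (0 < n)%N -> 0 <= nrep n.
Proof.
apply: (logder_ge0 (logder_dconv (@logder1 R) (@logder_chi R))) => [p j pr j0|].
  rewrite /chi; case: ifP => _; first by rewrite addr_ge0.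
  by case: ifP => _; rewrite ?mulrN1z ?subrr ?addr0.
by rewrite /dconv big_mkcond big_nat1 /= divn1 chi1 mulr1.
Qed.

(** This is [hsum_cauchy] from 1 to X. *)
Lemma hsum_chi_le X : hsum chiR X <= 17.
Proof.
case: X => [|X]; first by rewrite /hsum big_geq.
have := hsum_cauchy (@chi_cancel R) (isT : (0 < 1 <= X.+1)%N).
rewrite sqrtr1 divr1 ler_norml => /andP[_].
rewrite {2}/hsum big_nat1 chi1 divr1; lra.
Qed.

Lemma sum_nrep Z : (0 < Z)%N -> \sum_(1 <= n < Z.+1) nrep n / n%:R <= 17 * (1 + ln Z%:R).
Proof.
move=> Z0; have -> : \sum_(1 <= n < Z.+1) nrep n / n%:R =
    \sum_(1 <= d < Z.+1) d%:R^-1 * hsum chiR (Z %/ d).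
  under [RHS]eq_bigr do rewrite mulr_sumr.
  rewrite -(sum_dirichlet (fun d m => d%:R^-1 * (chiR m / m%:R))).
  rewrite !big_nat; apply: eq_bigr => n hn; rewrite /nrep /dconv mulr_suml.
  rewrite [LHS]big_nat_cond [RHS]big_nat_cond; apply: eq_bigr => d /andP[hd dn].
  by rewrite mul1r mulrCA -invfM -natrM mulnC divnK.
apply: le_trans (_ : \sum_(1 <= d < Z.+1) d%:R^-1 * 17 <= _).
  by apply: ler_sum => d _; rewrite ler_wpM2l ?invr_ge0 // hsum_chi_le.
by rewrite -mulr_suml mulrC ler_pM2l // sum_inv_harm.
Qed.

Definition ssum (Y : nat) : R := \sum_(1 <= m < Y.+1 | splitnat m) m%:R^-1.

Lemma ssum_ge0 Y : 0 <= ssum Y. Proof. by apply: sumr_ge0. Qed.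

Lemma ssum_le Y Z : (Y <= Z)%N -> ssum Y <= ssum Z.
Proof.
by move=> YZ; rewrite /ssum [leRHS](big_cat_nat _ (n := Y.+1)) //= lerDl sumr_ge0.
Qed.

(** The product of two integers composed of split primes is again such an
    integer n, at most Y^2, and the number of ways to write it so is at most
    (1 * chi)(n), because chi is 1 on all divisors of n. *)
Lemma ssum_sqr Y : (0 < Y)%N -> ssum Y ^+ 2 <= 17 * (1 + 2 * ln Y%:R).
Proof.
move=> Y0; pose i m : R := (splitnat m)%:R.
have -> : 2 * ln Y%:R = ln (Y * Y)%:R :> R by rewrite natrM lnM ?posrE ?ltr0n //; ring.
apply: le_trans (sum_nrep _); last by rewrite muln_gt0 Y0.
have e Z : ssum Z = \sum_(1 <= m < Z.+1) i m / m%:R.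
  rewrite /ssum big_mkcond; apply: eq_bigr => m _.
  by rewrite /i; case: splitnat; rewrite ?mul1r ?mul0r.
have i0 m : 0 <= i m / m%:R by rewrite mulr_ge0 ?invr_ge0.
apply: (@le_trans _ _ (\sum_(1 <= m < (Y * Y).+1) \sum_(1 <= k < ((Y * Y) %/ m).+1) (i m / m%:R) * (i k / k%:R))).
  have YY : (Y <= Y * Y)%N by rewrite leq_pmulr.
  rewrite expr2 {1}e mulr_suml [leRHS](big_cat_nat _ (n := Y.+1)) //=.
  rewrite -[leLHS]addr0; apply: lerD; last first.
    by apply: sumr_ge0 => m _; apply: sumr_ge0 => k _; rewrite mulr_ge0.
  rewrite !big_nat; apply: ler_sum => m hm.
  rewrite -mulr_sumr ler_wpM2l // e [leRHS](big_cat_nat _ (n := Y.+1)) //=; last first.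
    by rewrite ltnS leq_divRL; [rewrite leq_mul2l; lia|lia].
  by rewrite lerDl sumr_ge0.
rewrite -(sum_dirichlet (fun m k => (i m / m%:R) * (i k / k%:R))).
rewrite !big_nat; apply: ler_sum => n hn.
have n0 : (0 < n)%N by lia.
have -> : \sum_(1 <= d < n.+1 | (d %| n)%N) i d / d%:R * (i (n %/ d)%N / (n %/ d)%:R) =
   (\sum_(1 <= d < n.+1 | (d %| n)%N) i d * i (n %/ d)%N) / n%:R.
  rewrite mulr_suml; apply: eq_bigr => d dn.
  by rewrite mulrACA -invfM; congr (_ * _^-1); rewrite -natrM mulnC divnK.
rewrite ler_wpM2r ?invr_ge0 //.
case: (boolP (splitnat n)) => sn.
  rewrite /nrep /dconv big_nat_cond [leRHS]big_nat_cond; apply: ler_sum => d /andP[hd dn].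
  have q0 : (0 < n %/ d)%N by rewrite divn_gt0; [apply: dvdn_leq|case/andP: hd].
  have : splitnat (n %/ d * d) by rewrite divnK.
  rewrite splitnatM //; last by lia.
  move=> /andP[sq _]; rewrite (splitnat_chi q0 sq) mulr1 /i -natrM mulnb.
  by case: (_ && _).
rewrite big_nat_cond big1 ?nrep_ge0 // => d /andP[hd dn].
have q0 : (0 < n %/ d)%N by rewrite divn_gt0; [apply: dvdn_leq|case/andP: hd].
rewrite /i -natrM mulnb andbC -splitnatM ?divnK //; last by lia.
by rewrite (negPf sn).
Qed.

(** The logarithm is a sum over prime powers d dividing m, and the cofactors
    are again composed of split primes. Chebyshev's bound for the sum over d
    leaves the sum of the X / k. *)
Lemma sum_ln_split X : \sum_(1 <= m < X.+1 | splitnat m) ln (m%:R : R) <= 4 * X%:R * ssum X.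
Proof.
pose i m : R := (splitnat m)%:R.
apply: (@le_trans _ _ (\sum_(1 <= m < X.+1) dconv Lam i m)).
  rewrite big_mkcond !big_nat; apply: ler_sum => m hm.
  have m0 : (0 < m)%N by lia.
  case: ifP => sm; last first.
    by apply: sumr_ge0 => d _; rewrite mulr_ge0 ?Lam_ge0.
  have := logder_mangoldt (@logder1 R) m0; rewrite mul1r => ->.
  rewrite /dconv big_nat_cond [leRHS]big_nat_cond; apply: ler_sum => d /andP[hd dn].
  have d0 : (0 < d)%N by lia.
  have q0 : (0 < m %/ d)%N by rewrite divn_gt0 // dvdn_leq.
  have : splitnat (m %/ d * d) by rewrite divnK.
  by rewrite splitnatM // /i => /andP[-> _]; rewrite -/(vonMangoldt R).
have -> : \sum_(1 <= m < X.+1) dconv Lam i m =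
    \sum_(1 <= k < X.+1) \sum_(1 <= d < (X %/ k).+1) i k * Lam d.
  rewrite -(sum_dirichlet (fun k d => i k * Lam d)) !big_nat.
  by apply: eq_bigr => m hm; rewrite dconvC //; lia.
rewrite /ssum mulr_sumr [leRHS]big_mkcond !big_nat; apply: ler_sum => k hk.
have k0 : (0 < k)%N by lia.
rewrite -mulr_sumr /i; case: ifP => _; last by rewrite mul0r.
rewrite mul1r; apply: le_trans (chebyshev _ _) _.
by rewrite -mulrA ler_pM2l // ler_pdivlMr ?ltr0n // -natrM ler_nat leq_trunc_div.
Qed.

Lemma sum_inv_sqr T : \sum_(1 <= t < T.+1) ((t * t)%:R : R)^-1 <= 2.
Proof.
case: T => [|T]; first by rewrite big_geq.
suff : \sum_(1 <= t < T.+2) ((t * t)%:R : R)^-1 <= 2 - T.+1%:R^-1.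
  have : 0 <= (T.+1%:R : R)^-1 by rewrite invr_ge0.
  by move: (_^-1) => u; lra.
elim: T => [|T IH]; first by rewrite big_nat1 mul1n invr1; lra.
rewrite big_nat_recr //=; apply: le_trans (lerD IH (lexx _)) _.
rewrite -addrA lerD2l natrM.
have : T.+1%:R = T.+2%:R - 1 :> R by rewrite -[T.+2%:R]natr1 addrK.
have : 1 < T.+2%:R :> R by rewrite ltr1n.
move: (T.+2%:R : R) (T.+1%:R : R) => b a b1 ->.
rewrite -subr_ge0.
have -> : - b^-1 - (- (b - 1)^-1 + (b * b)^-1) = 1 / (b * b * (b - 1)) :> R.
  by field; rewrite !gt_eqF ?subr_gt0 //; lra.
by rewrite divr_ge0 // !mulr_ge0 ?subr_ge0 //; lra.
Qed.

Lemma sum_ln_sqr T : \sum_(1 <= t < T.+1) 2 * ln (t%:R : R) / (t * t)%:R <= 12.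
Proof.
case: T => [|T]; first by rewrite big_geq.
apply: (@le_trans _ _ (\sum_(1 <= t < T.+2) 4 * (t%:R * rt t)^-1)).
  rewrite !big_nat; apply: ler_sum => t ht.
  have t0 : (0 < t)%N by lia.
  apply: le_trans (_ : 2 * (2 * rt t) / (t * t)%:R <= _).
    by rewrite ler_wpM2r ?invr_ge0 // ler_pM2l // ln_le_rt.
  rewrite natrM; move: (rt_sqr R t) (rt_gt0 R t0); move: (rt t) => a <- a0.
  by rewrite le_eqVlt; apply/orP; left; apply/eqP; field; rewrite gt_eqF.
rewrite -mulr_sumr; have := sum_inv_pow32 R (isT : (0 < T.+1)%N).
have : 0 <= 2 / rt T.+1 by rewrite mulr_ge0 // invr_ge0.
lra.
Qed.

(** Summing [sum_ln_split] over the square factor t^2, with X / t^2 in place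
    of X; the sum over t converges even with ln t. *)
Lemma sum_ln_sqrsplit X :
  \sum_(1 <= N < X.+1 | sqrsplit N) ln (N%:R : R) <= 8 * X%:R * ssum X + 12 * X%:R.
Proof.
apply: (@le_trans _ _ (\sum_(1 <= t < X.+1) \sum_(1 <= m < (X %/ (t * t)).+1 | splitnat m)
    ln ((m * (t * t))%:R : R))).
  apply: (@le_trans _ _ (\sum_(1 <= N < X.+1) \sum_(1 <= t < X.+1)
     (if (t * t %| N)%N && splitnat (N %/ (t * t)) then ln (N%:R : R) else 0))).
    rewrite big_mkcond !big_nat; apply: ler_sum => N hN.
    have pos t : 0 <= (if (t * t %| N)%N && splitnat (N %/ (t * t)) then ln (N%:R : R) else 0).
      by case: ifP => // _; apply: ln_nat_ge0.
    case: ifP => [/hasP[t]|_]; last by apply: sumr_ge0.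
    rewrite mem_iota => ht hh.
    rewrite (bigD1_seq t) ?iota_uniq ?mem_index_iota //=; last by lia.
    by rewrite hh lerDl sumr_ge0.
  rewrite exchange_big /= !big_nat; apply: ler_sum => t ht.
  have t0 : (0 < t * t)%N by rewrite muln_gt0; lia.
  rewrite -big_mkcond /= big_mkcondr /= sum_dvdn_mul // [leRHS]big_mkcond /=.
  by apply: ler_sum => m _; rewrite mulKn // mulnC.
apply: (@le_trans _ _ (\sum_(1 <= t < X.+1)
   (4 * X%:R * ssum X * ((t * t)%:R)^-1 + X%:R * (2 * ln t%:R / (t * t)%:R)))).
  rewrite !big_nat; apply: ler_sum => t ht.
  have t0 : (0 < t)%N by lia.
  have tt0 : (0 < t * t)%N by rewrite muln_gt0 t0.
  set Y := (X %/ (t * t))%N.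
  have YX : Y%:R <= X%:R / (t * t)%:R :> R.
    by rewrite ler_pdivlMr ?ltr0n // -natrM ler_nat leq_trunc_div.
  apply: (@le_trans _ _ (\sum_(1 <= m < Y.+1 | splitnat m) (ln (m%:R : R) + 2 * ln t%:R))).
    rewrite big_nat_cond [leRHS]big_nat_cond; apply: ler_sum => m /andP[hm _].
    have m0 : (0 < m)%N by lia.
    by rewrite !natrM !lnM ?posrE ?mulr_gt0 ?ltr0n //; lra.
  rewrite big_split /=; apply: lerD.
    apply: le_trans (sum_ln_split Y) _.
    apply: (@le_trans _ _ (4 * (X%:R / (t * t)%:R) * ssum X)).
      apply: ler_pM; rewrite ?mulr_ge0 ?ssum_ge0 //; first by rewrite ler_pM2l.
      by apply: ssum_le; rewrite leq_div.
    by rewrite le_eqVlt; apply/orP; left; apply/eqP; ring.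
  apply: (@le_trans _ _ (\sum_(1 <= m < Y.+1) 2 * ln (t%:R : R))).
    rewrite big_mkcond; apply: ler_sum => m _; case: ifP => // _.
    by rewrite mulr_ge0 ?ln_nat_ge0.
  rewrite sumr_const_nat subn1 /= -[leLHS]mulr_natl.
  apply: le_trans (ler_wpM2r _ YX) _; first by rewrite mulr_ge0 ?ln_nat_ge0.
  by rewrite le_eqVlt; apply/orP; left; apply/eqP; ring.
rewrite big_split /= -!mulr_sumr.
have h1 : 4 * X%:R * ssum X * \sum_(1 <= t < X.+1) ((t * t)%:R : R)^-1 <= 4 * X%:R * ssum X * 2.
  by apply: ler_wpM2l (sum_inv_sqr X); rewrite !mulr_ge0 ?ssum_ge0.
have h2 : X%:R * \sum_(1 <= t < X.+1) 2 * ln (t%:R : R) / (t * t)%:R <= X%:R * 12.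
  by apply: ler_wpM2l (sum_ln_sqr X).
by apply: le_trans (lerD h1 h2) _; lra.
Qed.

(** Apart from the integers below sqrt X, each integer counted has logarithm
    at least (ln X) / 2, so their number is at most 2 / ln X times the sum of
    the logarithms. *)
Lemma sqrsplit_count_upper : exists C : R, exists X0 : nat, 0 < C /\
  forall X, (X0 <= X)%N ->
  (\sum_(1 <= N < X.+1 | sqrsplit N) 1%N)%:R <= C * (X%:R / Num.sqrt (ln X%:R)).
Proof.
have [X0 hX0] := exists_ln_ge (1 : R).
exists 200, (X0 + 2)%N; split => // X hX.
have X0' : (0 < X)%N by lia.
have L1 : 1 <= ln (X%:R : R) by apply: hX0; lia.
set l := ln (X%:R : R) in L1 *; set q := Num.sqrt l.
have qq : q * q = l by rewrite -expr2 sqr_sqrtr //; lra.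
have q1 : 1 <= q by rewrite -sqrtr1 ler_sqrt; lra.
have ss : ssum X <= 8 * q.
  rewrite -[leLHS]ger0_norm ?ssum_ge0 // -sqrtr_sqr -[leRHS]ger0_norm; last by lra.
  rewrite -sqrtr_sqr ler_sqrt ?sqr_ge0 //; apply: le_trans (ssum_sqr X0') _.
  by rewrite -/l exprMn expr2 [in leRHS]expr2 qq; lra.
have total := sum_ln_sqrsplit X.
(* the integers up to sqrt X are counted trivially *)
have cnt : (\sum_(1 <= N < X.+1 | sqrsplit N) 1%N)%:R <=
    rt X + 2 / l * \sum_(1 <= N < X.+1 | sqrsplit N) ln (N%:R : R).
  have [s /andP[s1 s2]] := exists_sqrtn X.
  have srt : s%:R <= rt X :> R.
    by rewrite -[leLHS]ger0_norm // -sqrtr_sqr ler_sqrt // -natrX ler_nat; lia.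
  have sX : (s <= X)%N by nia.
  rewrite natr_sum (big_cat_nat _ (n := s.+1)) //=; apply: lerD.
    apply: le_trans (_ : \sum_(1 <= N < s.+1) (1 : R) <= _).
      by rewrite big_mkcond; apply: ler_sum => N _; case: ifP.
    by rewrite sumr_const_nat subn1.
  rewrite mulr_sumr [leRHS](big_cat_nat _ (n := s.+1)) //=.
  have c0 : 0 <= 2 / l by rewrite divr_ge0 //; lra.
  apply: ler_wpDl; first by apply: sumr_ge0 => N _; rewrite mulr_ge0 ?ln_nat_ge0.
  rewrite big_nat_cond [leRHS]big_nat_cond; apply: ler_sum => N /andP[hN _].
  have hl : l <= 2 * ln N%:R.
    have -> : 2 * ln N%:R = ln (N * N)%:R :> R.
      by rewrite natrM lnM ?posrE ?ltr0n; [ring|lia|lia].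
    by apply: ln_nat_le; nia.
  by rewrite mulrAC ler_pdivlMr; lra.
apply: le_trans cnt _.
have rq : rt X <= X%:R / q.
  rewrite ler_pdivlMr; last by lra.
  rewrite -[leRHS](rt_sqr R X) ler_wpM2l // ler_sqrt //.
  by apply/ltW/ln_sublinear; rewrite ltr0n.
have h2 : 2 / l * \sum_(1 <= N < X.+1 | sqrsplit N) ln (N%:R : R) <= 2 / l * (X%:R * (76 * q)).
  apply: ler_wpM2l; first by rewrite divr_ge0 //; lra.
  apply: le_trans total _.
  have : X%:R * ssum X <= X%:R * (8 * q) by rewrite ler_wpM2l.
  have : X%:R * 1 <= X%:R * q :> R by rewrite ler_wpM2l.
  by rewrite mulr1; lra.
apply: le_trans (lerD rq h2) _; rewrite -qq.
have -> : 2 / (q * q) * (X%:R * (76 * q)) = 152 * (X%:R / q).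
  by field; rewrite gt_eqF //; lra.
have : 0 <= X%:R / q by rewrite divr_ge0 //; lra.
lra.
Qed.

End Upper.

(** * Transfer to the odd values of A *)

Lemma odd_countE (R : realType) (x : R) : 0 <= x ->
  odd_count x = count (fun n => odd (A (2 * n + 1))) (iota 0 (Num.truncn x).+1).
Proof.
move=> x0; rewrite /odd_count -size_filter.
set s := [seq n <- _ | _].
have us : uniq s by rewrite filter_uniq ?iota_uniq.
have -> : odd_set x = [set` [fset n in s]%fset]%classic.
  apply/seteqP; split => n /=.
    move=> [nx on]; rewrite in_fset /= mem_filter on mem_iota /= add0n ltnS.
    by rewrite truncn_ge_nat.
  rewrite in_fset /= mem_filter mem_iota add0n ltnS => /andP[on /=].
  by rewrite truncn_ge_nat.
by rewrite set_fsetK card_fseq undup_id.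
Qed.

(** Prime to 6, the first form is 1 or 7 and the second is 5 or 11 modulo 24. *)
Lemma qcoef_mod24 n : qcoef n != 0 -> coprime n 6 -> (n %% 24)%N \in [:: 1; 5; 7; 11]%N.
Proof.
move=> /qcoef_repr[x [y h]] c6.
have red a : (a ^ 2 = (a %% 24) ^ 2 %[mod 24])%N by rewrite modnXm.
have cop6 m : coprime m 6 = coprime (m %% 24) 6.
  by rewrite -(coprime_modl m 6) -(coprime_modl (m %% 24) 6) modn_dvdm.
have /allP fin : all (fun a => all (fun b =>
    (coprime ((a ^ 2 + 6 * b ^ 2) %% 24) 6 ==> ((a ^ 2 + 6 * b ^ 2) %% 24 \in [:: 1; 5; 7; 11]))
    && (coprime ((2 * a ^ 2 + 3 * b ^ 2) %% 24) 6 ==>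
         ((2 * a ^ 2 + 3 * b ^ 2) %% 24 \in [:: 1; 5; 7; 11])))%N (iota 0 24)) (iota 0 24).
  by vm_compute.
have lt24 a : (a %% 24)%N \in iota 0 24 by rewrite mem_iota /= ltn_mod.
have /allP/(_ _ (lt24 y))/andP[f1 f2] := fin _ (lt24 x).
have lin a b : ((a * x ^ 2 + b * y ^ 2) %% 24 =
    (a * (x %% 24) ^ 2 + b * (y %% 24) ^ 2) %% 24)%N.
  by rewrite -modnDm -modnMmr red modnMmr -[(b * _ %% _)%N]modnMmr red modnMmr modnDm.
rewrite cop6 in c6.
case: h => e; rewrite -e in c6 *.
  by move: (lin 1%N 6%N) c6 f1; rewrite !mul1n => -> -> .
by move: c6 f2; rewrite lin => ->.
Qed.

Lemma odd_qcoef_small : all (fun s => odd (absz (qcoef s))) [:: 1; 5; 7; 11]%N.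
Proof. by rewrite /qcoef unlock; vm_compute. Qed.

(** The factor s among 1, 5, 7, 11 for which s m is 11 modulo 24, as squares
    of integers prime to 24 are 1 modulo 24. *)
Definition lift11 (m : nat) : nat :=
  if (m %% 24 == 1)%N then 11 else if (m %% 24 == 5)%N then 7
  else if (m %% 24 == 7)%N then 5 else 1.

Lemma lift11_mem m : lift11 m \in [:: 1; 5; 7; 11]%N.
Proof. by rewrite /lift11; do 3![case: ifP => // _]. Qed.

Lemma dvdn_lift11 m : (lift11 m %| 2310)%N.
Proof. by have := lift11_mem m; rewrite !inE => /or4P[] /eqP ->. Qed.

Lemma good_coprime_lift11 m k : good m -> coprime m (lift11 k).
Proof. by move=> /andP[_]; apply: coprime_dvdr; apply: dvdn_lift11. Qed.

(** The primes 5, 7 and 11 have odd qcoef and do not divide m. *)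
Lemma odd_qcoef_lift11 m : good m -> odd (absz (qcoef (lift11 m * m))).
Proof.
move=> gm; have /andP[om _] := gm; have c := good_coprime_lift11 m gm.
have /allP/(_ _ (lift11_mem m)) os := odd_qcoef_small.
have := lift11_mem m; rewrite !inE => /orP[/eqP -> | h]; first by rewrite mul1n.
have pr : prime (lift11 m) by move: h => /or3P[] /eqP ->.
by rewrite odd_qcoefM ?os ?om // -prime_coprime // coprime_sym.
Qed.

Lemma lift11_mod24 m : good m -> (lift11 m * m %% 24 = 11)%N.
Proof.
move=> /andP[om c].
have nz : qcoef m != 0 by apply: contraTneq om => ->.
have := qcoef_mod24 nz (coprime_dvdr (isT : (6 %| 2310)%N) c).
rewrite -modnMmr /lift11 !inE => /or4P[] /eqP -> //.
Qed.

(** The factor lift11 m is recovered from the product as its part composed of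
    5, 7 and 11. *)
Lemma lift11_inj m m' : good m -> good m' -> (lift11 m * m = lift11 m' * m')%N -> m = m'.
Proof.
move=> g g' e.
have le k k' : good k' -> (lift11 k * k = lift11 k' * k')%N -> (lift11 k %| lift11 k')%N.
  move=> gk ek; rewrite -(@Gauss_dvdl _ _ k'); last by rewrite coprime_sym good_coprime_lift11.
  by rewrite -ek dvdn_mulr.
have es : lift11 m = lift11 m' by apply/eqP; rewrite eqn_dvd !le.
move/eqP: e; rewrite es eqn_pmul2l; first by move/eqP.
by have := lift11_mem m'; rewrite !inE => /or4P[] /eqP ->.
Qed.

Lemma count_good_le X : (count good (iota 1 (2 * X)) <=
  count (fun n => odd (A (2 * n + 1))) (iota 0 X.+1))%N.
Proof.
rewrite -!size_filter; pose f m := ((lift11 m * m) %/ 24)%N.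
have fE m : good m -> (24 * f m + 11 = lift11 m * m)%N.
  move=> g; rewrite [RHS](divn_eq _ 24) lift11_mod24 // mulnC //.
rewrite -(size_map f); apply: uniq_leq_size.
  rewrite map_inj_in_uniq ?filter_uniq ?iota_uniq // => m m'.
  rewrite !mem_filter => /andP[g _] /andP[g' _] e.
  by apply: lift11_inj => //; rewrite -!fE // e.
move=> n /mapP[m]; rewrite mem_filter mem_iota => /andP[g hm] ->.
rewrite mem_filter; apply/andP; split; first by rewrite odd_A fE // odd_qcoef_lift11.
rewrite mem_iota /= add0n ltnS.
have hs : (lift11 m <= 11)%N by have := lift11_mem m; rewrite !inE => /or4P[] /eqP ->.
rewrite /f -ltnS ltn_divLR //; apply: leq_ltn_trans (_ : 11 * (2 * X) < _)%N; last by lia.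
by apply: leq_mul => //; lia.
Qed.

Lemma count_odd_A_le X : (count (fun n => odd (A (2 * n + 1))) (iota 0 X.+1) <=
  count sqrsplit (iota 1 (24 * X + 11)))%N.
Proof.
rewrite -!size_filter; pose f n := (24 * n + 11)%N.
rewrite -(size_map f); apply: uniq_leq_size.
  by rewrite map_inj_uniq ?filter_uniq ?iota_uniq // => m m'; rewrite /f; lia.
move=> N /mapP[n]; rewrite mem_filter mem_iota => /andP[g hn] ->.
by rewrite mem_filter odd_A_sqrsplit //= mem_iota /f; lia.
Qed.

Lemma sum1_iota (P : pred nat) X : (\sum_(1 <= N < X.+1 | P N) 1 = count P (iota 1 X))%N.
Proof. by rewrite sum1_count /index_iota subSS subn0. Qed.

Theorem theorem1p3 (R : realType) :
  exists c C x0 : R, [/\ 0 < c, 0 < C, 1 < x0 &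
    forall x : R, x0 <= x ->
      c * (x / (ln x) `^ (11%:R / 12%:R)) <= (odd_count x)%:R
        <= C * (x / (ln x) `^ (1 / 2%:R))].
Proof.
have [c [X1 [c0 lower]]] := good_count_lower R.
have [C [X2 [C0 upper]]] := sqrsplit_count_upper R.
(* the constants come from 24 x + 11 <= 35 x, and from ln (2 x) <= 2 ln x with 2^(11/12) <= 2 *)
exists (c / 2), (35 * C), ((X1 + X2)%:R + 4).
have K0 : 0 <= (X1 + X2)%:R :> R := ler0n _ _.
split; [by rewrite divr_gt0 | by rewrite mulr_gt0 | by lra |] => x xx.
have x4 : 4 <= x by lra.
have x0 : 0 <= x by lra.
have lx : 0 < ln x by rewrite ln_gt0 //; lra.
rewrite odd_countE //; set X := Num.truncn x.
have /andP[X_le lt_X] : X%:R <= x < X.+1%:R := truncn_itv x0.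
have hX : (X1 + X2 < X)%N by rewrite -ltnS -(ltr_nat R) -natr1; apply: le_lt_trans lt_X; lra.
have X4 : (4 <= X)%N by rewrite truncn_ge_nat.
rewrite -natr1 in lt_X.
clearbody X.
have [hX1 hX2] : ((X1 <= 2 * X) /\ (X2 <= 24 * X + 11))%N by move: hX; clear; lia.
have X4R : 4 <= X%:R :> R by rewrite (ler_nat R 4).
apply/andP; split.
  have := lower (2 * X)%N; rewrite sum1_iota => low.
  apply: le_trans (_ : (count good (iota 1 (2 * X)))%:R <= _); last first.
    by rewrite ler_nat count_good_le.
  apply: le_trans (low hX1).
  rewrite -mulrA ler_pM2l // natrM.
  set a : R := 11%:R / 12%:R.
  have l1 : 0 < ln (2 * X%:R : R) by rewrite ln_gt0 //; lra.
  have l2 : ln (2 * X%:R) <= 2 * ln x.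
    rewrite (_ : 2 * ln x = ln (x * x)); last by rewrite lnM ?posrE; [ring|lra|lra].
    by rewrite ler_ln ?posrE; nra.
  have a0 : 0 <= a by rewrite /a; lra.
  have l3 : (ln (2 * X%:R)) `^ a <= 2 * (ln x) `^ a.
    apply: le_trans (_ : (2 * ln x) `^ a <= _).
      by apply: ge0_ler_powR; rewrite ?nnegrE //; lra.
    rewrite powRM //; last by lra.
    rewrite ler_wpM2r ?powR_ge0 // -[leRHS]powRr1 //.
    by apply: ler_powR; [lra | rewrite /a; lra].
  have p1 : 0 < (ln (2 * X%:R)) `^ a by rewrite powR_gt0.
  have p2 : 0 < (ln x) `^ a by rewrite powR_gt0.
  rewrite mulrA ler_pdivrMr // mulrAC ler_pdivlMr //.
  nra.
rewrite div1r -[_ `^ _]/(powR _ _) powR12_sqrt; last by lra.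
have := upper (24 * X + 11)%N; rewrite sum1_iota => up.
apply: le_trans (_ : (count sqrsplit (iota 1 (24 * X + 11)))%:R <= _).
  by rewrite ler_nat count_odd_A_le.
apply: le_trans (up hX2) _.
rewrite (mulrC 35) -mulrA ler_pM2l // mulrA natrD natrM.
have s0 : 0 < Num.sqrt (ln x) by rewrite sqrtr_gt0.
have ss : Num.sqrt (ln x) <= Num.sqrt (ln (24%:R * X%:R + 11%:R)).
  by rewrite ler_wsqrtr // ler_ln ?posrE; lra.
apply: ler_pM; first by lra.
- by rewrite invr_ge0 sqrtr_ge0.
- by lra.
- by rewrite lef_pV2 ?posrE // (lt_le_trans s0).
Qed.
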